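(* Let $\Sigma=(A,B,C,\mathbf G)$ be a system node on $(U,X,U)$ for which there exists $E\in\mathcal L(U)$ such that $$\|z(\tau)\|^2-\|z_0\|^2\le 2\int_0^\tau \mathrm{Re}\,\langle u(t),y(t)\rangle\,dt+2\int_0^\tau \mathrm{Re}\,\langle Eu(t),u(t)\rangle\,dt$$ for all $(z_0,u)\in\mathcal D_0$ and all $\tau\ge 0$, where $z$ and $y$ are the state trajectory and output function of $\Sigma$ corresponding to the initial state $z_0$ and the input function $u$. Then there exists $\kappa_0>0$ (possibly $\kappa_0=\infty$) such that for all $\kappa\in(0,\kappa_0)$ the feedback law $u=-\kappa y+v$ (where $u$ and $y$ are the input and the output of $\Sigma$ and $v$ is the new input) leads to a well-posed closed-loop system $\Sigma^\kappa$ that is system stable; that is, $K=-\kappa I$ is a well-posed feedback operator for $\Sigma$ and the closed-loop system $\Sigma^\kappa$ is system stable. Moreover, the semigroup of $\Sigma^\kappa$ is a contraction semigroup.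
   Context: Spaces. $U,X,Y$ are complex Hilbert spaces. If $A:\mathcal D(A)\to X$ generates a strongly continuous semigroup $\mathbb T=(\mathbb T_t)_{t\ge0}$ on $X$ and $\alpha\in\rho(A)$, then $X_1$ is $\mathcal D(A)$ with the norm $\|(\alpha I-A)x\|$, and $X_{-1}$ is the completion of $X$ with respect to the norm $\|(\alpha I-A)^{-1}x\|$. The operator $A$ extends uniquely to an operator in $\mathcal L(X,X_{-1})$, and $(sI-A)^{-1}$ extends to an operator in $\mathcal L(X_{-1},X)$ for $s\in\rho(A)$. System node. A system node on $(U,X,Y)$ is $\Sigma=(A,B,C,\mathbf G)$, where $A$ generates a strongly continuous semigroup $\mathbb T$ on $X$, $B\in\mathcal L(U,X_{-1})$, $C\in\mathcal L(X_1,Y)$ and $\mathbf G:\rho(A)\to\mathcal L(U,Y)$ satisfies $\mathbf G(s)-\mathbf G(\beta)=C[(sI-A)^{-1}-(\beta I-A)^{-1}]B$ for all $s,\beta\in\rho(A)$. $(A,B,C)$ is its generating triple and $\mathbf G$ its transfer function. Trajectories. $\mathcal D_0$ is the set of pairs $(z_0,u)\in X\times C^2([0,\infty),U)$ with $Az_0+Bu(0)\in X$. For $(z_0,u)\in\mathcal D_0$ the equation $\dot z=Az+Bu$, $z(0)=z_0$, has a unique solution $z\in C^1([0,\infty),X)$ (the state trajectory), and the output function is the continuous function $y(t)=C[z(t)-(\beta I-A)^{-1}Bu(t)]+\mathbf G(\beta)u(t)$, independent of $\beta\in\rho(A)$. Well-posedness. $\Sigma$ is well-posed if for some (hence every) $t>0$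 there is $M_t\ge0$ with $\|z(t)\|^2+\|y\|^2_{L^2([0,t],Y)}\le M_t(\|z_0\|^2+\|u\|^2_{L^2([0,t],U)})$ for all $(z_0,u)\in\mathcal D_0$ and corresponding $z,y$. Then the maps $(z_0,u)\mapsto z,y$ extend by continuity to all $z_0\in X$, $u\in L^2_{loc}([0,\infty),U)$. System stability. A well-posed $\Sigma$ is: input stable if for every $v\in L^2([0,\infty),U)$ the state trajectory with zero initial state and input $v$ is bounded; output stable if for every $z_0\in X$ the output function with initial state $z_0$ and zero input is in $L^2([0,\infty),Y)$; input-output stable if for every $v\in L^2([0,\infty),U)$ the output function with zero initial state and input $v$ is in $L^2([0,\infty),Y)$ (equivalently, $\mathbf G$ is a bounded analytic function on the open right half-plane). It is system stable if all three hold. Feedback. $K\in\mathcal L(Y,U)$ is an admissible feedback operator for $\Sigma$ if the feedback $u=Ky+v$ results in a system node: $I-K\mathbf G(s)$ has a bounded inverse for all $s$ in some right half-plane and there is a system node $\Sigma^K=(A^K,B^K,C^K,\mathbf G^K)$ (the closed-loop system) such that, for $s\in\rho(A)\cap\rho(A^K)$, $\mathbf G^K=\mathbf G(I-K\mathbf G)^{-1}$, $(sI-A^K)^{-1}=(sI-A)^{-1}+(sI-A)^{-1}BK(I-\mathbf G(s)K)^{-1}C(sI-A)^{-1}$, $C^K(sI-A^K)^{-1}=(I-\mathbf G(s)K)^{-1}C(sI-A)^{-1}$ and $(sI-A^K)^{-1}B^K=(sI-A)^{-1}B(I-K\mathbf G(s))^{-1}$. It is a well-posed feedback operator if moreover $\Sigma^K$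 is well-posed. For $K=-\kappa I$ we write $\Sigma^\kappa$ for $\Sigma^K$. *)

(* Defs.v *)
From HB Require Import structures.
From mathcomp Require Import all_boot all_order all_algebra.
From mathcomp Require Import sesquilinear complex.
From mathcomp Require Import all_classical all_reals all_analysis.

Set Implicit Arguments.
Unset Strict Implicit.
Unset Printing Implicit Defensive.

Import Order.TTheory GRing.Theory Num.Theory.
Import numFieldNormedType.Exports.

Local Open Scope classical_set_scope.
Local Open Scope complex_scope.
Local Open Scope ring_scope.

(* The inner product is linear in its first argument and conjugate-linear in
   its second one. *)
HB.mixin Record CompleteNormedModule_isHilbert (R : realType) V
    of CompleteNormedModule R[i] V := {
  inner : {dot V for @Num.conj R[i]};
  inner_norm : forall x : V, inner x x = `|x| ^+ 2
}.

#[short(type="hilbertType")]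
HB.structure Definition Hilbert (R : realType) :=
  {V of CompleteNormedModule R[i] V & CompleteNormedModule_isHilbert R V}.

Section Analysis.
Context {R : realType}.
Implicit Types V W Z : completeNormedModType R[i].

(* The norm of a normed space over R[i] takes its values in R[i]. *)
Definition nrm V (x : V) : R := complex.Re `|x|.

Definition re_inner (H : hilbertType R) (x y : H) : R :=
  complex.Re (inner x y).

Definition bounded_linear V W (f : V -> W) : Prop := linear f /\ continuous f.

Definition is_inverse V (f g : V -> V) : Prop :=
  bounded_linear g /\ cancel f g /\ cancel g f.

(* The continuous linear map g such that g (e x) = f x for x in D; it is unique
   when the span of e @` D is dense, and it is 0 if no such map exists. *)
Definition extension V W Z (D : set V) (e : V -> W) (f : V -> Z) : W -> Z :=
  xget (fun=> 0)
    [set g : W -> Z | bounded_linear g /\ forall x, D x -> g (e x) = f x].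

Definition half_line : set R := [set` `[0, +oo[%R].

(* One-sided at t = 0. *)
Definition has_deriv V (f : R -> V) (t : R) (l : V) : Prop :=
  ((s - t)^-1)%:C *: (f s - f t) @[s --> within half_line t^'] --> l.

Definition is_C1 V (f f' : R -> V) : Prop :=
  (forall t : R, 0 <= t -> has_deriv f t (f' t)) /\
  {within half_line, continuous f'}.

Definition is_C2 V (f : R -> V) : Prop :=
  exists f' f'' : R -> V, is_C1 f f' /\ is_C1 f' f''.

Definition simple_map V (f : R -> V) : Prop :=
  finite_set (range f) /\ forall c, measurable (f @^-1` [set c]).

(* Bochner measurability on [0, oo). The limit is required at every point and
   not only almost everywhere: every class of functions modulo null sets has
   such a representative. *)
Definition strongly_measurable V (f : R -> V) : Prop :=
  exists2 s : nat -> R -> V, (forall n, simple_map (s n)) &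
    forall t : R, 0 <= t -> s n t @[n --> \oo] --> f t.

Definition sq_norm_L2 V (D : set R) (f : R -> V) : \bar R :=
  (\int[lebesgue_measure]_(t in D) (nrm (f t) ^+ 2)%:E)%E.

Definition in_L2 V (f : R -> V) : Prop :=
  strongly_measurable f /\ (sq_norm_L2 half_line f < +oo)%E.

Definition in_L2loc V (f : R -> V) : Prop :=
  strongly_measurable f /\ forall t : R, 0 <= t -> (sq_norm_L2 `[0%R, t] f < +oo)%E.

Definition cvg_L2loc V (f_ : nat -> R -> V) (f : R -> V) : Prop :=
  forall t : R, 0 <= t ->
    sq_norm_L2 `[0, t] (fun s => f_ n s - f s) @[n --> \oo] --> 0%E.

(* A partially defined operator; the values outside of [dom] are irrelevant. *)
Record unbounded V := Unbounded { dom : set V; op :> V -> V }.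

(* Only the restriction of T to [0, oo) matters. *)
Definition is_C0_semigroup V (T : R -> V -> V) : Prop :=
  [/\ forall t : R, 0 <= t -> bounded_linear (T t),
      T 0 = id,
      forall s t : R, 0 <= s -> 0 <= t -> T (s + t) = T s \o T t &
      forall x, T t x @[t --> 0^'+] --> x].

Definition generates V (A : unbounded V) (T : R -> V -> V) : Prop :=
  is_C0_semigroup T /\
  forall x y, (dom A x /\ A x = y) <->
    (h^-1)%:C *: (T h x - x) @[h --> 0^'+] --> y.

Definition contraction_semigroup V (T : R -> V -> V) : Prop :=
  forall (t : R) x, 0 <= t -> nrm (T t x) <= nrm x.

Definition is_resolvent V (A : unbounded V) (s : R[i]) (Q : V -> V) : Prop :=
  [/\ bounded_linear Q,
      forall x, dom A (Q x) /\ s *: Q x - A (Q x) = x &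
      forall x, dom A x -> Q (s *: x - A x) = x].

Definition rho V (A : unbounded V) : set R[i] :=
  [set s | exists Q, is_resolvent A s Q].

(* The operator (sI - A)^-1, for s in rho A. *)
Definition resolvent V (A : unbounded V) (s : R[i]) : V -> V :=
  xget (fun=> 0) [set Q | is_resolvent A s Q].

(* A completion X_{-1} of V for the norm |(alpha I - A)^-1 x|. *)
Record extrapolation V (A : unbounded V) (alpha : R[i]) := Extrapolation {
  ext_space :> completeNormedModType R[i];
  emb : V -> ext_space;
  emb_linear : linear emb;
  emb_norm : forall x, `|emb x| = `|resolvent A alpha x|;
  emb_dense : dense (range emb)
}.

Definition ext_op V (A : unbounded V) alpha (W : extrapolation A alpha) :
    V -> W :=
  extension (dom A) id (@emb V A alpha W \o A).

Definition ext_resolvent V (A : unbounded V) alpha (W : extrapolation A alpha)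
    (s : R[i]) : W -> V :=
  extension setT (@emb V A alpha W) (resolvent A s).

End Analysis.

Arguments emb {R V A alpha} e x.
Arguments ext_op {R V A alpha} W x.
Arguments ext_resolvent {R V A alpha} W s w.

Section SystemNodes.
Context {R : realType}.
Implicit Types U X Y : hilbertType R.

(* opC_bounded: X_1 is dom A with the norm |(alpha I - A) x|.
   transfer_diff: the argument of opC is in dom A, although neither of its two
   terms need be. *)
Record sysnode U X Y := SysNode {
  opA : unbounded X;
  semigroup : R -> X -> X;
  alpha : R[i];
  Xm1 : extrapolation opA alpha;
  opB : U -> Xm1;
  opC : X -> Y;
  transfer : R[i] -> U -> Y;
  opA_generates : generates opA semigroup;
  alpha_rho : rho opA alpha;
  opB_bounded : bounded_linear opB;
  opC_linear : forall (a : R[i]) x y, dom opA x -> dom opA y ->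
    opC (a *: x + y) = a *: opC x + opC y;
  opC_bounded : exists M : R, forall x, dom opA x ->
    nrm (opC x) <= M * nrm (alpha *: x - opA x);
  transfer_bounded : forall s, rho opA s -> bounded_linear (transfer s);
  transfer_diff : forall s b, rho opA s -> rho opA b -> forall u,
    transfer s u - transfer b u =
    opC (ext_resolvent Xm1 s (opB u) - ext_resolvent Xm1 b (opB u))
}.

Section Trajectories.
Context {U X Y : hilbertType R} (S : sysnode U X Y).
Implicit Types (z : R -> X) (u : R -> U) (y : R -> Y).

Definition in_D0 (z0 : X) u : Prop :=
  is_C2 u /\ exists x, ext_op (Xm1 S) z0 + opB S (u 0) = emb (Xm1 S) x.

Definition state_trajectory (z0 : X) u z : Prop :=
  z 0 = z0 /\ exists2 z', is_C1 z z' &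
    forall t : R, 0 <= t -> emb (Xm1 S) (z' t) = ext_op (Xm1 S) (z t) + opB S (u t).

Definition output_function u z y : Prop :=
  forall b (t : R), rho (opA S) b -> 0 <= t ->
    y t = opC S (z t - ext_resolvent (Xm1 S) b (opB S (u t)))
          + transfer S b (u t).

Definition classical_trajectory (z0 : X) u z y : Prop :=
  [/\ in_D0 z0 u, state_trajectory z0 u z & output_function u z y].

Definition well_posed : Prop :=
  exists2 t : R, 0 < t & exists2 M : R, 0 <= M &
    forall (z0 : X) u z y, classical_trajectory z0 u z y ->
      ((nrm (z t) ^+ 2)%:E + sq_norm_L2 `[0%R, t] y <=
       M%:E * ((nrm z0 ^+ 2)%:E + sq_norm_L2 `[0%R, t] u))%E.

(* The extension by continuity of (z0, u) |-> (z, y) from in_D0 to X * L2loc;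
   if S is well-posed, then for u in L2loc the state trajectory z is unique on
   [0, oo), and the output function y is unique almost everywhere. *)
Definition trajectory (z0 : X) u z y : Prop :=
  [/\ in_L2loc u, in_L2loc y &
   exists (z0_ : nat -> X) (u_ : nat -> R -> U)
          (z_ : nat -> R -> X) (y_ : nat -> R -> Y),
   [/\ forall n, classical_trajectory (z0_ n) (u_ n) (z_ n) (y_ n),
       z0_ n @[n --> \oo] --> z0,
       cvg_L2loc u_ u,
       forall t : R, 0 <= t -> z_ n t @[n --> \oo] --> z t &
       cvg_L2loc y_ y]].

Definition input_stable : Prop :=
  forall v, in_L2 v -> exists z y, trajectory 0 v z y /\
    exists M : R, forall t : R, 0 <= t -> nrm (z t) <= M.

Definition output_stable : Prop :=
  forall z0 : X, exists z y, trajectory z0 (fun=> 0) z y /\ in_L2 y.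

Definition io_stable : Prop :=
  forall v, in_L2 v -> exists z y, trajectory 0 v z y /\ in_L2 y.

Definition system_stable : Prop :=
  [/\ well_posed, input_stable, output_stable & io_stable].

End Trajectories.

(* SK is the closed-loop system obtained from S with the feedback u = K y + v;
   P is (I - K G(s))^-1 and Q is (I - G(s) K)^-1. *)
Definition closed_loop U X Y (S : sysnode U X Y) (K : Y -> U)
    (SK : sysnode U X Y) : Prop :=
  let G := transfer S in
  (exists omega : R, forall s : R[i], omega < complex.Re s ->
     rho (opA S) s /\ exists P, is_inverse (fun u => u - K (G s u)) P) /\
  (forall s, rho (opA S) s -> rho (opA SK) s -> exists P Q,
     [/\ is_inverse (fun u => u - K (G s u)) P,
         is_inverse (fun y => y - G s (K y)) Q,
         forall u, transfer SK s u = G s (P u) &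
      [/\ forall x, resolvent (opA SK) s x =
            resolvent (opA S) s x +
            ext_resolvent (Xm1 S) s
              (opB S (K (Q (opC S (resolvent (opA S) s x))))),
          forall x, opC SK (resolvent (opA SK) s x) =
            Q (opC S (resolvent (opA S) s x)) &
          forall u, ext_resolvent (Xm1 SK) s (opB SK u) =
            ext_resolvent (Xm1 S) s (opB S (P u))]]).

Definition well_posed_feedback U X Y (S : sysnode U X Y) (K : Y -> U) : Prop :=
  bounded_linear K /\ exists2 SK, closed_loop S K SK & well_posed SK.

End SystemNodes.

(* Main.v *)
(* A system node is handled through the relation [node x u z y]: z = A x + B
   u lies in X and y is the output of (x, u). Taking the dissipation
   inequality to first order at time 0, along the explicit trajectory e^(rt)
   H_r u + T_t (x - H_r u) with H_r = (r - A)^-1 B, gives Re <x, z> <= Re <u,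
   y> + Re <E u, u> for all such (x, u, z, y). For k |E| < 1 this makes I + k
   G(s) coercive on the right half-plane, and with u = v - k y it becomes a
   strict inequality 2 Re <x, z> <= a |v|^2 - b |y|^2, with b > 0, for the
   closed loop. Hence the closed-loop main operator is maximal dissipative
   and generates a contraction semigroup (Hille-Yosida), and integration in
   time yields |z(t)|^2 + b |y|^2_{L2[0,t]} <= |z_0|^2 + a |v|^2_{L2[0,t]}
   with a and b independent of t: this is at once well-posedness and the
   three stabilities. A trajectory with an arbitrary L2 input is obtained as
   the limit of those with inputs t |-> sum_j e^(r_j t) c_j, which are dense
   in every L2[0, n] and have explicit classical trajectories. *)

Require Import Defs.
From HB Require Import structures.
From mathcomp Require Import all_boot all_order all_algebra.
From mathcomp Require Import sesquilinear complex.
From mathcomp Require Import all_classical all_reals all_analysis.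
From mathcomp Require Import measurable_realfun ring lra.

Set Implicit Arguments.
Unset Strict Implicit.
Unset Printing Implicit Defensive.

Import Order.TTheory GRing.Theory Num.Theory.
Import numFieldNormedType.Exports.

Local Open Scope classical_set_scope.
Local Open Scope complex_scope.
Local Open Scope ring_scope.

(** * Normed and Hilbert spaces over R[i] *)

Section Norm.
Context {R : realType}.
Implicit Types V W : completeNormedModType R[i].

(** The obstacle is that the closed-loop operator cannot be written as [A + B K C]: [B u] lies
    outside [X], and [C] acts only on [dom A], whereas a state driven by a nonzero input lies in
    [dom A] only after subtracting [H_b u]. The relation [node] is the graph of the whole node, so
    feedback becomes a substitution in that graph; invertibility of [I + k G(s)] gives existence
    there and dissipation gives uniqueness. The dissipation inequality has to be differentiated
    because it is assumed for C^2 inputs only: along a classical closed-loop trajectory,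
    [u = v - k y] is merely continuous, so the integrated inequality for [S] does not apply to it.
    The definition of a closed loop supplies only resolvent identities. Stability is therefore
    derived for every node satisfying them, and the constructed node serves for existence. Its
    extrapolation space, input operator and transfer function are all written relative to the single
    point 1. *)

Lemma nrmE V (x : V) : `|x| = (nrm x)%:C.
Proof. by rewrite /nrm RRe_real // ger0_real. Qed.

Lemma nrm_ge0 V (x : V) : 0 <= nrm x.
Proof. by rewrite -ler0c -nrmE. Qed.

Lemma nrm0 V : nrm (0 : V) = 0.
Proof. by rewrite /nrm normr0. Qed.

Lemma nrm0_eq0 V (x : V) : nrm x = 0 -> x = 0.
Proof. by move=> h; apply/eqP; rewrite -normr_eq0 nrmE h. Qed.

Lemma nrmD V (x y : V) : nrm (x + y) <= nrm x + nrm y.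
Proof. by rewrite -lecR rmorphD /= -!nrmE ler_normD. Qed.

Lemma nrmN V (x : V) : nrm (- x) = nrm x.
Proof. by rewrite /nrm normrN. Qed.

Lemma nrmB V (x y : V) : nrm (x - y) <= nrm x + nrm y.
Proof. by rewrite -(nrmN y) nrmD. Qed.

Lemma nrm_sym V (x y : V) : nrm (x - y) = nrm (y - x).
Proof. by rewrite -nrmN opprB. Qed.

Definition modc (a : R[i]) : R := complex.Re `|a|.

Lemma modcE (a : R[i]) : `|a| = (modc a)%:C.
Proof. by rewrite /modc RRe_real // ger0_real. Qed.

Lemma modc_ge0 (a : R[i]) : 0 <= modc a.
Proof. by rewrite -ler0c -modcE. Qed.

Lemma modcR (a : R) : modc a%:C = `|a|.
Proof. by rewrite /modc normc_def /= expr0n addr0 sqrtr_sqr. Qed.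

Lemma nrmZ V a (x : V) : nrm (a *: x) = modc a * nrm x.
Proof. by rewrite /nrm normrZ !nrmE modcE /= mul0r subr0. Qed.

Lemma nrmZR V (a : R) (x : V) : nrm (a%:C *: x) = `|a| * nrm x.
Proof. by rewrite nrmZ modcR. Qed.

Lemma nrm_triangle V (z x y : V) : nrm (x - y) <= nrm (x - z) + nrm (z - y).
Proof. by apply: le_trans (nrmD _ _); rewrite addrA subrK. Qed.

Lemma nrm_dist V (x y : V) : `|nrm x - nrm y| <= nrm (x - y).
Proof.
have := nrmD (x - y) y; have := nrmD (y - x) x; rewrite !subrK (nrm_sym y x).
by move=> h1 h2; rewrite ler_norml; apply/andP; split; lra.
Qed.

(** A positive element of [R[i]] is real, so real radii suffice; all later estimates can stay in [R]
    although norms take values in [R[i]]. *)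
Lemma cvg_nrmP V (T : Type) (F : set_system T) (FF : Filter F) (f : T -> V) l :
  f @ F --> l <-> forall e : R, 0 < e -> \forall x \near F, nrm (f x - l) < e.
Proof.
split=> [/cvgrPdist_lt h e e0|h].
  have := h e%:C; rewrite (ltcR 0) => /(_ e0); apply: filterS => x.
  by rewrite nrmE ltcR nrm_sym.
apply/cvgrPdist_lt => e e0.
have eE : e = (complex.Re e)%:C by rewrite RRe_real // gtr0_real.
rewrite eE (ltcR 0) in e0; have := h _ e0; apply: filterS => x.
by rewrite eE nrmE ltcR nrm_sym.
Qed.

Lemma cvg_nrm0P V (T : Type) (F : set_system T) (FF : Filter F) (f : T -> V) l :
  f @ F --> l <-> (fun x => nrm (f x - l)) @ F --> (0 : R).
Proof.
rewrite cvg_nrmP; split=> h.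
  apply/cvgrPdist_lt => e /h; apply: filterS => x.
  by rewrite sub0r normrN ger0_norm ?nrm_ge0.
move=> e e0; move/cvgrPdist_lt : h => /(_ e e0); apply: filterS => x.
by rewrite sub0r normrN ger0_norm ?nrm_ge0.
Qed.

End Norm.

Section BoundedLinear.
Context {R : realType}.
Implicit Types V W Z : completeNormedModType R[i].

Lemma lin0 V W (f : V -> W) : linear f -> f 0 = 0.
Proof. by move=> h; have := h (-1) 0 0; rewrite scaleN1r oppr0 addr0 scaleN1r addNr. Qed.

Lemma linZ V W (f : V -> W) : linear f -> forall a x, f (a *: x) = a *: f x.
Proof. by move=> h a x; rewrite -[a *: x]addr0 h lin0 ?addr0. Qed.

Lemma linD V W (f : V -> W) : linear f -> forall x y, f (x + y) = f x + f y.
Proof. by move=> h x y; have := h 1 x y; rewrite !scale1r. Qed.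

Lemma linN V W (f : V -> W) : linear f -> forall x, f (- x) = - f x.
Proof. by move=> h x; rewrite -scaleN1r linZ // scaleN1r. Qed.

Lemma linB V W (f : V -> W) : linear f -> forall x y, f (x - y) = f x - f y.
Proof. by move=> h x y; rewrite linD // linN. Qed.

Lemma cvg_bound V W (T : Type) (F : set_system T) (FF : Filter F)
    (f : T -> V) l (g : T -> W) k (M : R) :
  (forall x, nrm (g x - k) <= M * nrm (f x - l)) ->
  f @ F --> l -> g @ F --> k.
Proof.
move=> h /cvg_nrmP fl; apply/cvg_nrmP => e e0.
have M0 : 0 < `|M| + 1 by rewrite ltr_wpDl.
have := fl (e / (`|M| + 1)); rewrite divr_gt0 // => /(_ isT).
apply: filterS => x; rewrite ltr_pdivlMr // => hx.
apply: le_lt_trans (h x) (le_lt_trans _ hx).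
rewrite mulrC ler_wpM2l ?nrm_ge0 //.
by apply: le_trans (ler_norm _) _; rewrite lerDl.
Qed.

Lemma bounded_linearP V W (f : V -> W) :
  bounded_linear f <->
  linear f /\ exists2 M : R, 0 <= M & forall x, nrm (f x) <= M * nrm x.
Proof.
split=> [[lf cf]|[lf [M M0 hM]]]; last first.
  split=> // x; apply: (@cvg_bound _ _ _ _ _ id x f (f x) M) => [y|].
    by rewrite -linB.
  exact: cvg_id.
split=> //; have /cvg_nrmP h : f x @[x --> (0:V)] --> f 0 by exact: cf.
have /nbhs_ballP[e /= e0 he] : nbhs (0:V) (fun x => nrm (f x - f 0) < 1) by exact: h.
set d : R := complex.Re e.
have eE : e = d%:C by rewrite RRe_real // gtr0_real.
have d0 : 0 < d by rewrite -(ltcR 0) -eE.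
exists (2 / d); first by rewrite divr_ge0 // ltW.
move=> x; have [->|x0] := eqVneq x 0; first by rewrite lin0 // !nrm0 mulr0.
have nx : 0 < nrm x by rewrite lt_neqAle nrm_ge0 andbT eq_sym; apply: contra_neq x0 => /nrm0_eq0.
(* The vector is rescaled to norm [d / 2], inside the ball where [f] stays below 1. *)
have c0 : 0 < d / (2 * nrm x) by rewrite divr_gt0 // mulr_gt0.
have hc : nrm ((d / (2 * nrm x))%:C *: x) < d.
  rewrite nrmZR gtr0_norm // -mulrA invfM -mulrA mulVf ?gt_eqF // mulr1.
  by rewrite ltr_pdivrMr // ltr_pMr // ltr1n.
have : ball (0:V) e ((d / (2 * nrm x))%:C *: x).
  by rewrite -ball_normE /= sub0r normrN nrmE eE ltcR.
move=> /he; rewrite lin0 // subr0 linZ // nrmZR gtr0_norm //.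
move=> /ltW; rewrite -ler_pdivlMl // mulr1 invfM invrK mulrAC => hx.
by rewrite -mulrA [nrm x / d]mulrC mulrCA.
Qed.

Lemma bounded_linear_comp V W Z (f : W -> Z) (g : V -> W) :
  bounded_linear f -> bounded_linear g -> bounded_linear (f \o g).
Proof.
move=> [lf cf] [lg cg]; split=> [a x y /=|x]; first by rewrite lg lf.
exact: (continuous_comp (cg x) (cf _)).
Qed.

Lemma bounded_linearD V W (f g : V -> W) :
  bounded_linear f -> bounded_linear g -> bounded_linear (fun x => f x + g x).
Proof.
move=> [lf cf] [lg cg]; split=> [a x y /=|x]; last exact: (cvgD (cf x) (cg x)).
by rewrite lf lg scalerDr addrACA.
Qed.

Lemma bounded_linearZ V W (a : R[i]) (f : V -> W) :
  bounded_linear f -> bounded_linear (fun x => a *: f x).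
Proof.
move=> [lf cf]; split=> [b x y /=|x]; last exact: (cvgZl_tmp (cf x)).
by rewrite lf scalerDr !scalerA mulrC.
Qed.

Lemma bounded_linear_id V : bounded_linear (@id V).
Proof. by split=> // x; exact: cvg_id. Qed.

Lemma bounded_linearB V W (f g : V -> W) :
  bounded_linear f -> bounded_linear g -> bounded_linear (fun x => f x - g x).
Proof.
move=> bf bg; have -> : (fun x => f x - g x) = (fun x => f x + -1 *: g x).
  by apply/funext => x; rewrite scaleN1r.
exact/bounded_linearD/bounded_linearZ.
Qed.

Lemma cauchy_seq_cvg V (u : nat -> V) (e : nat -> R) :
  e n @[n --> \oo] --> (0 : R) ->
  (forall n k, nrm (u (n + k)%N - u n) <= e n) -> exists l : V, u n @[n --> \oo] --> l.
Proof.
move=> e0 h; suff : cvgn u by move=> c; exists (lim (u @ \oo)).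
apply/cauchy_cvgP/cauchy_ballP => d d0.
have dE : d = (complex.Re d)%:C by rewrite RRe_real // gtr0_real.
have d0' : 0 < complex.Re d by rewrite -(ltcR 0) -dE.
have hN : \forall n \near \oo, e n < complex.Re d / 2.
  by apply: (cvgr_lt _ e0); rewrite divr_gt0.
have [N _ HN] := hN.
have near_N : \forall n \near \oo, nrm (u n - u N) < complex.Re d / 2.
  near=> n; have Nn : (N <= n)%N by near: n; exists N.
  by rewrite -(subnKC Nn) (le_lt_trans (h _ _)) // HN /=.
exists ([set x | nrm (x - u N) < complex.Re d / 2],
        [set x | nrm (x - u N) < complex.Re d / 2]) => [//|].
move=> [x y] /= [hx hy]; rewrite -ball_normE /= dE nrmE ltcR.
by apply: le_lt_trans (nrm_triangle (u N) _ _) _; rewrite (nrm_sym (u N)); lra.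
Unshelve. all: by end_near. Qed.

Lemma geometric_cvg V (u : nat -> V) (C q : R) :
  0 <= C -> 0 <= q < 1 -> (forall n, nrm (u n.+1 - u n) <= C * q ^+ n) ->
  exists l : V, u n @[n --> \oo] --> l.
Proof.
move=> C0 /andP[q0 q1] h; apply: (@cauchy_seq_cvg _ _ (fun n => C / (1 - q) * q ^+ n)).
  rewrite -[X in _ --> X](mulr0 (C / (1 - q))); apply: cvgMl_tmp.
  by apply: cvg_expr; rewrite ger0_norm.
have q1' : 0 < 1 - q by rewrite subr_gt0.
(* The factor [1 - q ^+ k] is the exact partial geometric sum; without it the induction on [k] does
   not close. *)
move=> n k; suff : nrm (u (n + k)%N - u n) <= C / (1 - q) * q ^+ n * (1 - q ^+ k).
  move=> /le_trans; apply; rewrite ler_piMr //; last by rewrite gerBl exprn_ge0.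
  by rewrite !mulr_ge0 ?exprn_ge0 // invr_ge0 ltW.
elim: k => [|k IH]; first by rewrite addn0 subrr nrm0 expr0 subrr mulr0.
apply: le_trans (nrm_triangle (u (n + k)%N) _ _) _.
rewrite addnS; apply: le_trans (lerD (h _) IH) _.
rewrite exprD exprS le_eqVlt; apply/orP; left; apply/eqP.
by field; rewrite gt_eqF.
Qed.

(** Neumann series: the preimage of [f] is the limit of the iteration [u -> f + B u]. The lower
    bound [(1 - q) |x| <= |x - B x|] yields both injectivity and boundedness of the inverse. *)
Lemma inverse_near_id V (B : V -> V) (q : R) :
  linear B -> 0 <= q < 1 -> (forall x, nrm (B x) <= q * nrm x) ->
  exists P, is_inverse (fun x => x - B x) P.
Proof.
move=> lB /[dup] q01 /andP[q0 q1] hB.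
have low x : (1 - q) * nrm x <= nrm (x - B x).
  have := nrmD (x - B x) (B x); rewrite subrK => /le_trans /(_ (lerD (lexx _) (hB x))).
  by move=> ?; lra.
have q1' : 0 < 1 - q by rewrite subr_gt0.
have /choice[P hP] : forall f, exists x, x - B x = f.
  move=> f; pose u := fix u n : V := if n is k.+1 then f + B (u k) else 0.
  have [n|l ul] := @geometric_cvg _ u (nrm f) q (nrm_ge0 _) q01.
    elim: n => [|n IH]; first by rewrite /= lin0 // addr0 subr0 expr0 mulr1.
    have -> : u n.+2 - u n.+1 = B (u n.+1 - u n).
      by rewrite [u n.+2]/(f + B (u n.+1)) {2}[u n.+1]/(f + B (u n)) linB // opprD addrACA subrr add0r.
    apply: le_trans (hB _) _; rewrite exprS mulrCA.
    by apply: ler_wpM2l.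
  exists l; have cB : continuous B.
    by apply: (proj2 (_ : bounded_linear B)); apply/bounded_linearP; split => //; exists q.
  have h1 : u n.+1 @[n --> \oo] --> f + B l.
    by apply: cvgD; [exact: cvg_cst | exact: (cvg_comp _ _ ul (cB l))].
  have h2 : u n.+1 @[n --> \oo] --> l by rewrite (@cvg_shiftS _ u).
  by rewrite {1}(cvg_unique _ h2 h1) // addrK.
pose L x := x - B x.
have lL : linear L by move=> a x y; rewrite /L lB scalerBr opprD addrACA.
have inj x y : L x = L y -> x = y.
  move=> h; apply/eqP; rewrite -subr_eq0; apply/eqP/nrm0_eq0/le_anti.
  rewrite nrm_ge0 andbT -(pmulr_rle0 _ q1').
  by apply: le_trans (low _) _; rewrite -[X in nrm X]/(L (x - y)) (linB lL) h subrr nrm0.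
have {}hP x : L (P x) = x by exact: hP.
exists P; split; last by split=> x; [apply: inj; exact: hP|exact: hP].
apply/bounded_linearP; split.
  by move=> a x y; apply: inj; rewrite lL !hP.
exists (1 - q)^-1; first by rewrite invr_ge0 ltW.
by move=> x; rewrite ler_pdivlMl // -{2}(hP x) low.
Qed.

End BoundedLinear.

(** * Real inner product, orthogonality and density, coercive operators *)

Section Hilbert.
Context {R : realType}.

Implicit Types H : hilbertType R.

Lemma conj_conjc (z : R[i]) : Num.conj z = conjc z.
Proof.
have [->|z0] := eqVneq z 0; first by rewrite rmorph0 conjc0.
by apply: (mulfI z0); rewrite -normCK sqr_normc.
Qed.

Lemma riC H (x y : H) : re_inner x y = re_inner y x.
Proof.
rewrite /re_inner hermC expr0 mul1r.
have h : complex.Re (Num.conj (inner y x)) = complex.Re (inner y x).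
  by rewrite conj_conjc; case: (inner y x).
exact: h.
Qed.

Lemma riDl H (x y z : H) : re_inner (x + y) z = re_inner x z + re_inner y z.
Proof. by rewrite /re_inner linearDl raddfD. Qed.

Lemma riDr H (x y z : H) : re_inner z (x + y) = re_inner z x + re_inner z y.
Proof. by rewrite !(riC z) riDl. Qed.

Lemma riNl H (x z : H) : re_inner (- x) z = - re_inner x z.
Proof. by rewrite /re_inner linearNl raddfN. Qed.

Lemma riNr H (x z : H) : re_inner z (- x) = - re_inner z x.
Proof. by rewrite !(riC z) riNl. Qed.

Lemma riBl H (x y z : H) : re_inner (x - y) z = re_inner x z - re_inner y z.
Proof. by rewrite riDl riNl. Qed.

Lemma riBr H (x y z : H) : re_inner z (x - y) = re_inner z x - re_inner z y.
Proof. by rewrite riDr riNr. Qed.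

Lemma riZl H (a : R) (x z : H) : re_inner (a%:C *: x) z = a * re_inner x z.
Proof.
rewrite /re_inner linearZl_LR /=; case: (inner x z) => b c /=.
by rewrite mul0r subr0.
Qed.

Lemma riZr H (a : R) (x z : H) : re_inner z (a%:C *: x) = a * re_inner z x.
Proof. by rewrite !(riC z) riZl. Qed.

Lemma ri0l H (z : H) : re_inner 0 z = 0.
Proof. by rewrite -(subrr z) riBl subrr. Qed.

Lemma ri0r H (z : H) : re_inner z 0 = 0.
Proof. by rewrite riC ri0l. Qed.

Lemma ri_self H (x : H) : re_inner x x = nrm x ^+ 2.
Proof. by rewrite /re_inner inner_norm nrmE -rmorphXn. Qed.

Lemma riZ_self H (s : R[i]) (x : H) :
  re_inner (s *: x) x = complex.Re s * nrm x ^+ 2.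
Proof.
rewrite /re_inner linearZl_LR /= inner_norm nrmE -rmorphXn /=.
by case: s => a b /=; rewrite mulr0 subr0.
Qed.

Lemma nrm_sqD H (x y : H) :
  nrm (x + y) ^+ 2 = nrm x ^+ 2 + 2 * re_inner x y + nrm y ^+ 2.
Proof. by rewrite -!ri_self riDl !riDr (riC y x); ring. Qed.

Lemma nrm_sqB H (x y : H) :
  nrm (x - y) ^+ 2 = nrm x ^+ 2 - 2 * re_inner x y + nrm y ^+ 2.
Proof. by rewrite nrm_sqD riNr nrmN mulrN. Qed.

Lemma ri_le H (x y : H) : re_inner x y <= nrm x * nrm y.
Proof.
have [x0|x0] := eqVneq (nrm x) 0.
  by rewrite (nrm0_eq0 x0) ri0l nrm0 mul0r.
have [y0|y0] := eqVneq (nrm y) 0.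
  by rewrite (nrm0_eq0 y0) ri0r nrm0 mulr0.
have xp : 0 < nrm x by rewrite lt_neqAle eq_sym x0 nrm_ge0.
have yp : 0 < nrm y by rewrite lt_neqAle eq_sym y0 nrm_ge0.
(* The square expands to [2 |x| |y| (|x| |y| - <x, y>)]. *)
have := sqr_ge0 (nrm ((nrm y)%:C *: x - (nrm x)%:C *: y)).
rewrite nrm_sqB !nrmZR riZl riZr !ger0_norm ?nrm_ge0 // => h.
have h2 : 0 <= (2 * (nrm x * nrm y)) * (nrm x * nrm y - re_inner x y).
  by apply: le_trans h _; rewrite le_eqVlt; apply/orP; left; apply/eqP; ring.
by rewrite pmulr_rge0 ?subr_ge0 ?mulr_gt0 // in h2.
Qed.

Lemma ri_abs_le H (x y : H) : `|re_inner x y| <= nrm x * nrm y.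
Proof.
by rewrite ler_norml ri_le andbT -[X in _ <= X]opprK lerN2 -riNl -(nrmN x) ri_le.
Qed.

Lemma cvg_ri H (T : Type) (F : set_system T) (FF : Filter F) (f g : T -> H) a b :
  f @ F --> a -> g @ F --> b -> re_inner (f x) (g x) @[x --> F] --> re_inner a b.
Proof.
move=> fa gb.
have fa' : f x - a @[x --> F] --> (0 : H) by rewrite -(subrr a); apply: cvgB => //; exact: cvg_cst.
have gb' : g x - b @[x --> F] --> (0 : H) by rewrite -(subrr b); apply: cvgB => //; exact: cvg_cst.
have n0 (h : T -> H) : h @ F --> (0 : H) -> nrm (h x) @[x --> F] --> (0 : R).
  by move=> /cvg_nrm0P; under eq_fun do rewrite subr0.
have -> : (fun x => re_inner (f x) (g x)) = (fun x => re_inner a b + (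
   re_inner (f x - a) (g x - b) + re_inner (f x - a) b + re_inner a (g x - b))).
  by apply/funext => x; rewrite !(riBl, riBr); ring.
rewrite -[X in _ --> X]addr0; apply: cvgD; first exact: cvg_cst.
have h1 := n0 _ fa'; have h2 := n0 _ gb'.
pose h x := nrm (f x - a) * nrm (g x - b) + nrm (f x - a) * nrm b + nrm a * nrm (g x - b).
have : h x @[x --> F] --> (0 * 0 + 0 * nrm b + nrm a * 0 : R).
  by repeat first [apply: cvgD | apply: cvgM | exact: cvg_cst | by []].
rewrite !mul0r mulr0 !addr0 => hF.
apply/cvgr0Pnorm_lt => e e0; have := @cvgr0_norm_lt _ _ _ _ _ h hF e e0 => /(_ FF).
apply: filterS => x; apply: le_lt_trans.
rewrite [leRHS]ger0_norm; last by rewrite !addr_ge0 ?mulr_ge0 ?nrm_ge0.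
rewrite (le_trans (ler_normD _ _)) // lerD ?ri_abs_le //.
by rewrite (le_trans (ler_normD _ _)) // lerD ?ri_abs_le.
Qed.

Lemma cvg_nrm (V : completeNormedModType R[i]) (T : Type) (F : set_system T) (FF : Filter F) (f : T -> V) a :
  f @ F --> a -> nrm (f x) @[x --> F] --> nrm a.
Proof.
move=> /cvg_nrmP h; apply/cvgrPdist_lt => e /h; apply: filterS => x.
by rewrite nrm_sym; apply: le_lt_trans (nrm_dist _ _).
Qed.

Definition subspace_closed (V : lmodType R[i]) (D : set V) :=
  D 0 /\ forall (a : R[i]) x y, D x -> D y -> D (a *: x + y).

(** Projection argument: a minimizing sequence for the distance from [w] to [D] is Cauchy by the
    parallelogram identity, and [w] minus its limit is orthogonal to [D], hence 0. As [D] need not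
    be closed, the limit may lie outside [D]. *)
Lemma dense_of_orthogonal H (D : set H) :
  subspace_closed D -> (forall y, (forall x, D x -> re_inner x y = 0) -> y = 0) ->
  forall (w : H) (e : R), 0 < e -> exists2 x, D x & nrm (w - x) < e.
Proof.
move=> [D0 DS] orth w e e0.
pose A := [set nrm (w - x) ^+ 2 | x in D].
have A0 : A !=set0 by exists (nrm (w - 0) ^+ 2), 0.
have lbA : lbound A 0 by move=> _ [x _ <-]; exact: sqr_ge0.
have hA : has_inf A by split=> //; exists 0.
pose d := inf A.
have dle x : D x -> d <= nrm (w - x) ^+ 2 by move=> Dx; apply: ge_inf; [exists 0|exists x].
(* Squared distances within [4^-n] of the infimum make the increments of order [2^-n]. *)
have /choice[u hu] : forall n : nat, exists x, D x /\ nrm (w - x) ^+ 2 < d + (4^-1 : R) ^+ n.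
  move=> n; have e' : 0 < (4^-1 : R) ^+ n by rewrite exprn_gt0 // invr_gt0.
  by have [_ [x Dx <-] hx] := inf_adherent e' hA; exists x.
have half01 : 0 <= (2^-1 : R) < 1 by rewrite invr_ge0 ler0n /= invf_lt1 // ltr1n.
have [n|p up] := @geometric_cvg _ _ u 2 2^-1 (ler0n _ 2) half01.
- have [Dn hn] := hu n; have [Dn1 hn1] := hu n.+1.
  (* The midpoint of two consecutive terms, which lies in [D] and so is at squared distance at least
     [d]. *)
  have Dm : D (2^-1%:C *: (u n.+1 - u n) + u n).
    by have := DS (-1) _ _ Dn Dn1; rewrite scaleN1r addrC => h; exact: DS.
  have hm := dle _ Dm.
  have eq1 : nrm (u n.+1 - u n) ^+ 2 = 2 * nrm (w - u n) ^+ 2 + 2 * nrm (w - u n.+1) ^+ 2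
      - 4 * nrm (w - (2^-1%:C *: (u n.+1 - u n) + u n)) ^+ 2.
    rewrite -!ri_self !(riBl, riBr, riDl, riDr, riZl, riZr) (riC (u n) w) (riC (u n.+1) w) (riC (u n.+1) (u n)).
    by field.
  have q : (4^-1 : R) ^+ n = (2^-1 ^+ n) ^+ 2 by rewrite -exprM mulnC exprM; congr (_ ^+ _); field.
  rewrite -(@ler_pXn2r _ 2) ?nnegrE ?nrm_ge0 ?mulr_ge0 ?exprn_ge0 ?invr_ge0 //.
  rewrite eq1 exprMn -q; rewrite (exprS 4^-1 n) in hn1.
  have : 0 <= (4^-1 : R) ^+ n by rewrite exprn_ge0 // invr_ge0.
  by lra.
- have lim x : D x -> forall t : R, d <= nrm (w - p - t%:C *: x) ^+ 2.
    move=> Dx t.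
    have c : nrm (w - u n - t%:C *: x) ^+ 2 @[n --> \oo] --> nrm (w - p - t%:C *: x) ^+ 2.
      apply: cvgM; apply: cvg_nrm; apply: cvgB; try exact: cvg_cst;
      apply: cvgB => //; exact: cvg_cst.
    apply: (cvgr_to_ge c); near=> n; have [Dn _] := hu n.
    by rewrite -addrA -opprD addrC [u n + _]addrC addrC; apply/dle/DS.
  have le_d : nrm (w - p) ^+ 2 <= d.
    have c : nrm (w - u n) ^+ 2 @[n --> \oo] --> nrm (w - p) ^+ 2.
      by apply: cvgM; apply: cvg_nrm; apply: cvgB => //; exact: cvg_cst.
    have c2 : d + (4^-1 : R) ^+ n @[n --> \oo] --> d + 0.
      apply: cvgD; first exact: cvg_cst.
      by apply: cvg_expr; rewrite ger0_norm ?invr_ge0 // invf_lt1 // ltr1n.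
    rewrite -[d]addr0; apply: ler_cvg_to c c2 _.
    by near=> n; apply: ltW; case: (hu n).
  have wp : w - p = 0.
    apply: orth => x Dx; have [x0|x0] := eqVneq (nrm x) 0.
      by rewrite (nrm0_eq0 x0) ri0l.
    have xp : 0 < nrm x ^+ 2 by rewrite exprn_gt0 // lt_neqAle eq_sym x0 nrm_ge0.
    (* The coefficient is the minimizer of [t -> |w - p - t x|^2]; its minimum is
       [|w - p|^2 - r^2 / N], which forces [r = 0]. *)
    have := le_trans le_d (lim x Dx (re_inner (w - p) x / nrm x ^+ 2)).
    rewrite nrm_sqB nrmZR riZr exprMn real_normK ?num_real //.
    set r := re_inner _ x; set N := nrm x ^+ 2 => h.
    have : 0 <= - r ^+ 2 / N.
      have <- : - (2 * (r / N * r)) + (r / N) ^+ 2 * N = - r ^+ 2 / N.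
        by field; rewrite gt_eqF.
      by lra.
    rewrite pmulr_lge0 ?invr_gt0 // oppr_ge0 => h2.
    by apply/eqP; rewrite riC -sqrf_eq0 eq_le h2 sqr_ge0.
  have := up; move=> /cvg_nrmP /(_ e e0) [N _ /(_ N (leqnn N))] /= hN.
  by exists (u N); [case: (hu N)|rewrite -[w](subrK p) wp add0r nrm_sym].
Unshelve. all: by end_near. Qed.

(** Lax-Milgram by contraction: for [r = c / M^2], coercivity and [|T u| <= M |u|] give
    [|u - r T u|^2 <= (1 - c^2 / M^2) |u|^2], so that [r T] is invertible as a perturbation of the
    identity. *)
Lemma coercive_inverse H (T : H -> H) (c : R) :
  bounded_linear T -> 0 < c -> (forall u, c * nrm u ^+ 2 <= re_inner (T u) u) ->
  exists P, is_inverse T P.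
Proof.
move=> /bounded_linearP[lT [M0 M00 hM0]] c0 hT.
(* Adding [c] ensures [c <= M], hence [q >= 0] below, where [q] uses [sqrt (1 - x) <= 1 - x / 2]. *)
pose M := M0 + c.
have Mp : 0 < M by rewrite ltr_wpDl.
have hM x : nrm (T x) <= M * nrm x.
  by apply: le_trans (hM0 x) _; rewrite ler_wpM2r ?nrm_ge0 // lerDl ltW.
pose r := c / M ^+ 2.
have rp : 0 < r by rewrite divr_gt0 // exprn_gt0.
pose q := 1 - c ^+ 2 / M ^+ 2 / 2.
have cM : c ^+ 2 / M ^+ 2 <= 1.
  by rewrite ler_pdivrMr ?exprn_gt0 // mul1r ler_pXn2r ?nnegrE ?(ltW c0) ?(ltW Mp) // /M lerDr.
have cMp : 0 < c ^+ 2 / M ^+ 2 by rewrite divr_gt0 // exprn_gt0.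
have q01 : 0 <= q < 1 by apply/andP; split; rewrite /q; lra.
have lB : linear (fun u => u - r%:C *: T u).
  move=> a x y; rewrite lT !scalerDr !scalerA (mulrC _ a) -scalerA opprD addrACA.
  by rewrite scalerN.
have [|P [bP [PK KP]]] := @inverse_near_id _ _ (fun u => u - r%:C *: T u) q lB q01.
  move=> u; case/andP: q01 => q0 q1.
  rewrite -(@ler_pXn2r _ 2) ?nnegrE ?nrm_ge0 ?mulr_ge0 ?nrm_ge0 //.
  rewrite nrm_sqB nrmZR riZr (@exprMn _ 2 `|r|) real_normK ?num_real // (riC u).
  have h1 : nrm (T u) ^+ 2 <= M ^+ 2 * nrm u ^+ 2.
    by rewrite -exprMn ler_pXn2r ?nnegrE ?nrm_ge0 ?mulr_ge0 ?nrm_ge0 // ltW.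
  have h2 : r ^+ 2 * nrm (T u) ^+ 2 <= c ^+ 2 / M ^+ 2 * nrm u ^+ 2.
    apply: le_trans (ler_wpM2l (sqr_ge0 _) h1) _.
    by rewrite le_eqVlt; apply/orP; left; apply/eqP; rewrite /r; field; rewrite gt_eqF.
  have h3 : c ^+ 2 / M ^+ 2 * nrm u ^+ 2 <= r * re_inner (T u) u.
    apply: le_trans (ler_wpM2l (ltW rp) (hT u)).
    by rewrite le_eqVlt; apply/orP; left; apply/eqP; rewrite /r; field; rewrite gt_eqF.
  rewrite (@exprMn _ 2 q); have h4 : (1 - c ^+ 2 / M ^+ 2) * nrm u ^+ 2 <= q ^+ 2 * nrm u ^+ 2.
    rewrite ler_wpM2r ?sqr_ge0 // /q.
    have := sqr_ge0 (c ^+ 2 / M ^+ 2 / 2); set k := _ / _ / _ => hk.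
    by rewrite (_ : (1 - k) ^+ 2 = 1 - 2 * k + k ^+ 2); [rewrite /k in hk *; lra|ring].
  by lra.
exists (fun x => P (r%:C *: x)); split; last split.
- have [lP cP] := bP; apply: (@bounded_linear_comp _ _ _ _ P (fun x => r%:C *: x)) => //.
  exact/bounded_linearZ/bounded_linear_id.
- by move=> x; have := PK x; rewrite opprB addrCA subrr addr0.
- move=> x; have := KP (r%:C *: x); rewrite opprB addrCA subrr addr0 => /(congr1 (fun y => r^-1%:C *: y)).
  by rewrite !scalerA -rmorphM /= mulVf ?gt_eqF // !scale1r.
Qed.

End Hilbert.

(** * Extension by density *)

Section Extension.
Context {R : realType}.
Implicit Types V W Z : completeNormedModType R[i].

Lemma dense_eps V (D : set V) : dense D ->
  forall (w : V) (e : R), 0 < e -> exists2 x, D x & nrm (w - x) < e.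
Proof.
move=> dD w e e0; have [||x [hx Dx]] := dD (ball w e%:C).
- by exists w; apply: ballxx; rewrite (ltcR 0).
- by apply: ball_open; rewrite (ltcR 0).
- by exists x => //; move: hx; rewrite -ball_normE /= nrmE ltcR.
Qed.

Lemma eps_dense V (D : set V) :
  (forall (w : V) (e : R), 0 < e -> exists2 x, D x & nrm (w - x) < e) -> dense D.
Proof.
move=> h O [w Ow] oO; have /nbhs_ballP[e /= e0 he] : nbhs w O by exact: open_nbhs_nbhs.
have eE : e = (complex.Re e)%:C by rewrite RRe_real // gtr0_real.
have := h w (complex.Re e); rewrite -(ltcR 0) -eE => /(_ e0) [x Dx hx].
by exists x; split => //; apply: he; rewrite -ball_normE /= nrmE eE ltcR.
Qed.

Lemma eq_on_dense V W (D : set V) (f g : V -> W) :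
  (forall (w : V) (e : R), 0 < e -> exists2 x, D x & nrm (w - x) < e) ->
  bounded_linear f -> bounded_linear g -> (forall x, D x -> f x = g x) -> f =1 g.
Proof.
move=> dD bf bg fg w.
have /bounded_linearP[lh [M M0 hM]] := bounded_linearB bf bg.
apply/eqP; rewrite -subr_eq0; apply/eqP/nrm0_eq0/le_anti; rewrite nrm_ge0 andbT.
apply/ler_addgt0Pr => e e0; rewrite add0r.
have M1 : 0 < M + 1 by rewrite ltr_wpDl.
have [x Dx hx] := dD w (e / (M + 1)) (divr_gt0 e0 M1).
have -> : f w - g w = (f (w - x) - g (w - x)).
  have [lf _] := bf; have [lg _] := bg.
  by rewrite (linB lf) (linB lg) (fg x Dx) opprB addrA subrK.
apply: le_trans (hM _) _; apply: le_trans (ler_wpM2l M0 (ltW hx)) _.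
by rewrite mulrCA ger_pMr // ler_pdivrMr // mul1r lerDl.
Qed.

(** The extension is read off the closure [Gr] of the set of pairs [(e x, f x)]. The bound passes to
    the closure and makes it single-valued, which also covers the possibility that [e] is not
    injective on [D]. *)
Lemma extensionP V W Z (D : set V) (e : V -> W) (f : V -> Z) (M : R) :
  subspace_closed D ->
  (forall a x y, D x -> D y -> e (a *: x + y) = a *: e x + e y) ->
  (forall a x y, D x -> D y -> f (a *: x + y) = a *: f x + f y) ->
  0 <= M -> (forall x, D x -> nrm (f x) <= M * nrm (e x)) ->
  (forall (w : W) (d : R), 0 < d -> exists2 x, D x & nrm (w - e x) < d) ->
  bounded_linear (extension D e f) /\ forall x, D x -> extension D e f (e x) = f x.
Proof.
move=> [D0 DS] le lf M0 hM dD.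
suff [g hg] : exists g, [set g : W -> Z | bounded_linear g /\ forall x, D x -> g (e x) = f x] g.
  by have /= := xgetPex (fun=> 0) (ex_intro _ g hg).
pose Gr (w : W) (l : Z) := exists u : nat -> V, [/\ forall n, D (u n), e (u n) @[n --> \oo] --> w
   & f (u n) @[n --> \oo] --> l].
have GrS a w l w' l' : Gr w l -> Gr w' l' -> Gr (a *: w + w') (a *: l + l').
  move=> [u [uD uw ul]] [v [vD vw vl]]; exists (fun n => a *: u n + v n); split.
  - by move=> n; exact: DS.
  - under eq_fun do rewrite le //.
    by apply: cvgD => //; apply: cvgZl_tmp.
  - under eq_fun do rewrite lf //.
    by apply: cvgD => //; apply: cvgZl_tmp.
have GrB w l : Gr w l -> nrm l <= M * nrm w.
  move=> [u [uD uw ul]].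
  have c : M * nrm (e (u n)) @[n --> \oo] --> M * nrm w by apply: cvgMl_tmp; exact: cvg_nrm.
  have c' : nrm (f (u n)) @[n --> \oo] --> nrm l by exact: cvg_nrm.
  by apply: ler_cvg_to c' c _; near=> n; exact: hM.
have GrU w l l' : Gr w l -> Gr w l' -> l = l'.
  move=> h1 h2; have := GrB _ _ (GrS (-1) _ _ _ _ h1 h2).
  rewrite !scaleN1r addNr nrm0 mulr0 => h; apply/esym/eqP; rewrite -subr_eq0 addrC.
  by apply/eqP/nrm0_eq0/le_anti; rewrite h nrm_ge0.
have GrE w : exists l, Gr w l.
  have hp n : 0 < (2^-1 : R) ^+ n by rewrite exprn_gt0 // invr_gt0.
  have /choice[u hu] : forall n : nat, exists x, D x /\ nrm (w - e x) < (2^-1 : R) ^+ n.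
    by move=> n; have [x] := dD w _ (hp n); exists x.
  have half01 : 0 <= (2^-1 : R) < 1 by rewrite invr_ge0 ler0n /= invf_lt1 // ltr1n.
  have sub x y : D x -> D y -> D (x - y) /\ (e (x - y) = e x - e y /\ f (x - y) = f x - f y).
    move=> Dx Dy; have -> : x - y = -1 *: y + x by rewrite scaleN1r addrC.
    by rewrite le // lf // !scaleN1r ![- _ + _]addrC; split=> //; rewrite addrC -scaleN1r; exact: DS.
  (* Approximants within [2^-n] of [w] have images under [f] whose increments are at most
     [2 M 2^-n]. *)
  have [n|l hl] := @geometric_cvg _ _ (f \o u) (M * 2) 2^-1 (mulr_ge0 M0 (ler0n _ 2)) half01.
  - rewrite /=; have [Dn hn] := hu n; have [Dn1 hn1] := hu n.+1.
    have [D' [e' <-]] := sub _ _ Dn1 Dn.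
    apply: le_trans (hM _ D') _; rewrite -mulrA ler_wpM2l // e'.
    apply: le_trans (nrm_triangle w _ _) _; rewrite nrm_sym.
    rewrite (exprS 2^-1 n) in hn1; have := hp n; lra.
  - exists l, u; split => // [n|]; first by case: (hu n).
    apply/cvg_nrm0P; apply/cvgr0Pnorm_lt => d d0.
    have h0 : (2^-1 : R) ^+ n @[n --> \oo] --> 0.
      by apply: cvg_expr; case/andP: half01 => ? ?; rewrite ger0_norm.
    have := @cvgr0_norm_lt _ _ _ _ _ (fun n => (2^-1 : R) ^+ n) h0 d d0.
    move=> /(_ _); apply: filterS => n; apply: le_lt_trans.
    rewrite ger0_norm ?nrm_ge0 // ger0_norm ?ltW // nrm_sym.
    by case: (hu n).
have [g hg] := choice GrE; exists g; split=> [|x Dx].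
  apply/bounded_linearP; split; last by exists M => // w; exact: GrB.
  by move=> a w w'; apply: GrU (hg _) (GrS _ _ _ _ _ (hg _) (hg _)).
apply: GrU (hg _) _; exists (fun=> x); split=> //; exact: cvg_cst.
Unshelve. all: by end_near. Qed.

End Extension.

(** * Derivatives on the half-line *)

Section Calculus.
Context {R : realType}.
Implicit Types V W : completeNormedModType R[i].

(** The increment form avoids division, so [s = t] is no exception, and the guard [0 <= s] makes the
    derivative one-sided at 0, as in [has_deriv]. *)
Definition rderiv (f : R -> R) (t d : R) :=
  forall e : R, 0 < e -> \forall s \near t, 0 <= s ->
    `|f s - f t - (s - t) * d| <= e * `|s - t|.

Lemma half_lineE (t : R) : half_line t = (0 <= t).
Proof. by rewrite /half_line /= in_itv /= andbT. Qed.

Lemma has_derivP V (f : R -> V) (t : R) (l : V) :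
  has_deriv f t l <-> forall e : R, 0 < e -> \forall s \near t, 0 <= s ->
    nrm (f s - f t - (s - t)%:C *: l) <= e * `|s - t|.
Proof.
rewrite /has_deriv; split.
  move=> /cvg_nrmP h e e0; have := h e e0; rewrite near_withinE near_withinE.
  apply: filterS => s hs s0; have [->|st] := eqVneq s t.
    by rewrite !subrr scale0r subrr nrm0 normr0 mulr0.
  have := hs st; rewrite half_lineE => /(_ s0) /ltW hh.
  have st0 : 0 < `|s - t| by rewrite normr_gt0 subr_eq0.
  rewrite -ler_pdivrMr // mulrC -normfV -nrmZR scalerBr scalerA -rmorphM /=.
  by rewrite mulVf ?subr_eq0 // scale1r.
move=> h; apply/cvg_nrmP => e e0; have := h (e / 2) (divr_gt0 e0 (ltr0n _ 2)).
rewrite near_withinE near_withinE.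
apply: filterS => s hs st; rewrite half_lineE => s0.
have {hs} := hs s0; have st0 : 0 < `|s - t| by rewrite normr_gt0 subr_eq0.
rewrite -ler_pdivrMr // mulrC -normfV -nrmZR scalerBr scalerA -rmorphM /=.
rewrite mulVf ?subr_eq0 // scale1r => /le_lt_trans; apply.
by rewrite ltr_pdivrMr // ltr_pMr // ltr1n.
Qed.

Lemma within_contP V (f : R -> V) : {within half_line, continuous f} <->
  forall t : R, 0 <= t -> forall e : R, 0 < e -> \forall s \near t, 0 <= s ->
    nrm (f s - f t) < e.
Proof.
split=> [h t t0 e e0|h].
  have /subspace_continuousP := h => /(_ t); rewrite half_lineE => /(_ t0).
  move=> /cvg_nrmP /(_ e e0); rewrite near_withinE; apply: filterS => s.
  by rewrite half_lineE.
apply/subspace_continuousP => t; rewrite half_lineE => t0.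
apply/cvg_nrmP => e e0; rewrite near_withinE.
by apply: filterS (h t t0 e e0) => s; rewrite half_lineE.
Qed.

Lemma near_all (t : R) (P : R -> Prop) : (forall s, P s) -> \forall s \near t, P s.
Proof. by move=> h; apply: filterE. Qed.

Lemma nearP (t : R) (P : R -> Prop) : (\forall s \near t, P s) <->
  exists2 r : R, 0 < r & forall s, `|s - t| < r -> P s.
Proof.
split=> [/nbhs_ballP[r /= r0 h]|[r r0 h]].
  by exists r => // s sr; apply: h; rewrite -ball_normE /= distrC.
by apply/nbhs_ballP; exists r => // s; rewrite -ball_normE /= distrC; exact: h.
Qed.

Lemma near_dist (t e : R) : 0 < e -> \forall s \near t, `|s - t| < e.
Proof.
move=> e0; apply/nbhs_ballP; exists e => // s.
by rewrite -ball_normE /= distrC.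
Qed.

Lemma rderiv_near (f : R -> R) (t d : R) : rderiv f t d ->
  forall e : R, 0 < e -> \forall s \near t, 0 <= s -> `|f s - f t| < e.
Proof.
move=> h e e0; have c0 : 0 < 1 + `|d| by rewrite ltr_pwDl.
have := near_dist t (divr_gt0 e0 c0); have := h 1 ltr01.
apply: filterS2 => s hs hd s0.
have {}hs := hs s0; rewrite ltr_pdivlMr // in hd.
have := ler_normD (f s - f t - (s - t) * d) ((s - t) * d).
rewrite subrK normrM => /le_lt_trans; apply.
by rewrite mulrDr mulr1 in hd; rewrite mul1r in hs; apply: le_lt_trans hd; rewrite lerD2r.
Qed.

Lemma has_deriv_near V (f : R -> V) (t : R) (d : V) : has_deriv f t d ->
  forall e : R, 0 < e -> \forall s \near t, 0 <= s -> nrm (f s - f t) < e.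
Proof.
move=> /has_derivP h e e0; have c0 : 0 < 1 + nrm d by rewrite ltr_pwDl ?nrm_ge0.
have := near_dist t (divr_gt0 e0 c0); have := h 1 ltr01.
apply: filterS2 => s hs hd s0.
have {}hs := hs s0; rewrite ltr_pdivlMr // in hd.
have := nrmD (f s - f t - (s - t)%:C *: d) ((s - t)%:C *: d).
rewrite subrK nrmZR => /le_lt_trans; apply.
by rewrite mulrDr mulr1 in hd; rewrite mul1r in hs; apply: le_lt_trans hd; rewrite lerD2r.
Qed.

Lemma rderiv_is_derive (f : R -> R) (t d : R) : 0 < t -> rderiv f t d ->
  is_derive t 1 f d.
Proof.
move=> t0 h; suff c : h^-1 *: (f (h *: 1 + t) - f t) @[h --> 0^'] --> d.
  by split; [apply/cvg_ex; exists d | apply/cvg_lim].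
apply/cvgrPdist_le => e e0; rewrite near_withinE.
have /nearP[r1 r10 h1] := h e e0.
apply/nearP; exists (Num.min r1 t); first by rewrite lt_min r10.
move=> x; rewrite subr0 lt_min => /andP[xr xt] x0.
have := h1 (x + t); rewrite addrK => /(_ xr) h3.
have {h3}h3 : `|f (x + t) - f t - x * d| <= e * `|x|.
  by apply: h3; move: xt; rewrite ltr_norml => /andP[? _]; lra.
rewrite -[x *: 1]/(x * 1) mulr1 distrC.
have -> : x^-1 *: (f (x + t) - f t) - d = x^-1 * (f (x + t) - f t - x * d).
  by rewrite mulrBr mulKf.
by rewrite normrM normfV ler_pdivrMl ?normr_gt0 // [X in _ <= X]mulrC.
Qed.

(** The mean value theorem needs two-sided derivatives only in the open interval, where [t > 0]; at
    [a], which may be 0, one-sided continuity is enough. *)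
Lemma rderiv_nincr (f : R -> R) (a b : R) : 0 <= a -> a <= b ->
  (forall t : R, a <= t <= b -> exists2 d, d <= 0 & rderiv f t d) -> f b <= f a.
Proof.
move=> a0 ab h.
have hd t : t \in `]a, b[ -> exists2 d, d <= 0 & is_derive t 1 f d.
  rewrite in_itv /= => /andP[at_ tb]; have t0 := le_lt_trans a0 at_.
  have [|d d0 hd] := h t; first by rewrite (ltW at_) ltW.
  by exists d => //; exact: rderiv_is_derive.
apply: (@ler0_derive1_le_cc _ f a b) => //; rewrite ?in_itv /= ?lexx ?ab //.
- by move=> t /hd[d _ []].
- by move=> t /hd[d d0 hd']; rewrite derive1E (@derive_val _ _ _ _ _ _ _ hd').
- apply/subspace_continuousP => t; rewrite /= in_itv /= => hab.
  have [d _ hd'] := h t hab.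
  apply/cvgrPdist_lt => e e0; rewrite near_withinE.
  apply: filterS (rderiv_near hd' e0) => s hs /=; rewrite in_itv /= => /andP[as_ _].
  by rewrite distrC; apply: hs; exact: le_trans as_.
Qed.

Lemma rderivD (f g : R -> R) t a b :
  rderiv f t a -> rderiv g t b -> rderiv (fun s => f s + g s) t (a + b).
Proof.
move=> hf hg e e0; have e2 : 0 < e / 2 by rewrite divr_gt0.
apply: filterS2 (hf _ e2) (hg _ e2) => s h1 h2 s0.
have {}h1 := h1 s0; have {}h2 := h2 s0.
have -> : f s + g s - (f t + g t) - (s - t) * (a + b) =
  (f s - f t - (s - t) * a) + (g s - g t - (s - t) * b) by ring.
apply: le_trans (ler_normD _ _) _; apply: le_trans (lerD h1 h2) _.
by rewrite -mulrDl -splitr.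
Qed.

Lemma rderivZ (f : R -> R) t a c : rderiv f t a -> rderiv (fun s => c * f s) t (c * a).
Proof.
move=> hf e e0; have c0 : 0 < `|c| + 1 by rewrite ltr_wpDl.
apply: filterS (hf _ (divr_gt0 e0 c0)) => s h1 s0; have {}h1 := h1 s0.
have -> : c * f s - c * f t - (s - t) * (c * a) = c * (f s - f t - (s - t) * a) by ring.
rewrite normrM; apply: le_trans (ler_wpM2l (normr_ge0 c) h1) _.
rewrite mulrA ler_wpM2r // mulrCA ger_pMr // ler_pdivrMr // mul1r.
by rewrite lerDl.
Qed.

Lemma rderiv_id t c : rderiv (fun s => s * c) t c.
Proof.
move=> e e0; apply: near_all => s _.
by rewrite -mulrBl subrr normr0 mulr_ge0 // ltW.
Qed.

Lemma rderiv_le (f : R -> R) (b c : R) : 0 <= b ->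
  (forall t : R, 0 <= t <= b -> exists2 d, d <= c & rderiv f t d) -> f b <= f 0 + b * c.
Proof.
move=> b0 h; have := @rderiv_nincr (fun s => f s + -1 * (s * c)) 0 b (lexx _) b0.
rewrite mul0r mulr0 addr0 mulN1r lerBlDr; apply=> t /h[d dc hd].
exists (d + -1 * c); first by rewrite mulN1r subr_le0.
exact: (rderivD hd (rderivZ _ (rderiv_id _ _))).
Qed.

Lemma has_derivD V (f g : R -> V) t a b :
  has_deriv f t a -> has_deriv g t b -> has_deriv (fun s => f s + g s) t (a + b).
Proof.
move=> hf hg; rewrite /has_deriv.
have -> : (fun s => ((s - t)^-1)%:C *: (f s + g s - (f t + g t))) =
  (fun s => ((s - t)^-1)%:C *: (f s - f t) + ((s - t)^-1)%:C *: (g s - g t)).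
  by apply/funext => s; rewrite -scalerDr opprD addrACA.
exact: cvgD.
Qed.

Lemma has_deriv_lin V W (L : V -> W) (f : R -> V) t a :
  bounded_linear L -> has_deriv f t a -> has_deriv (L \o f) t (L a).
Proof.
move=> [lL cL] hf; rewrite /has_deriv.
have -> : (fun s => ((s - t)^-1)%:C *: ((L \o f) s - (L \o f) t)) =
  L \o (fun s => ((s - t)^-1)%:C *: (f s - f t)).
  by apply/funext => s /=; rewrite (linZ lL) (linB lL).
exact: (cvg_comp _ _ hf (cL a)).
Qed.

Lemma has_deriv_cst V t (c : V) : has_deriv (fun=> c) t 0.
Proof.
apply/has_derivP => e e0; apply: near_all => s _.
by rewrite subrr scaler0 subr0 nrm0 mulr_ge0 // ltW.
Qed.

Lemma has_deriv_ri (H : hilbertType R) (f g : R -> H) t a b :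
  has_deriv f t a -> has_deriv g t b ->
  rderiv (fun s => re_inner (f s) (g s)) t (re_inner a (g t) + re_inner (f t) b).
Proof.
move=> /[dup] hf /has_derivP hf' hg e e0.
have hg' := proj1 (has_derivP _ _ _) hg.
pose M := 1 + nrm (f t) + nrm (g t) + nrm a.
have M0 : 0 < M.
  by have := nrm_ge0 (f t); have := nrm_ge0 (g t); have := nrm_ge0 a; rewrite /M; lra.
have e3 : 0 < e / (3 * M) by rewrite divr_gt0 // mulr_gt0.
apply: filterS2 (filterI (hf' _ e3) (has_deriv_near hg ltr01)) (filterI (hg' _ e3) (has_deriv_near hg e3)) => s [h1 h2] [h3 h4] s0.
have {}h1 := h1 s0; have {}h2 := h2 s0; have {}h3 := h3 s0; have {}h4 := h4 s0.
(* Two first-order remainders and one cross term, each of which is then at most a third of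
   [e |s - t|]. *)
have -> : re_inner (f s) (g s) - re_inner (f t) (g t) - (s - t) * (re_inner a (g t) + re_inner (f t) b)
  = re_inner (f s - f t - (s - t)%:C *: a) (g s) + re_inner (f t) (g s - g t - (s - t)%:C *: b)
    + (s - t) * re_inner a (g s - g t).
  by rewrite !(riBl, riBr, riZl, riZr); ring.
have k1 : `|re_inner (f s - f t - (s - t)%:C *: a) (g s)| <= e / 3 * `|s - t|.
  apply: le_trans (ri_abs_le _ _) _.
  have n1 : nrm (g s) <= M.
    rewrite -[g s](subrK (g t)); apply: le_trans (nrmD _ _) _.
    by have := nrm_ge0 (f t); have := nrm_ge0 a; rewrite /M; lra.
  apply: le_trans (ler_pM (nrm_ge0 _) (nrm_ge0 _) h1 n1) _.
  by rewrite le_eqVlt; apply/orP; left; apply/eqP; field; rewrite gt_eqF.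
have k2 : `|re_inner (f t) (g s - g t - (s - t)%:C *: b)| <= e / 3 * `|s - t|.
  apply: le_trans (ri_abs_le _ _) _.
  have n1 : nrm (f t) <= M.
    by have := nrm_ge0 (g t); have := nrm_ge0 a; rewrite /M; lra.
  apply: le_trans (ler_pM (nrm_ge0 _) (nrm_ge0 _) n1 h3) _.
  by rewrite le_eqVlt; apply/orP; left; apply/eqP; field; rewrite gt_eqF.
have k3 : `|(s - t) * re_inner a (g s - g t)| <= e / 3 * `|s - t|.
  rewrite normrM mulrC ler_wpM2r //; apply: le_trans (ri_abs_le _ _) _.
  have n1 : nrm a <= M.
    by have := nrm_ge0 (g t); have := nrm_ge0 (f t); rewrite /M; lra.
  apply: le_trans (ler_pM (nrm_ge0 _) (nrm_ge0 _) n1 (ltW h4)) _.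
  by rewrite le_eqVlt; apply/orP; left; apply/eqP; field; rewrite gt_eqF.
apply: le_trans (ler_normD _ _) _; apply: le_trans (lerD (ler_normD _ _) (lexx _)) _.
by lra.
Qed.

Lemma has_deriv_sq (H : hilbertType R) (f : R -> H) t a : has_deriv f t a ->
  rderiv (fun s => nrm (f s) ^+ 2) t (2 * re_inner (f t) a).
Proof.
move=> h; have := has_deriv_ri h h; rewrite (riC a).
have -> : re_inner (f t) a + re_inner (f t) a = 2 * re_inner (f t) a by ring.
by congr (rderiv _ _ _); apply/funext => s; rewrite ri_self.
Qed.

End Calculus.

(** * Semigroups and their generators *)

Section UniformBoundedness.
Context {R : realType}.
Implicit Types V W : completeNormedModType R[i].

Lemma cvg_in_ball V (u : nat -> V) (l c : V) (r : R) :
  u n @[n --> \oo] --> l -> (\forall n \near \oo, nrm (u n - c) <= r) -> nrm (l - c) <= r.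
Proof.
move=> ul h; have c1 : nrm (u n - c) @[n --> \oo] --> nrm (l - c).
  by apply: cvg_nrm; apply: cvgB => //; exact: cvg_cst.
exact: cvgr_to_le c1 h.
Qed.

(* Nested balls, on the k-th of which some member of F exceeds k *)
Lemma uniform_boundedness V W (F : set (V -> W)) :
  (forall f, F f -> bounded_linear f) ->
  (forall x, exists M : R, forall f, F f -> nrm (f x) <= M) ->
  exists2 M : R, 0 <= M & forall f, F f -> forall x, nrm (f x) <= M * nrm x.
Proof.
move=> bF pF; apply: contrapT => nob.
have unb (M : R) : 0 <= M -> exists f x, F f /\ M * nrm x < nrm (f x).
  move=> M0; apply: contrapT => h; apply: nob; exists M => // f Ff x.
  by rewrite leNgt; apply/negP => hx; apply: h; exists f, x.
(* A ball is a pair centre-radius; positivity of the radius is a premise inside the existential so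
   that choice applies to all pairs. *)
have step (k : nat) (b : V * R) : exists b' : V * R, 0 < b.2 ->
    [/\ 0 < b'.2, b'.2 <= b.2 / 2, nrm (b'.1 - b.1) <= b.2 / 2 &
     exists2 f, F f & forall y, nrm (y - b'.1) <= b'.2 -> k%:R <= nrm (f y)].
  case: b => x r /=; have [r0|] := ltP 0 r; last by exists (x, r).
  have [|f [z [Ff hz]]] := unb ((k%:R + 1) / (r / 2)).
    by rewrite divr_ge0 ?addr_ge0 // divr_ge0 // ltW.
  have [lf [M M0 hM]] := proj1 (bounded_linearP _) (bF f Ff).
  have z0 : 0 < nrm z.
    rewrite lt_neqAle nrm_ge0 andbT eq_sym; apply/eqP => z0.
    by move: hz; rewrite (nrm0_eq0 z0) (lin0 lf) !nrm0 mulr0 ltxx.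
  pose xi := (r / 2 / nrm z)%:C *: z.
  have nxi : nrm xi = r / 2.
    by rewrite nrmZR ger0_norm ?divr_ge0 ?nrm_ge0 ?(ltW r0) // divfK // gt_eqF.
  have fxi : k%:R + 1 <= nrm (f xi).
    rewrite (linZ lf) nrmZR ger0_norm ?divr_ge0 ?nrm_ge0 ?(ltW r0) //.
    rewrite mulrAC ler_pdivlMr // mulrC; rewrite mulrAC ltr_pdivrMr ?divr_gt0 // in hz.
    by apply: ltW; rewrite mulrC [X in _ < X]mulrC.
  (* Since [f (x + xi) - f (x - xi) = 2 f xi], at least one of the two values is as large as [f xi].
     This replaces the Baire category theorem. *)
  have [x' [hx' fx']] : exists x', nrm (x' - x) <= r / 2 /\ k%:R + 1 <= nrm (f x').
    have [h|h] := leP (k%:R + 1) (nrm (f (x + xi))).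
      by exists (x + xi); rewrite addrC addKr nxi.
    exists (x - xi); rewrite addrC addKr nrmN nxi; split=> //.
    have := nrmB (f (x + xi)) (f (x - xi)); rewrite -(linB lf) opprB addrC addrA subrK.
    rewrite (linD lf xi xi) => h2.
    have : nrm (f xi + f xi) = 2 * nrm (f xi).
      by rewrite -mulr2n -scaler_nat nrmZ -[2%:R]/(2%:R : R[i]) -(rmorph_nat (real_complex R)) modcR ger0_norm.
    by lra.
  have M1 : 0 < M + 1 by rewrite ltr_wpDl.
  exists (x', Num.min (r / 2) (M + 1)^-1) => _ /=; split => //.
  - by rewrite lt_min divr_gt0 //= invr_gt0.
  - by rewrite ge_min lexx.
  exists f => // y; rewrite le_min => /andP[_ hy].
  have := nrmD (f (x' - y)) (f y); rewrite -(linD lf) subrK.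
  have := hM (x' - y); rewrite nrm_sym.
  have : M * nrm (y - x') <= 1.
    apply: le_trans (_ : (M + 1) * (M + 1)^-1 <= 1); last by rewrite divff ?gt_eqF.
    by apply: ler_pM => //; [exact: nrm_ge0 | rewrite lerDl].
  by lra.
have /choice[g hg] : forall kb : nat * (V * R), exists b' : V * R, 0 < kb.2.2 ->
    [/\ 0 < b'.2, b'.2 <= kb.2.2 / 2, nrm (b'.1 - kb.2.1) <= kb.2.2 / 2 &
     exists2 f, F f & forall y, nrm (y - b'.1) <= b'.2 -> kb.1%:R <= nrm (f y)].
  by move=> [k b]; exact: step.
pose u := fix u (k : nat) : V * R := if k is n.+1 then g (n, u n) else (0, 1).
have u0 k : 0 < (u k).2 by elim: k => [|k IH] //=; have [] := hg (k, u k) IH.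
have hu k := hg (k, u k) (u0 k).
have ur k : (u k).2 <= 2^-1 ^+ k.
  elim: k => [|k IH]; first by rewrite expr0.
  have [_ h _ _] := hu k; apply: le_trans h _ => /=.
  by rewrite exprS mulrC ler_wpM2l // invr_ge0.
have unest k m : nrm ((u (k + m)%N).1 - (u k).1) <= (u k).2 - (u (k + m)%N).2.
  elim: m => [|m IH]; first by rewrite addn0 !subrr nrm0.
  have [_ /= h1 h2 _] := hu (k + m)%N; rewrite addnS.
  by apply: le_trans (nrm_triangle (u (k + m)%N).1 _ _) _; lra.
have half01 : 0 <= (2^-1 : R) < 1 by rewrite invr_ge0 ler0n /= invf_lt1 // ltr1n.
have [|n k|l hl] := @cauchy_seq_cvg _ _ (fun k => (u k).1) (fun k => 2^-1 ^+ k).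
- by apply: cvg_expr; case/andP: half01 => ? ?; rewrite ger0_norm.
- apply: le_trans (unest _ _) (le_trans _ (ur n)).
  by rewrite gerBl ltW.
have [M hM] := pF l.
have [k kM] : exists k : nat, M < k%:R.
  by exists (Num.truncn M).+1; rewrite truncnS_gt.
have [_ _ _ [f Ff hf]] := hu k.
suff /hf : nrm (l - (u k.+1).1) <= (u k.+1).2 by rewrite leNgt (le_lt_trans (hM f Ff) kM).
apply: cvg_in_ball hl _; exists k.+1 => // n /= kn.
rewrite -(subnKC kn); apply: le_trans (unest _ _) _.
by rewrite gerBl ltW.
Qed.

End UniformBoundedness.

Section Resolvents.
Context {R : realType}.
Implicit Types V : completeNormedModType R[i].

Lemma resolventP V (A : unbounded V) s : rho A s -> is_resolvent A s (resolvent A s).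
Proof. by move=> [Q hQ]; exact: (xgetPex (fun=> 0) (ex_intro _ Q hQ)). Qed.

Lemma is_resolvent_inj V (A : unbounded V) s P Q :
  is_resolvent A s P -> is_resolvent A s Q -> P =1 Q.
Proof.
move=> [_ P1 P2] [_ Q1 Q2] x; have [DQ QE] := Q1 x.
by rewrite -{1}QE P2.
Qed.

Lemma resolventE V (A : unbounded V) s Q : is_resolvent A s Q -> resolvent A s = Q.
Proof.
move=> hQ; apply/funext; apply: is_resolvent_inj (hQ).
by apply: resolventP; exists Q.
Qed.

End Resolvents.

(** * Local bounds and linearity of the generator *)

Section Semigroup.
Context {R : realType} (X : hilbertType R) (A : unbounded X) (T : R -> X -> X).
Hypothesis gen : generates A T.
Hypothesis rhoA : exists s, rho A s.

Lemma at_right0P (P : R -> Prop) : (\forall h \near 0^'+, P h) <->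
  exists2 r : R, 0 < r & forall h, 0 < h < r -> P h.
Proof.
rewrite /at_right near_withinE; split=> [/nearP[r r0 h]|[r r0 h]].
  by exists r => // s /andP[s0 sr]; apply: h => //; rewrite subr0 gtr0_norm.
apply/nearP; exists r => // s.
by rewrite subr0 => sr s0; apply: h; rewrite s0 /= (le_lt_trans (ler_norm _)).
Qed.

Lemma at_right0_cvgP (f : R -> X) (l : X) : f h @[h --> 0^'+] --> l <->
  forall e : R, 0 < e -> exists2 r : R, 0 < r & forall h, 0 < h < r -> nrm (f h - l) < e.
Proof.
rewrite cvg_nrmP; split=> h e e0; have := h e e0.
  by move/at_right0P.
by move=> hr; apply/at_right0P.
Qed.

Lemma quotientP (f : R -> X) (x l : X) :
  (h^-1)%:C *: (f h - x) @[h --> 0^'+] --> l <->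
  forall e : R, 0 < e -> exists2 r : R, 0 < r &
    forall h, 0 < h < r -> nrm (f h - x - h%:C *: l) <= e * h.
Proof.
have E h : 0 < h -> nrm ((h^-1)%:C *: (f h - x) - l) = nrm (f h - x - h%:C *: l) / h.
  move=> h0; have -> : (h^-1)%:C *: (f h - x) - l = (h^-1)%:C *: (f h - x - h%:C *: l).
    by rewrite [RHS]scalerBr scalerA -rmorphM /= mulVf ?gt_eqF // scale1r.
  by rewrite nrmZR gtr0_norm ?invr_gt0 // mulrC.
rewrite at_right0_cvgP; split=> H e e0.
  have [r r0 hr] := H e e0; exists r => // h /[dup] hh /hr.
  by case/andP: hh => h0 _; rewrite E // ltr_pdivrMr // => /ltW.
have [r r0 hr] := H (e / 2) (divr_gt0 e0 (ltr0n _ 2)); exists r => // h /[dup] hh /hr.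
case/andP: hh => h0 _; rewrite E // ltr_pdivrMr // => /le_lt_trans; apply.
by rewrite ltr_pM2r // ltr_pdivrMr // ltr_pMr // ltr1n.
Qed.

Lemma sg_bl (t : R) : 0 <= t -> bounded_linear (T t).
Proof. by case: gen => -[h _ _ _] _; exact: h. Qed.

Lemma sg_lin (t : R) : 0 <= t -> linear (T t).
Proof. by move=> /sg_bl[]. Qed.

Lemma sg0 x : T 0 x = x.
Proof. by case: gen => -[_ -> _ _] _. Qed.

Lemma sgD (s t : R) x : 0 <= s -> 0 <= t -> T (s + t) x = T s (T t x).
Proof. by case: gen => -[_ _ h _] _ s0 t0; rewrite h. Qed.

Lemma sg_cont0 x (e : R) : 0 < e ->
  exists2 r : R, 0 < r & forall h, 0 <= h < r -> nrm (T h x - x) < e.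
Proof.
case: gen => -[_ _ _ h] _ e0; have /at_right0_cvgP/(_ e e0)[r r0 hr] := h x.
exists r => // t /andP[t0 tr]; have [->|t1] := eqVneq t 0.
  by rewrite sg0 subrr nrm0.
by apply: hr; rewrite tr lt_neqAle eq_sym t1 t0.
Qed.

Lemma generatorP x y : (dom A x /\ A x = y) <->
  forall e : R, 0 < e -> exists2 r : R, 0 < r &
    forall h, 0 < h < r -> nrm (T h x - x - h%:C *: y) <= e * h.
Proof. by case: gen => _ h; rewrite h quotientP. Qed.

(** [generates] describes the graph of [A], so domain membership and the value of [A] are obtained
    from one limit. *)
Lemma gen_comb a x y : dom A x -> dom A y ->
  dom A (a *: x + y) /\ A (a *: x + y) = a *: A x + A y.
Proof.
move=> Dx Dy; case: (gen) => _ h; apply/h.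
have hx := proj1 (h x (A x)) (conj Dx erefl); have hy := proj1 (h y (A y)) (conj Dy erefl).
have : (fun h => a *: ((h^-1)%:C *: (T h x - x)) + (h^-1)%:C *: (T h y - y)) h @[h --> 0^'+] --> a *: A x + A y.
  by apply: cvgD => //; apply: cvgZl_tmp.
apply: cvg_trans; apply: near_eq_cvg; apply/at_right0P; exists 1 => // k /andP[k0 _].
rewrite (sg_lin (ltW k0)) scalerA mulrC -scalerA -scalerDr scalerBr; congr (_ *: _).
by rewrite opprD addrACA.
Qed.

Lemma dom_closed : subspace_closed (dom A).
Proof.
split; last by move=> a x y Dx Dy; case: (gen_comb a Dx Dy).
suff [] : dom A 0 /\ A 0 = 0 by [].
apply/generatorP => e e0; exists 1 => // h /andP[h0 _].
by rewrite (lin0 (sg_lin (ltW h0))) scaler0 !subr0 nrm0 mulr_ge0 // ltW.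
Qed.

Lemma gen_linear a x y : dom A x -> dom A y -> A (a *: x + y) = a *: A x + A y.
Proof. by move=> Dx Dy; case: (gen_comb a Dx Dy). Qed.

(** Otherwise there are times [t_n <= 1 / (n + 1)] with [|T_{t_n}| > n]; but [T_{t_n} x] tends to
    [x] for each [x], so the family is pointwise bounded, against uniform boundedness. *)
Lemma sg_local_bound0 : exists2 d : R, 0 < d &
  exists2 M : R, 0 <= M & forall t x, 0 <= t <= d -> nrm (T t x) <= M * nrm x.
Proof.
apply: contrapT => nob.
have /choice[tx htx] : forall n : nat, exists tx : R * X, 0 <= tx.1 <= n.+1%:R^-1 /\ n%:R * nrm tx.2 < nrm (T tx.1 tx.2).
  move=> n; apply: contrapT => h; apply: nob; exists n.+1%:R^-1; first by rewrite invr_gt0.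
  exists n%:R => // t x ht; rewrite leNgt; apply/negP => hx; apply: h; by exists (t, x).
pose F := [set T (tx n).1 | n in [set: nat]].
have [||M M0 hM] := @uniform_boundedness _ _ _ F.
- by move=> _ [n _ <-]; apply: sg_bl; case: (htx n) => /andP[].
- move=> x; have [r r0 hr] := sg_cont0 x ltr01.
  have [N hN] : exists N : nat, r^-1 < N%:R by exists (Num.truncn r^-1).+1; rewrite truncnS_gt.
  (* The sum absorbs the finitely many times at which [T_t x] is not yet within 1 of [x]. *)
  exists (\sum_(n < N) nrm (T (tx n).1 x) + (1 + nrm x)) => _ [n _ <-].
  have [nN|Nn] := ltnP n N.
    rewrite (bigD1 (Ordinal nN)) //= -addrA lerDl addr_ge0 //; first by apply: sumr_ge0 => i _; exact: nrm_ge0.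
    by rewrite addr_ge0 // nrm_ge0.
  rewrite ler_wpDl //; first by apply: sumr_ge0 => i _; exact: nrm_ge0.
  rewrite -[T _ x](subrK x); apply: le_trans (nrmD _ _) _; rewrite lerD2r ltW //.
  apply: hr; have [/andP[-> h] _] := htx n; apply: le_lt_trans h _.
  rewrite invf_plt ?posrE //; apply: lt_le_trans hN _.
  by rewrite ler_nat (leq_trans Nn).
have [N hN] : exists N : nat, M < N%:R by exists (Num.truncn M).+1; rewrite truncnS_gt.
have [_ h] := htx N; have := hM (T (tx N).1) (ex_intro2 _ _ N I erefl) (tx N).2.
rewrite leNgt (le_lt_trans _ h) // ler_wpM2r ?nrm_ge0 // ltW //.
Qed.

Lemma sg_local_bound (b : R) : exists2 M : R, 0 <= M &
  forall t x, 0 <= t <= b -> nrm (T t x) <= M * nrm x.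
Proof.
have [d d0 [M M0 hM]] := sg_local_bound0.
have h (n : nat) : exists2 M : R, 0 <= M &
    forall t x, 0 <= t <= n%:R * d -> nrm (T t x) <= M * nrm x.
  elim: n => [|n [K K0 hK]].
    exists 1 => // t x; rewrite mul0r -eq_le => /eqP <-.
    by rewrite sg0 mul1r.
  exists (K + M * K); first by rewrite addr_ge0 ?mulr_ge0.
  move=> t x /andP[t0 tn]; have [tnd|ndt] := leP t (n%:R * d).
    rewrite mulrDl ler_wpDr ?mulr_ge0 ?nrm_ge0 //.
    by apply: hK; rewrite t0.
  have nd0 : 0 <= n%:R * d by rewrite mulr_ge0 // ltW.
  rewrite -[t](subrK (n%:R * d)) sgD // ?subr_ge0 ?(ltW ndt) //.
  apply: le_trans (hM _ _ _) _.
    by rewrite subr_ge0 (ltW ndt) /=; rewrite -natr1 mulrDl mul1r in tn; lra.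
  rewrite mulrDl ler_wpDl ?mulr_ge0 ?nrm_ge0 // -mulrA ler_wpM2l //.
  by apply: hK; rewrite nd0 lexx.
have [n hn] : exists n : nat, b / d < n%:R by exists (Num.truncn (b / d)).+1; rewrite truncnS_gt.
have [K K0 hK] := h n; exists K => // t x /andP[t0 tb]; apply: hK; rewrite t0.
by rewrite ltr_pdivrMr // in hn; rewrite (le_trans tb) // ltW.
Qed.

End Semigroup.

Lemma cvg_pow2 (R : realType) (V : completeNormedModType R[i]) (u : nat -> V) (l : V) :
  (forall n, nrm (u n - l) <= 2^-1 ^+ n) -> u n @[n --> \oo] --> l.
Proof.
move=> h; apply/cvg_nrmP => d d0.
have h0 : (2^-1 : R) ^+ n @[n --> \oo] --> 0.
  by apply: cvg_expr; rewrite ger0_norm ?invr_ge0 // invf_lt1 // ltr1n.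
have := @cvgr0_norm_lt _ _ _ _ _ (fun n => (2^-1 : R) ^+ n) h0 d d0.
move=> /(_ _); apply: filterS => n; apply: le_lt_trans.
by rewrite ger0_norm ?exprn_ge0 ?invr_ge0.
Qed.

(** * Orbits, density of the domain, points of the resolvent set *)

Section Semigroup.
Context {R : realType} (X : hilbertType R) (A : unbounded X) (T : R -> X -> X).
Hypothesis gen : generates A T.

(** For [t <= s] the difference is [T_t (T_{s-t} x - x)], so continuity anywhere reduces to
    continuity at 0. *)
Lemma sg_diff_le (b M : R) : 0 <= M ->
  (forall t x, 0 <= t <= b -> nrm (T t x) <= M * nrm x) ->
  forall s t x, 0 <= s <= b -> 0 <= t <= b ->
  nrm (T s x - T t x) <= M * nrm (T `|s - t| x - x).
Proof.
move=> M0 hM s t x; wlog st : s t / t <= s.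
  move=> h hs ht; have [ts|/ltW st] := leP t s; first exact: h.
  by rewrite nrm_sym distrC; exact: h.
move=> /andP[s0 sb] /andP[t0 tb]; rewrite ger0_norm ?subr_ge0 //.
have st0 : 0 <= s - t by rewrite subr_ge0.
have -> : T s x = T t (T (s - t) x) by rewrite -(sgD gen _ t0 st0) addrC subrK.
rewrite -(linB (sg_lin gen t0)).
by apply: hM; rewrite t0.
Qed.

Lemma sg_cont x (t : R) : 0 <= t -> forall e : R, 0 < e ->
  \forall s \near t, 0 <= s -> nrm (T s x - T t x) < e.
Proof.
move=> t0 e e0; have [M M0 hM] := sg_local_bound gen (t + 1).
have M1 : 0 < M + 1 by rewrite ltr_wpDl.
have [r r0 hr] := sg_cont0 gen x (divr_gt0 e0 M1).
apply/nearP; exists (Num.min r 1); first by rewrite lt_min r0 ltr01.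
move=> s; rewrite lt_min => /andP[sr s1] s0.
apply: le_lt_trans (sg_diff_le M0 hM _ _ _) _; rewrite ?s0 ?t0 ?lerDl //=.
  by move: s1; rewrite ltr_norml => /andP[_ ?]; lra.
have := hr `|s - t|; rewrite normr_ge0 sr => /(_ isT).
rewrite ltr_pdivlMr // mulrC; apply: le_lt_trans.
by rewrite ler_wpM2r ?nrm_ge0 // lerDl.
Qed.

Lemma sg_dom x (t : R) : 0 <= t -> dom A x -> dom A (T t x) /\ A (T t x) = T t (A x).
Proof.
move=> t0 Dx; apply/(generatorP gen) => e e0.
have [M M0 hM] := sg_local_bound gen t.
have M1 : 0 < M + 1 by rewrite ltr_wpDl.
have [r r0 hr] := proj1 (generatorP gen x (A x)) (conj Dx erefl) _ (divr_gt0 e0 M1).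
exists r => // h hh; have /andP[h0 _] := hh.
rewrite -(sgD gen _ (ltW h0) t0) (addrC h t) (sgD gen _ t0 (ltW h0)).
rewrite -(linZ (sg_lin gen t0)) -!(linB (sg_lin gen t0)).
apply: le_trans (hM _ _ _) _; first by rewrite t0 lexx.
apply: le_trans (ler_wpM2l M0 (hr h hh)) _.
rewrite mulrA ler_wpM2r ?(ltW h0) // mulrCA ger_pMr // ler_pdivrMr // mul1r.
by rewrite lerDl.
Qed.

Lemma sg_deriv x (t : R) : 0 <= t -> dom A x ->
  has_deriv (fun s => T s x) t (T t (A x)).
Proof.
move=> t0 Dx; apply/has_derivP => e e0.
have [M M0 hM] := sg_local_bound gen (t + 1).
have M1 : 0 < M + 1 by rewrite ltr_wpDl.
have e2 : 0 < e / 2 by rewrite divr_gt0.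
have [r r0 hr] := proj1 (generatorP gen x (A x)) (conj Dx erefl) _ (divr_gt0 e2 M1).
have hr' h : 0 < h < r -> M * nrm (T h x - x - h%:C *: A x) <= e / 2 * h.
  move=> hh; have /andP[h0 _] := hh; apply: le_trans (ler_wpM2l M0 (hr h hh)) _.
  rewrite mulrA ler_wpM2r ?(ltW h0) // mulrCA ger_pMr // ler_pdivrMr // mul1r.
  by rewrite lerDl.
have c := sg_cont (A x) t0 e2.
have r1 : 0 < Num.min r 1 by rewrite lt_min r0 ltr01.
apply: filterS2 c (near_dist t r1) => s cs; rewrite lt_min => /andP[sr s1] s0.
have {}cs := cs s0.
have [->|st] := eqVneq s t; first by rewrite !subrr scale0r subrr nrm0 normr0 mulr0.
have [lts|ltt] := ltP t s.
  have h0 : 0 < s - t by rewrite subr_gt0.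
  have -> : T s x = T t (T (s - t) x) by rewrite -(sgD gen _ t0 (ltW h0)) addrC subrK.
  rewrite -(linZ (sg_lin gen t0)) -!(linB (sg_lin gen t0)) (gtr0_norm h0).
  apply: le_trans (hM _ _ _) _; first by rewrite t0 lerDl ler01.
  apply: le_trans (hr' _ _) _; first by rewrite h0 (le_lt_trans (ler_norm _)).
  by rewrite ler_wpM2r ?(ltW h0) // ler_pdivrMr // ler_peMr ?(ltW e0) // ler1n.
have h0 : 0 < t - s by rewrite subr_gt0 lt_neqAle st.
rewrite distrC (gtr0_norm h0).
(* For the left derivative [T_s] is factored out instead of [T_t]; this costs the term in
   [T_t (A x) - T_s (A x)], small by continuity of the orbit of [A x]. *)
have -> : T s x - T t x - (s - t)%:C *: T t (A x) =
    (t - s)%:C *: (T t (A x) - T s (A x)) - T s (T (t - s) x - x - (t - s)%:C *: A x).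
  have ls := sg_lin gen s0.
  rewrite !(linB ls) (linZ ls) -(sgD gen _ s0 (ltW h0)) (addrC s (t - s)) subrK.
  rewrite scalerBr !opprB -[s - t]opprB raddfN scaleNr /= opprK.
  by rewrite [RHS]addrA subrK addrC.
apply: le_trans (nrmB _ _) _; rewrite nrmZR (gtr0_norm h0).
have k1 : (t - s) * nrm (T t (A x) - T s (A x)) <= e / 2 * (t - s).
  by rewrite mulrC ler_wpM2r ?(ltW h0) // nrm_sym ltW.
have k2 : nrm (T s (T (t - s) x - x - (t - s)%:C *: A x)) <= e / 2 * (t - s).
  apply: le_trans (hM _ _ _) _; first by rewrite s0 (le_trans ltt) // lerDl.
  by apply: hr'; rewrite h0 (le_lt_trans (ler_norm _)) // distrC.
by lra.
Qed.

Hypothesis rhoA : exists s, rho A s.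

(** With [Q] the resolvent, [w = s Q w - A (Q w)], and [A (Q w)] is the limit of difference
    quotients of the orbit of [Q w], which lie in [dom A]. This needs no vector-valued integral. *)
Lemma sg_dom_dense (w : X) (e : R) : 0 < e -> exists2 x, dom A x & nrm (w - x) < e.
Proof.
move=> e0; have [s hs] := rhoA; have [bQ Q1 Q2] := resolventP hs.
set Q := resolvent A s in bQ Q1 Q2.
have [DQ QE] := Q1 w.
have [r r0 hr] := proj1 (generatorP gen (Q w) (A (Q w))) (conj DQ erefl) (e / 2) (divr_gt0 e0 (ltr0n _ 2)).
pose h := r / 2.
have h0 : 0 < h by rewrite divr_gt0.
have hh : 0 < h < r by rewrite h0 ltr_pdivrMr // ltr_pMr // ltr1n.
have [D0 DS] := dom_closed gen.
have DT := proj1 (sg_dom (ltW h0) DQ).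
exists (s *: Q w - (h^-1)%:C *: (T h (Q w) - Q w)).
  rewrite -scaleNr addrC; apply: (DS); last by rewrite -[s *: _]addr0; apply: (DS).
  by have := DS (-1) _ _ DQ DT; rewrite scaleN1r addrC.
have := hr h hh.
have -> : w - (s *: Q w - (h^-1)%:C *: (T h (Q w) - Q w)) =
    (h^-1)%:C *: (T h (Q w) - Q w - h%:C *: A (Q w)).
  rewrite [RHS]scalerBr scalerA -rmorphM /= mulVf ?gt_eqF // scale1r.
  by rewrite -{1}QE opprB addrC addrA subrK.
rewrite nrmZR gtr0_norm ?invr_gt0 // ltr_pdivrMl // mulrC => /le_lt_trans; apply.
by have := mulr_gt0 e0 h0; clearbody h; lra.
Qed.

(** Closedness comes from boundedness of the resolvent: [u n = Q (s u_n - A u_n)] passes to the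
    limit. *)
Lemma gen_closed_op (u : nat -> X) x z : (forall n, dom A (u n)) ->
  u n @[n --> \oo] --> x -> A (u n) @[n --> \oo] --> z -> dom A x /\ A x = z.
Proof.
move=> Du ux uz; have [s hs] := rhoA; have [bQ Q1 Q2] := resolventP hs.
set Q := resolvent A s in bQ Q1 Q2.
have c : s *: u n - A (u n) @[n --> \oo] --> s *: x - z.
  by apply: cvgB => //; apply: cvgZl_tmp.
have c' := cvg_comp _ _ c (proj2 bQ (s *: x - z)).
have xE : x = Q (s *: x - z).
  have c'' : u n @[n --> \oo] --> Q (s *: x - z).
    by rewrite (_ : (fun n => u n) = Q \o (fun n => s *: u n - A (u n))) //; apply/funext => n /=; rewrite Q2.
  exact: (cvg_unique _ ux c'').
have [D E] := Q1 (s *: x - z); rewrite -xE in D E; split=> //.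
by have := congr1 (fun w => s *: x - w) E; rewrite /= !subKr.
Qed.

(* Integrating d/dt <T t x, w> = <T t (A x), w> over [0, t0] bounds A from below
   (w = x), and shows that w is 0 if it is orthogonal to the range of A. *)
Lemma zero_in_rho (t0 : R) : 0 < t0 -> (forall x, nrm (T t0 x) <= 2^-1 * nrm x) -> rho A 0.
Proof.
move=> t00 half; have [M M0 hM] := sg_local_bound gen t0.
have dTi x w t : 0 <= t -> dom A x ->
    rderiv (fun s => re_inner (T s x) w) t (re_inner (T t (A x)) w).
  move=> t0' Dx; have := has_deriv_ri (sg_deriv t0' Dx) (has_deriv_cst t w).
  by rewrite ri0r addr0.
have t0b t : 0 <= t <= t0 -> 0 <= t by case/andP.
have low x : dom A x -> nrm x <= 2 * t0 * M * nrm (A x).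
  move=> Dx; have [x0|x0] := eqVneq (nrm x) 0.
    by rewrite x0 !mulr_ge0 ?nrm_ge0 // ltW.
  have xp : 0 < nrm x by rewrite lt_neqAle eq_sym x0 nrm_ge0.
  have := @rderiv_le R (fun t => -1 * re_inner (T t x) x) t0 (M * nrm (A x) * nrm x) (ltW t00).
  move=> /(_ _) h; have {}h : -1 * re_inner (T t0 x) x <= -1 * re_inner (T 0 x) x + t0 * (M * nrm (A x) * nrm x).
    apply: h => t ht; exists (-1 * re_inner (T t (A x)) x); last exact/rderivZ/dTi/Dx/(t0b t ht).
    rewrite mulN1r; apply: le_trans (ler_norm _) _; rewrite normrN.
    by apply: le_trans (ri_abs_le _ _) _; rewrite ler_wpM2r ?nrm_ge0 // hM.
  rewrite (sg0 gen) ri_self !mulN1r in h.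
  have := ri_le (T t0 x) x; have := ler_wpM2r (ltW xp) (half x).
  have e : nrm x ^+ 2 = nrm x * nrm x by rewrite expr2.
  rewrite e in h => h1 h2.
  have h3 : nrm x * nrm x <= 2 * t0 * M * nrm (A x) * nrm x by lra.
  by rewrite ler_pM2r in h3.
have lN x y : dom A x -> dom A y -> dom A (x - y) /\ A (x - y) = A x - A y.
  move=> Dx Dy; have := gen_comb gen (-1) Dy Dx.
  by rewrite !scaleN1r ![- _ + _]addrC.
have denseR : forall (w : X) (e : R), 0 < e -> exists2 z, [set A x | x in dom A] z & nrm (w - z) < e.
  apply: dense_of_orthogonal.
    have [D0 DS] := dom_closed gen; split.
      by exists 0 => //; have [_] := lN 0 0 D0 D0; rewrite !subrr.
    move=> a _ _ [x Dx <-] [y Dy <-]; have [D E] := gen_comb gen a Dx Dy.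
    by exists (a *: x + y).
  move=> y orth.
  have cst x : dom A x -> re_inner x y = re_inner (T t0 x) y.
    move=> Dx; have z t : 0 <= t <= t0 -> re_inner (T t (A x)) y = 0.
      move=> ht; have [D <-] := sg_dom (t0b t ht) Dx; apply: orth.
      by exists (T t x).
    have h1 := @rderiv_le R (fun t => re_inner (T t x) y) t0 0 (ltW t00).
    have h2 := @rderiv_le R (fun t => -1 * re_inner (T t x) y) t0 0 (ltW t00).
    rewrite (sg0 gen) mulr0 addr0 in h1; rewrite (sg0 gen) mulr0 addr0 !mulN1r lerN2 in h2.
    apply/le_anti/andP; split.
      apply: h2 => t ht; exists (-1 * re_inner (T t (A x)) y); last exact/rderivZ/dTi/Dx/(t0b t ht).
      by rewrite z // mulr0.
    apply: h1 => t ht; exists (re_inner (T t (A x)) y); last exact/dTi/Dx/(t0b t ht).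
    by rewrite z.
  apply: nrm0_eq0; apply/eqP; case: eqVneq => // y0.
  have yp : 0 < nrm y by rewrite lt_neqAle eq_sym y0 nrm_ge0.
  have [x Dx hx] := sg_dom_dense y (divr_gt0 yp (ltr0n _ 4)).
  (* The three terms are at most 1/4, 1/8 and 1/2 of [|y|^2], which is contradictory unless
     [y = 0]. *)
  have e1 : nrm y ^+ 2 = re_inner (y - x) y + re_inner (T t0 (x - y)) y + re_inner (T t0 y) y.
    by rewrite (linB (sg_lin gen (ltW t00))) !riBl ri_self (cst x Dx); ring.
  have := ri_le (y - x) y; have := ri_le (T t0 (x - y)) y; have := ri_le (T t0 y) y.
  have k1 : nrm (T t0 (x - y)) * nrm y <= 2^-1 * (nrm y / 4) * nrm y.
    rewrite ler_wpM2r ?nrm_ge0 //; apply: le_trans (half _) _.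
    by rewrite ler_wpM2l ?invr_ge0 // nrm_sym ltW.
  have k2 : nrm (T t0 y) * nrm y <= 2^-1 * nrm y * nrm y by rewrite ler_wpM2r ?nrm_ge0.
  have k3 : nrm (y - x) * nrm y <= nrm y / 4 * nrm y by rewrite ler_wpM2r ?nrm_ge0 // ltW.
  rewrite expr2 in e1; have yy : 0 < nrm y * nrm y by rewrite mulr_gt0.
  by move=> j1 j2 j3; exfalso; lra.
have hp n : 0 < (2^-1 : R) ^+ n by rewrite exprn_gt0 // invr_gt0.
have half01 : 0 <= (2^-1 : R) < 1 by rewrite invr_ge0 ler0n /= invf_lt1 // ltr1n.
have surj w : exists x, dom A x /\ - A x = w.
  have /choice[u hu] : forall n : nat, exists x, dom A x /\ nrm (- w - A x) < (2^-1 : R) ^+ n.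
    by move=> n; have [_ [x Dx <-] h] := denseR (- w) _ (hp n); exists x.
  (* The lower bound [low] turns the geometric approximation of [- w] by the [A (u n)] into
     convergence of the [u n] themselves. *)
  have C0 : 0 <= 2 * t0 * M * 2 by rewrite !mulr_ge0 // ltW.
  have [n|x hx] := @geometric_cvg _ _ u (2 * t0 * M * 2) 2^-1 C0 half01.
    have [Dn hn] := hu n; have [Dn1 hn1] := hu n.+1.
    have [D E] := lN _ _ Dn1 Dn; apply: le_trans (low _ D) _.
    rewrite -[X in _ <= X]mulrA ler_wpM2l ?mulr_ge0 ?(ltW t00) // E.
    apply: le_trans (nrm_triangle (- w) _ _) _; rewrite nrm_sym.
    by rewrite (exprS 2^-1 n) in hn1; have := hp n; lra.
  have c : A (u n) @[n --> \oo] --> - w.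
    by apply: cvg_pow2 => n; rewrite nrm_sym ltW //; case: (hu n).
  have [D E] := gen_closed_op (fun n => proj1 (hu n)) hx c.
  by exists x; rewrite E opprK.
have [Q hQ] := choice surj.
have inj x y : dom A x -> dom A y -> A x = A y -> x = y.
  move=> Dx Dy e; have [D E] := lN x y Dx Dy; apply/eqP; rewrite -subr_eq0.
  apply/eqP/nrm0_eq0/le_anti; rewrite nrm_ge0 andbT; apply: le_trans (low _ D) _.
  by rewrite E e subrr nrm0 mulr0.
exists Q; split.
- apply/bounded_linearP; split.
    move=> a x y; have [Dx Ex] := hQ x; have [Dy Ey] := hQ y.
    have [D E] := gen_comb gen a Dx Dy; have [D' E'] := hQ (a *: x + y).
    apply: inj => //; apply: oppr_inj; rewrite E' E opprD -scalerN.
    by rewrite Ex Ey.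
  exists (2 * t0 * M); first by rewrite !mulr_ge0 // ltW.
  by move=> x; have [Dx Ex] := hQ x; apply: le_trans (low _ Dx) _; rewrite -nrmN Ex.
- by move=> x; have [Dx Ex] := hQ x; rewrite scale0r sub0r.
- move=> x Dx; have [D E] := hQ (0 *: x - A x); apply: inj => //.
  by apply: oppr_inj; rewrite E scale0r sub0r.
Qed.

End Semigroup.

Ltac nneg := repeat first [assumption | exact: nrm_ge0 | exact: sqr_ge0 | exact: normr_ge0
  | exact: ler0n | exact: ler01 | exact: expR_ge0 | apply: addr_ge0 | apply: mulr_ge0
  | apply: exprn_ge0 | by rewrite invr_ge0 | by rewrite ltW].

Section Extensionality.
Context {R : realType} (H : hilbertType R).

(** Reduces an identity between vectors to one between reals, which [ring] decides; [inner_ext] does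
    the same when the scalars are complex. *)
Lemma ri_ext (x y : H) : (forall w, re_inner x w = re_inner y w) -> x = y.
Proof.
move=> h; apply/eqP; rewrite -subr_eq0; apply/eqP/nrm0_eq0/eqP.
by rewrite -sqrf_eq0 -ri_self riBl h subrr.
Qed.

Lemma inner_ext (x y : H) : (forall w, inner x w = inner y w) -> x = y.
Proof. by move=> h; apply: ri_ext => w; rewrite /re_inner h. Qed.

Definition riE := (@riDl R, @riBl R, @riNl R, @riZl R, @ri0l R).

End Extensionality.

(** * Rescaled semigroups and resolvent sets of dissipative generators *)

Section Rescaling.
Context {R : realType}.

(** Both bounds follow from [1 + x <= e^x]: applied to [- x] it gives [e^x <= 1 / (1 - x)]. *)
Lemma expR_lin (x : R) : `|x| <= 2^-1 -> `|expR x - 1 - x| <= 2 * x ^+ 2.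
Proof.
rewrite ler_norml => /andP[h1 h2].
have e1 := expR_ge1Dx x; have e2 := expR_ge1Dx (- x).
have p : 0 < 1 - x by lra.
have q := expR_gt0 (- x).
have e3 : expR x * (1 - x) <= 1.
  by rewrite -[X in _ <= X](expRxMexpNx_1 x) ler_wpM2l // ltW ?expR_gt0.
rewrite ger0_norm; last by lra.
have h3 : expR x <= 1 / (1 - x) by rewrite ler_pdivlMr.
apply: le_trans (_ : 1 / (1 - x) - 1 - x <= _); first by rewrite !lerD2r.
have -> : 1 / (1 - x) - 1 - x = x ^+ 2 / (1 - x) by field; rewrite gt_eqF.
rewrite ler_pdivrMr // -mulrA mulrCA; apply: ler_peMr; rewrite ?sqr_ge0 //; lra.
Qed.

Lemma expR_lip (x : R) : `|x| <= 2^-1 -> `|expR x - 1| <= 2 * `|x|.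
Proof.
move=> h; have := ler_normD (expR x - 1 - x) x; rewrite subrK => /le_trans; apply.
have := expR_lin h; have : x ^+ 2 <= 2^-1 * `|x|.
  by rewrite -normr_id -[x ^+ 2]ger0_norm ?sqr_ge0 // normrX expr2 normr_id ler_wpM2r.
by lra.
Qed.

Variables (X : hilbertType R).
Implicit Types (A : unbounded X) (T : R -> X -> X).

Lemma has_deriv_exp (V : completeNormedModType R[i]) (r t : R) (c : V) :
  has_deriv (fun s => (expR (r * s))%:C *: c) t ((r * expR (r * t))%:C *: c).
Proof.
apply/has_derivP => e e0.
pose K := 2 * expR (r * t) * r ^+ 2 * nrm c + 1.
have K0 : 0 < K by rewrite ltr_wpDl //; nneg.
have d0 : 0 < Num.min (e / K) (2^-1 / (`|r| + 1)).
  by rewrite lt_min !divr_gt0 // ltr_wpDl.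
apply: filterS (near_dist t d0) => s; rewrite lt_min => /andP[h1 h2] _.
have -> : (expR (r * s))%:C *: c - (expR (r * t))%:C *: c - (s - t)%:C *: ((r * expR (r * t))%:C *: c)
  = (expR (r * t) * (expR (r * (s - t)) - 1 - r * (s - t)))%:C *: c.
  rewrite scalerA -!scalerBl -!rmorphM -!rmorphB /=; congr (_%:C *: _).
  have -> : r * s = r * t + r * (s - t) by ring.
  by rewrite expRD; ring.
rewrite nrmZR normrM (ger0_norm (ltW (expR_gt0 _))).
have h : `|r * (s - t)| <= 2^-1.
  rewrite normrM; move: h2; rewrite ltr_pdivlMr ?ltr_wpDl // mulrDr mulr1 => h2.
  by have := normr_ge0 (s - t); rewrite mulrC; lra.
have := expR_lin h => h3.
have h4 : `|s - t| * K <= e by move: h1; rewrite ltr_pdivlMr // => /ltW.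
apply: le_trans (_ : expR (r * t) * (2 * (r * (s - t)) ^+ 2) * nrm c <= _).
  by rewrite ler_wpM2r ?nrm_ge0 // ler_wpM2l // ltW ?expR_gt0.
apply: le_trans (_ : `|s - t| * K * `|s - t| <= _); last by rewrite ler_wpM2r.
have -> : (r * (s - t)) ^+ 2 = r ^+ 2 * (`|s - t| * `|s - t|).
  by rewrite exprMn -expr2 real_normK ?num_real.
rewrite /K mulrDr mulr1 mulrDl.
have -> : expR (r * t) * (2 * (r ^+ 2 * (`|s - t| * `|s - t|))) * nrm c =
   `|s - t| * (2 * expR (r * t) * r ^+ 2 * nrm c) * `|s - t| by ring.
by rewrite lerDl mulr_ge0.
Qed.

Lemma quotient_rescale (f : R -> X) (x y : X) (c : R) :
  (h^-1)%:C *: (f h - x) @[h --> 0^'+] --> y ->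
  (h^-1)%:C *: ((expR (c * h))%:C *: f h - x) @[h --> 0^'+] --> y + c%:C *: x.
Proof.
move=> /quotientP H; apply/quotientP => e e0.
have [r r0 hr] := H (e / 4) (divr_gt0 e0 (ltr0n _ 4)).
pose K := 2 * c ^+ 2 * nrm x + 2 * `|c| * nrm y + 1.
have K0 : 0 < K by rewrite ltr_wpDl //; nneg.
have c1 : 0 < `|c| + 1 by rewrite ltr_wpDl.
exists (Num.min r (Num.min (e / 2 / K) (2^-1 / (`|c| + 1)))).
  by rewrite !lt_min r0 !divr_gt0.
move=> h; rewrite !lt_min => /andP[h0 /andP[h1 /andP[h2 h3]]].
have hf := hr h; rewrite h0 h1 in hf; have {}hf := hf isT.
set E := expR (c * h).
have ch : `|c * h| <= 2^-1.
  rewrite normrM (gtr0_norm h0); move: h3; rewrite ltr_pdivlMr // mulrDr mulr1 => h3.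
  by rewrite mulrC; lra.
have E1 := expR_lip ch; have E2 := expR_lin ch; rewrite -/E in E1 E2.
have E3 : `|E| <= 2.
  have := ler_normD (E - 1) 1; rewrite subrK normr1; lra.
have -> : E%:C *: f h - x - h%:C *: (y + c%:C *: x) =
  E%:C *: (f h - x - h%:C *: y) + ((E - 1 - c * h)%:C *: x + ((E - 1) * h)%:C *: y).
  by apply: ri_ext => w; rewrite !riE; ring.
apply: le_trans (nrmD _ _) _; apply: le_trans (lerD (lexx _) (nrmD _ _)) _.
rewrite !nrmZR normrM (gtr0_norm h0).
have k1 : `|E| * nrm (f h - x - h%:C *: y) <= 2 * (e / 4 * h).
  by apply: ler_pM => //; exact: nrm_ge0.
have k2 : `|E - 1 - c * h| * nrm x <= 2 * (c * h) ^+ 2 * nrm x by rewrite ler_wpM2r ?nrm_ge0.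
have k3 : `|E - 1| * h * nrm y <= 2 * `|c * h| * h * nrm y.
  by rewrite ler_wpM2r ?nrm_ge0 // ler_wpM2r // ltW.
have k4 : h * K <= e / 2 by move: h2; rewrite ltr_pdivlMr // => /ltW.
have k5 : 2 * (c * h) ^+ 2 * nrm x + 2 * `|c * h| * h * nrm y <= h * K * h.
  rewrite normrM (gtr0_norm h0) /K.
  have -> : h * (2 * c ^+ 2 * nrm x + 2 * `|c| * nrm y + 1) * h =
    2 * (c * h) ^+ 2 * nrm x + 2 * (`|c| * h) * h * nrm y + h * h by ring.
  by rewrite lerDl mulr_ge0 // ltW.
have k6 : h * K * h <= e / 2 * h by rewrite ler_wpM2r // ltW.
by lra.
Qed.

Definition shift A (r : R) := Unbounded (dom A) (fun x => A x - r%:C *: x).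

Lemma rescale_generates A T (r : R) : generates A T ->
  generates (shift A r) (fun t x => (expR (- r * t))%:C *: T t x).
Proof.
move=> gen; have [[T1 T2 T3 T4] T5] := gen; split; first split.
- by move=> t t0; apply: bounded_linearZ; exact: T1.
- by rewrite T2 mulr0 expR0; apply/funext => x; rewrite scale1r.
- move=> s t s0 t0; rewrite T3 //; apply/funext => x /=.
  by rewrite (linZ (proj1 (T1 s s0))) scalerA -rmorphM -expRD -mulrDr.
- move=> x; apply/(at_right0_cvgP) => e e0.
  have e2 : 0 < e / 2 by rewrite divr_gt0.
  have [d d0 hd] := sg_cont0 gen x (divr_gt0 e0 (ltr0n _ 4)).
  pose K := `|r| * nrm x + `|r| + 1.
  have K0 : 0 < K by rewrite ltr_wpDl // addr_ge0 // mulr_ge0 // nrm_ge0.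
  exists (Num.min d (Num.min (2^-1 / K) (e / 4 / K))); first by rewrite !lt_min d0 !divr_gt0.
  move=> h; rewrite !lt_min => /andP[h0 /andP[h1 /andP[h2 h3]]].
  have := hd h; rewrite (ltW h0) h1 => /(_ isT) hT.
  rewrite !ltr_pdivlMr // in h2 h3.
  have hrx : 0 <= h * (`|r| * nrm x) by rewrite !mulr_ge0 ?nrm_ge0 // ltW.
  have hrr : 0 <= h * `|r| by rewrite mulr_ge0 // ltW.
  have hr : `|- r * h| <= 2^-1.
    by rewrite normrM normrN (gtr0_norm h0) mulrC; rewrite /K in h2; lra.
  have E1 := expR_lip hr; set E := expR _ in E1 *.
  have E3 : `|E| <= 2 by have := ler_normD (E - 1) 1; rewrite subrK normr1; lra.
  have -> : E%:C *: T h x - x = E%:C *: (T h x - x) + (E - 1)%:C *: x.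
    by rewrite scalerBr rmorphB scalerBl /= scale1r addrA subrK.
  apply: le_lt_trans (nrmD _ _) _; rewrite !nrmZR.
  have k1 : `|E| * nrm (T h x - x) <= 2 * nrm (T h x - x) by rewrite ler_wpM2r ?nrm_ge0.
  have k2 : `|E - 1| * nrm x <= 2 * (h * (`|r| * nrm x)).
    rewrite mulrA -mulrA; apply: le_trans (ler_wpM2r (nrm_ge0 _) E1) _.
    by rewrite normrM normrN (gtr0_norm h0) le_eqVlt; apply/orP; left; apply/eqP; ring.
  by rewrite /K in h3; lra.
- move=> x y; split=> [[Dx <-]|h].
    have := @quotient_rescale (T^~ x) x (A x) (- r) (proj1 (T5 x (A x)) (conj Dx erefl)).
    by rewrite rmorphN scaleNr.
  (* Conversely, multiplying by [e^(r h)] undoes the rescaling and adds [r x] back to the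
     derivative. *)
  have := @quotient_rescale _ _ _ r h.
  have -> : (fun h : R => (h^-1)%:C *: ((expR (r * h))%:C *: ((expR (- r * h))%:C *: T h x) - x)) =
      (fun h => (h^-1)%:C *: (T h x - x)).
    apply/funext => k; rewrite scalerA -rmorphM /= -expRD mulNr subrr expR0.
    by rewrite scale1r.
  by move=> /T5[Dx AE]; split=> //=; rewrite AE addrK.
Qed.

(** [e^(-r t) T_t] is generated by [A - r], so [zero_in_rho] for the rescaled semigroup is the claim
    for [r]. *)
Lemma real_in_rho A T (r t0 : R) : generates A T -> (exists s, rho A s) -> 0 < t0 ->
  (forall x, expR (- r * t0) * nrm (T t0 x) <= 2^-1 * nrm x) -> rho A r%:C.
Proof.
move=> gen [s [Q [bQ Q1 Q2]]] t00 hT.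
have shE (q a : X) : (s - r%:C) *: q - (a - r%:C *: q) = s *: q - a.
  by rewrite scalerBl opprB addrA subrK.
have [||Q0 [bQ0 Q01 Q02]] := @zero_in_rho _ _ _ _ (rescale_generates r gen) _ t0 t00.
- exists (s - r%:C), Q; split => //=.
    move=> x; have [Dx E] := Q1 x; split=> //.
    by rewrite shE.
  by move=> x Dx; rewrite shE Q2.
- by move=> x /=; rewrite nrmZR ger0_norm ?expR_ge0.
exists Q0; split=> // [x|x Dx].
  have [Dx E] := Q01 x; split=> //; rewrite -[RHS]E scale0r sub0r /=.
  by rewrite opprB.
by have := Q02 x Dx; rewrite scale0r sub0r /= opprB.
Qed.

(** At time 1 the required bound is [e^(-r) M <= 1/2], and [e^r >= 1 + r >= 2 M] as soon as
    [r >= 2 M]. *)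
Lemma rho_eventually A T : generates A T -> (exists s, rho A s) ->
  exists r0 : R, forall r : R, r0 <= r -> rho A r%:C.
Proof.
move=> gen hA; have [M M0 hM] := sg_local_bound gen 1.
exists (2 * M) => r hr; apply: (real_in_rho gen hA ltr01) => x.
have r0 : 0 <= r by apply: le_trans hr; rewrite mulr_ge0.
have h1 := expR_ge1Dx r; have h2 := expR_gt0 r.
rewrite mulr1 expRN ler_pdivrMl //.
apply: le_trans (hM _ _ _) _; first by rewrite ler01 lexx.
rewrite mulrA ler_wpM2r ?nrm_ge0 //; lra.
Qed.

Lemma contraction_real_rho A T (r : R) : generates A T -> (exists s, rho A s) ->
  contraction_semigroup T -> 0 < r -> rho A r%:C.
Proof.
(* At time [1 / r] the rescaling factor is [e^(-1) <= 1/2]. *)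
move=> gen hA cT r0; have t00 : 0 < r^-1 by rewrite invr_gt0.
apply: (real_in_rho gen hA t00) => x.
rewrite mulNr mulfV ?gt_eqF // ler_pM ?expR_ge0 ?nrm_ge0 ?cT ?(ltW t00) //.
rewrite expRN lef_pV2 ?posrE ?expR_gt0 //.
by have := expR_ge1Dx (1 : R); lra.
Qed.

(** On [dom A] the derivative of [|T_s d|^2] is [2 Re <T_s d, A T_s d> <= 0]; the local bound
    carries the estimate to all of [X] by density. *)
Lemma dissipative_contraction A T : generates A T -> (exists s, rho A s) ->
  (forall x, dom A x -> re_inner x (A x) <= 0) -> contraction_semigroup T.
Proof.
move=> gen hA dA t x t0; apply/ler_addgt0Pr => e e0.
have [M M0 hM] := sg_local_bound gen t.
have M1 : 0 < M + 1 by rewrite ltr_wpDl.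
have [d Dd hd] := sg_dom_dense gen hA x (divr_gt0 e0 (addr_gt0 M1 ltr01)).
have h1 : nrm (T t d) <= nrm d.
  rewrite -(@ler_pXn2r _ 2) ?nnegrE ?nrm_ge0 //.
  have := @rderiv_nincr R (fun s => nrm (T s d) ^+ 2) 0 t (lexx _) t0.
  rewrite (sg0 gen); apply=> s /andP[s0 _]; have [D E] := sg_dom gen s0 Dd.
  exists (2 * re_inner (T s d) (T s (A d))); last exact/has_deriv_sq/sg_deriv.
  by rewrite -E pmulr_rle0 // dA.
have h2 : nrm (T t x) <= nrm (T t d) + M * nrm (x - d).
  rewrite -{1}(subrK d x) (linD (sg_lin gen t0)) addrC.
  by apply: le_trans (nrmD _ _) _; rewrite lerD2l hM // t0 lexx.
have h3 : nrm d <= nrm x + nrm (x - d) by rewrite -{1}(subKr x d) nrmB.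
have : nrm (x - d) * (M + 1 + 1) <= e by move: hd; rewrite (ltr_pdivlMr _ _ (addr_gt0 M1 ltr01)) => /ltW.
by have := nrm_ge0 (x - d); nra.
Qed.

(* s - A = (I - (r - s) (r - A)^-1) (r - A), and the bracket is invertible
   because |s - r| < r once r is large *)
Lemma dissipative_rho A T (s : R[i]) : generates A T -> (exists s, rho A s) ->
  (forall x, dom A x -> re_inner x (A x) <= 0) -> 0 < complex.Re s -> rho A s.
Proof.
move=> gen hA dA s0; have cT := dissipative_contraction gen hA dA.
(* With this value [|r - s|^2 = r^2 - |s|^2 - 2 Re s < r^2]. *)
pose r := modc s ^+ 2 / complex.Re s + 1.
have r0 : 0 < r by rewrite ltr_wpDl // divr_ge0 ?sqr_ge0 // ltW.
have [Q [bQ Q1 Q2]] := contraction_real_rho gen hA cT r0.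
have hQ x : nrm (Q x) <= r^-1 * nrm x.
  have [D E] := Q1 x; rewrite ler_pdivlMl //.
  have [q0|q0] := eqVneq (nrm (Q x)) 0; first by rewrite q0 mulr0 nrm_ge0.
  have qp : 0 < nrm (Q x) by rewrite lt_neqAle eq_sym q0 nrm_ge0.
  rewrite -(ler_pM2r qp) -mulrA -expr2 -ri_self -riZl.
  apply: le_trans (ri_le _ _).
  have -> : re_inner x (Q x) = re_inner (r%:C *: Q x - A (Q x)) (Q x) by rewrite E.
  by rewrite riBl lerDl oppr_ge0 riC dA.
have hs : modc (r%:C - s) < r.
  rewrite -(@ltr_pXn2r _ 2) ?nnegrE ?modc_ge0 ?(ltW r0) //.
  have e : modc (r%:C - s) ^+ 2 = r ^+ 2 - 2 * r * complex.Re s + modc s ^+ 2.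
    apply: complexI; rewrite rmorphXn /= -modcE -add_Re2_Im2; congr (_%:C).
    have -> : modc s ^+ 2 = complex.Re s ^+ 2 + complex.Im s ^+ 2.
      by apply: complexI; rewrite rmorphXn /= -modcE -add_Re2_Im2.
    by case: (s) => a b /=; ring.
  have e2 : r * complex.Re s = modc s ^+ 2 + complex.Re s.
    by rewrite /r mulrDl mul1r divfK ?gt_eqF.
  by rewrite e -[2 * r * _]mulrA e2; have := sqr_ge0 (modc s); lra.
have [|||P [bP [PK KP]]] := @inverse_near_id _ _ (fun x => (r%:C - s) *: Q x) (modc (r%:C - s) / r).
- by move=> a x y; rewrite (proj1 bQ) scalerDr !scalerA mulrC.
- by rewrite divr_ge0 ?modc_ge0 ?(ltW r0) //= ltr_pdivrMr // mul1r.
- by move=> x; rewrite nrmZ -mulrA ler_wpM2l // modc_ge0.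
exists (Q \o P); split.
- exact: bounded_linear_comp.
- move=> x /=; have [D E] := Q1 (P x); split=> //.
  rewrite -[RHS]KP; set q := Q (P x) in D E *; rewrite -E; apply: inner_ext => w.
  by rewrite !(linearDl, linearBl, linearNl, linearZl_LR) /=; ring.
- move=> x Dx /=; have := Q2 x Dx; set w := r%:C *: x - A x => Qw.
  rewrite -[RHS]Qw -[in RHS](PK w); congr (Q (P _)); rewrite Qw /w.
  apply: inner_ext => v.
  by rewrite !(linearDl, linearBl, linearNl, linearZl_LR) /=; ring.
Qed.

End Rescaling.

(* The semigroup is the limit of the implicit Euler scheme with step 2^-n, which
   converges because halving the step h changes one step by O(h^2). *)
Section HilleYosida.
Context {R : realType} (X : hilbertType R) (A : unbounded X).
Hypothesis rhoA : forall r : R, 0 < r -> rho A r%:C.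
Hypothesis disA : forall x, dom A x -> re_inner x (A x) <= 0.

(** Linearity of [A] is not assumed but inherited from its resolvent at 1. *)
Lemma dom_comb a x y : dom A x -> dom A y ->
  dom A (a *: x + y) /\ A (a *: x + y) = a *: A x + A y.
Proof.
have [bQ Q1 Q2] := resolventP (rhoA ltr01); set Q := resolvent _ _ in bQ Q1 Q2.
move=> Dx Dy; have [D E] := Q1 (a *: (1%:C *: x - A x) + (1%:C *: y - A y)).
rewrite (proj1 bQ) !Q2 // in D E; split=> //.
have := congr1 (fun z => (a *: x + y) - z) E; rewrite !scale1r subKr => ->.
by apply: inner_ext => w; rewrite !(linearDl, linearBl, linearNl, linearZl_LR) /=; ring.
Qed.

Lemma dom0 : dom A 0 /\ A 0 = 0.
Proof.
have [bQ Q1 Q2] := resolventP (rhoA ltr01); have [D E] := Q1 0.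
rewrite (lin0 (proj1 bQ)) in D E; split=> //.
by rewrite scaler0 sub0r in E; rewrite -[A 0]opprK E oppr0.
Qed.

Lemma domZ a x : dom A x -> dom A (a *: x) /\ A (a *: x) = a *: A x.
Proof. by move=> Dx; have [D E] := dom_comb a Dx (proj1 dom0); rewrite !addr0 (proj2 dom0) addr0 in D E. Qed.

Lemma domB x y : dom A x -> dom A y -> dom A (x - y) /\ A (x - y) = A x - A y.
Proof.
move=> Dx Dy; have [D E] := dom_comb (-1) Dy Dx.
by rewrite !scaleN1r ![- _ + _]addrC in D E.
Qed.

(** This is [(1 - h A)^-1], one implicit Euler step; it is locked so that rewriting does not unfold
    it. *)
Definition yosida (h : R) (x : X) : X :=
  locked ((h^-1)%:C *: resolvent A (h^-1)%:C x).
Local Notation J := yosida.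

Lemma J1 h x : 0 < h -> dom A (J h x) /\ J h x - h%:C *: A (J h x) = x.
Proof.
move=> h0; have h1 : 0 < h^-1 by rewrite invr_gt0.
have [bQ Q1 Q2] := resolventP (rhoA h1); have [D E] := Q1 x.
have [D' E'] := domZ (h^-1)%:C D; rewrite /J -lock; split=> //; rewrite -[RHS]E E' scalerA.
by rewrite -rmorphM /= mulfV ?gt_eqF // scale1r.
Qed.

Lemma J2 h x : 0 < h -> dom A x -> J h (x - h%:C *: A x) = x.
Proof.
move=> h0 Dx; have h1 : 0 < h^-1 by rewrite invr_gt0.
have [bQ Q1 Q2] := resolventP (rhoA h1).
rewrite -[RHS](Q2 x Dx) /J -lock -(linZ (proj1 bQ)) scalerBr scalerA -rmorphM /=.
by rewrite mulVf ?gt_eqF // scale1r.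
Qed.

Lemma J_lin h : 0 < h -> linear (J h).
Proof.
move=> h0 a x y; have h1 : 0 < h^-1 by rewrite invr_gt0.
have [bQ _ _] := resolventP (rhoA h1).
by rewrite /J -!lock (proj1 bQ) scalerDr !scalerA mulrC.
Qed.

Lemma J_le h x : 0 < h -> nrm (J h x) <= nrm x.
Proof.
move=> h0; have [D E] := J1 x h0.
have [q0|q0] := eqVneq (nrm (J h x)) 0; first by rewrite q0 nrm_ge0.
have qp : 0 < nrm (J h x) by rewrite lt_neqAle eq_sym q0 nrm_ge0.
rewrite -(ler_pM2r qp) -expr2 -ri_self; apply: le_trans (ri_le _ _).
have -> : re_inner x (J h x) = re_inner (J h x - h%:C *: A (J h x)) (J h x) by rewrite E.
by rewrite riBl riZl lerDl oppr_ge0 (riC (A _)) pmulr_rle0 // disA.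
Qed.

Lemma J_comm h x : 0 < h -> dom A x -> A (J h x) = J h (A x).
Proof.
move=> h0 Dx; have [D E] := J1 x h0; have E2 := J2 h0 Dx.
rewrite (linB (J_lin h0)) (linZ (J_lin h0)) in E2.
have : h%:C *: A (J h x) = h%:C *: J h (A x).
  by apply/oppr_inj/(@addrI _ (J h x)); rewrite E E2.
move=> /(congr1 (fun z => (h^-1)%:C *: z)).
by rewrite !scalerA -rmorphM /= mulVf ?gt_eqF // !scale1r.
Qed.

Lemma J_near h x : 0 < h -> dom A x -> nrm (J h x - x) <= h * nrm (A x).
Proof.
move=> h0 Dx; have [D E] := J1 x h0.
rewrite -{2}E subKr nrmZR gtr0_norm // J_comm // ler_wpM2l ?(ltW h0) //.
exact: J_le.
Qed.

Definition dom2 := [set x | dom A x /\ dom A (A x)].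

Lemma dom2_closed : subspace_closed dom2.
Proof.
split; first by rewrite /dom2 /= (proj2 dom0); split; exact: (proj1 dom0).
move=> a x y [Dx Dx'] [Dy Dy']; have [D E] := dom_comb a Dx Dy.
by split=> //; rewrite E; case: (dom_comb a Dx' Dy').
Qed.

Lemma J_dom2 h x : 0 < h -> dom A x -> dom2 (J h x).
Proof.
move=> h0 Dx; have [D _] := J1 x h0; split=> //; rewrite J_comm //.
by case: (J1 (A x) h0).
Qed.

Lemma J_comm2 h x : 0 < h -> dom2 x -> A (A (J h x)) = J h (A (A x)).
Proof. by move=> h0 [Dx Dx']; rewrite !J_comm. Qed.

Lemma iterJ_lin h k : 0 < h -> linear (iter k (J h)).
Proof. by move=> h0 a x y; elim: k => [//|k IH] /=; rewrite IH (J_lin h0). Qed.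

Lemma iterJ_le h k x : 0 < h -> nrm (iter k (J h) x) <= nrm x.
Proof. by move=> h0; elim: k => [//|k IH] /=; apply: le_trans (J_le _ h0) IH. Qed.

Lemma iterJ_near h k x : 0 < h -> dom A x ->
  nrm (iter k (J h) x - x) <= k%:R * h * nrm (A x).
Proof.
move=> h0 Dx; elim: k => [|k IH]; first by rewrite /= subrr nrm0 !mul0r.
apply: le_trans (nrm_triangle (J h x) _ _) _.
rewrite -natr1 mulrDl mul1r mulrDl lerD ?J_near //=.
by rewrite -(linB (J_lin h0)); apply: le_trans (J_le _ h0) IH.
Qed.

(** With [k = h / 2] and [w = J h x], [(1 - k A)^2 w = (1 - h A) w + k^2 A^2 w = x + k^2 A^2 w];
    hence the two schemes differ by [k^2] times two half steps applied to [A^2 w]. *)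
Lemma J_halve h x : 0 < h -> dom2 x ->
  nrm (J h x - J (h / 2) (J (h / 2) x)) <= h ^+ 2 / 4 * nrm (A (A x)).
Proof.
move=> h0 [Dx Dx']; pose k := h / 2; have k0 : 0 < k by rewrite divr_gt0.
have [D E] := J1 x h0; set w := J h x in D E *.
have [Dw Dw'] : dom2 w by apply: J_dom2.
have lJ := J_lin k0.
have h2 : h%:C *: A w = k%:C *: A w + k%:C *: A w.
  by rewrite -scalerDl -rmorphD /= -splitr.
have e : J k (J k (x + (k ^+ 2)%:C *: A (A w))) = w.
  rewrite -{2}(J2 k0 Dw) -[in RHS](J2 k0 (proj1 (domB Dw (proj1 (domZ k%:C Dw'))))).
  rewrite (proj2 (domB Dw (proj1 (domZ k%:C Dw')))) (proj2 (domZ k%:C Dw')).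
  congr (J k (J k _)); rewrite -{1}E h2 scalerBr scalerA -rmorphM -expr2.
  by apply: ri_ext => v; rewrite !riE; ring.
have -> : w - J k (J k x) = (k ^+ 2)%:C *: J k (J k (A (A w))).
  apply: (canLR (addrK _)); move: e.
  by rewrite !(linD lJ) !(linZ lJ) addrC => ->.
have kk : k ^+ 2 = h ^+ 2 / 4 by rewrite /k; field.
rewrite nrmZR ger0_norm ?sqr_ge0 // kk ler_wpM2l ?divr_ge0 ?sqr_ge0 //.
apply: le_trans (J_le _ k0) _; apply: le_trans (J_le _ k0) _.
by rewrite /w J_comm // J_comm // J_le.
Qed.

(** One full step at a time is exchanged for two half steps. Contractivity carries each error
    forward without growth, so [m] errors of size [h^2 / 4] add up to order [h] over a bounded
    time. *)
Lemma iterJ_halve h m x : 0 < h -> dom2 x ->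
  nrm (iter m (J h) x - iter m.*2 (J (h / 2)) x) <= m%:R * (h ^+ 2 / 4) * nrm (A (A x)).
Proof.
move=> h0; have k0 : 0 < h / 2 by rewrite divr_gt0.
elim: m x => [|m IH] x D2; first by rewrite /= subrr nrm0 !mul0r.
rewrite iterSr doubleS !iterSr.
set y := J (h / 2) (J (h / 2) x).
apply: le_trans (nrm_triangle (iter m (J h) y) _ _) _.
rewrite -(natr1 m) mulrDl mul1r mulrDl addrC lerD //.
  have Dy : dom2 y by apply: J_dom2 => //; case: (J1 x k0).
  apply: le_trans (IH y Dy) _; rewrite ler_wpM2l ?mulr_ge0 ?divr_ge0 ?sqr_ge0 ?(ltW h0) //.
  rewrite /y !J_comm2 //; last by apply: J_dom2 => //; case: D2.
  by apply: le_trans (J_le _ k0) (J_le _ k0).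
rewrite -(linB (iterJ_lin m h0)); apply: le_trans (iterJ_le _ _ h0) _.
exact: J_halve.
Qed.

Lemma iterJ_taylor h k x : 0 < h -> dom2 x ->
  nrm (iter k (J h) x - x - (k%:R * h)%:C *: A x) <= (k%:R * h) ^+ 2 * nrm (A (A x)).
Proof.
move=> h0 [Dx Dx']; set a := nrm (A (A x)).
elim: k => [|k IH]; first by rewrite /= subrr mul0r scale0r subrr nrm0 expr0n mul0r.
have lJ := J_lin h0.
have eJ : J h x - x - h%:C *: A x = h%:C *: (J h (A x) - A x).
  have [D E] := J1 x h0; rewrite -{2}E subKr J_comm // -scalerBr //.
(* One step applied to the previous remainder, plus the consistency error of a single step, plus the
   lag of [J h] on [A x]. *)
have -> : iter k.+1 (J h) x - x - (k.+1%:R * h)%:C *: A x =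
  J h (iter k (J h) x - x - (k%:R * h)%:C *: A x) +
  ((J h x - x - h%:C *: A x) + (k%:R * h)%:C *: (J h (A x) - A x)).
  rewrite !(linB lJ) (linZ lJ) -natr1 mulrDl mul1r /=.
  by apply: ri_ext => v; rewrite !riE; ring.
apply: le_trans (nrmD _ _) _; apply: le_trans (lerD (J_le _ h0) (nrmD _ _)) _.
rewrite eJ !nrmZR !ger0_norm ?mulr_ge0 ?(ltW h0) //.
have k1 := J_near h0 Dx'; rewrite -/a in k1.
have k2 : h * nrm (J h (A x) - A x) <= h * (h * a) by rewrite ler_wpM2l ?(ltW h0).
have k3 : k%:R * h * nrm (J h (A x) - A x) <= k%:R * h * (h * a).
  by rewrite ler_wpM2l ?mulr_ge0 ?(ltW h0).
apply: le_trans (lerD IH (lerD k2 k3)) _; rewrite -natr1.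
have : 0 <= k%:R * h * h * a by rewrite !mulr_ge0 ?(ltW h0) // nrm_ge0.
by rewrite expr2 [(_ + 1)%R]addrC; nra.
Qed.

(** If [y] is orthogonal to [dom A], then [x = J 1 y] satisfies
    [0 = <x, y> = |x|^2 - <x, A x> >= |x|^2], so [x = 0] and [y = x - A x = 0]. *)
Lemma dom_dense (w : X) (e : R) : 0 < e -> exists2 x, dom A x & nrm (w - x) < e.
Proof.
apply: dense_of_orthogonal; first by split=> [|a x y Dx Dy]; [case: dom0|case: (dom_comb a Dx Dy)].
move=> y orth; have [D E] := J1 y ltr01; set x := J 1 y in D E *.
have := orth x D; rewrite -E scale1r riBr ri_self => h.
have x0 : x = 0.
  apply/nrm0_eq0/eqP; rewrite -sqrf_eq0 eq_le sqr_ge0 andbT.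
  by have := disA D; lra.
by rewrite x0 (proj2 dom0) subrr.
Qed.

Lemma dom2_dense (w : X) (e : R) : 0 < e -> exists2 x, dom2 x & nrm (w - x) < e.
Proof.
move=> e0; have [d Dd hd] := dom_dense w (divr_gt0 e0 (ltr0n _ 2)).
have n0 : 0 < nrm (A d) + 1 by rewrite ltr_wpDl ?nrm_ge0.
pose h := e / 2 / (nrm (A d) + 1); have h0 : 0 < h by rewrite !divr_gt0.
exists (J h d); first exact: J_dom2.
apply: le_lt_trans (nrm_triangle d _ _) _; have := J_near h0 Dd; rewrite (nrm_sym d (J h d)).
have : h * nrm (A d) <= e / 2.
  by rewrite /h mulrAC ler_pdivrMr // ler_wpM2l ?divr_ge0 ?(ltW e0) // lerDl.
by lra.
Qed.

Let hn (n : nat) : R := 2^-1 ^+ n.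

Let hn_gt0 n : 0 < hn n.
Proof. by rewrite exprn_gt0 // invr_gt0. Qed.

Let steps (t : R) n := Num.truncn (t / hn n).

Definition euler n (t : R) (x : X) := iter (steps t n) (J (hn n)) x.

Let stepsP (t : R) n : 0 <= t -> (steps t n)%:R * hn n <= t < (steps t n).+1%:R * hn n.
Proof.
move=> t0; have := truncn_itv (divr_ge0 t0 (ltW (hn_gt0 n))).
by rewrite ler_pdivlMr // ltr_pdivrMr.
Qed.

Let hnS n : hn n.+1 = hn n / 2.
Proof. by rewrite /hn exprSr. Qed.

Lemma euler_step n (t : R) x : 0 <= t -> dom2 x ->
  nrm (euler n.+1 t x - euler n t x) <= (t * nrm (A (A x)) + nrm (A x)) * hn n.
Proof.
move=> t0 D2; have [Dx _] := D2; rewrite /euler hnS.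
have /andP[h1 h2] := stepsP n t0; have /andP[h3 h4] := stepsP n.+1 t0.
set m := steps t n in h1 h2 *; set p := steps t n.+1 in h3 h4 *.
have hp := hn_gt0 n; have kp : 0 < hn n / 2 by rewrite divr_gt0.
rewrite hnS in h3 h4.
(* Halving the step makes the number of steps [2 m] or [2 m + 1]; the possible extra step is paid
   for by [J_near]. *)
have mp : (m.*2 <= p)%N.
  rewrite -ltnS -(@ltr_nat R) -(ltr_pM2r kp); apply: le_lt_trans h4.
  apply: le_trans h1; rewrite -muln2 natrM le_eqVlt; apply/orP; left; apply/eqP; by field.
have pm : (p <= m.*2.+1)%N.
  rewrite -ltnS -(@ltr_nat R) -(ltr_pM2r kp); apply: le_lt_trans h3 (lt_le_trans h2 _).
  rewrite -doubleS -muln2 natrM le_eqVlt; apply/orP; left; apply/eqP; by field.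
have e1 : nrm (iter p (J (hn n / 2)) x - iter m.*2 (J (hn n / 2)) x) <= hn n / 2 * nrm (A x).
  have [->|->] : p = m.*2 \/ p = m.*2.+1.
    by move: mp pm; rewrite leq_eqVlt => /orP[/eqP ->|h]; [left|rewrite leq_eqVlt ltnS leqNgt h orbF => /eqP; right].
    by rewrite subrr nrm0; nneg.
  rewrite iterSr -(linB (iterJ_lin _ kp)).
  by apply: le_trans (iterJ_le _ _ kp) _; exact: J_near.
have e2 := iterJ_halve m hp D2; rewrite nrm_sym in e2.
apply: le_trans (nrm_triangle _ _ _) (le_trans (lerD e1 e2) _).
have h5 : m%:R * (hn n ^+ 2 / 4) <= t * hn n.
  have -> : m%:R * (hn n ^+ 2 / 4) = (m%:R * hn n) * hn n / 4 by rewrite expr2; field.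
  rewrite ler_pdivrMr //; have : 0 <= t * hn n by rewrite mulr_ge0 // ltW.
  by have := ler_wpM2r (ltW hp) h1; lra.
have := ler_wpM2r (nrm_ge0 (A (A x))) h5; have : 0 <= hn n * nrm (A x) by nneg.
lra.
Qed.

Lemma euler_le n (t : R) x : nrm (euler n t x) <= nrm x.
Proof. exact: iterJ_le. Qed.

Lemma euler_cvg (t : R) x : 0 <= t -> dom2 x -> exists l : X, euler n t x @[n --> \oo] --> l.
Proof.
move=> t0 D2; apply: (@geometric_cvg _ _ _ (t * nrm (A (A x)) + nrm (A x)) 2^-1).
- by nneg.
- by rewrite invr_ge0 ler0n /= invf_lt1 // ltr1n.
- by move=> n; exact: euler_step.
Qed.

Definition hy_limit (t : R) (x : X) : X := xget 0 [set l | euler n t x @[n --> \oo] --> l].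

Definition hy_semigroup (t : R) : X -> X := extension dom2 id (hy_limit t).

Local Notation T := hy_semigroup.

Let limE (t : R) x : 0 <= t -> dom2 x -> euler n t x @[n --> \oo] --> hy_limit t x.
Proof.
move=> t0 D2; have [l hl] := euler_cvg t0 D2.
have h : exists l, [set l : X | euler n t x @[n --> \oo] --> l] l by exists l.
exact: (xgetPex 0 h).
Qed.

Lemma hy_ext (t : R) : 0 <= t -> bounded_linear (T t) /\ forall x, dom2 x -> T t x = hy_limit t x.
Proof.
move=> t0; apply: (@extensionP _ _ _ _ dom2 id (hy_limit t) 1) => //.
- exact: dom2_closed.
- move=> a x y D2x D2y; have Dxy := proj2 dom2_closed a x y D2x D2y.
  have c : euler n t (a *: x + y) @[n --> \oo] --> a *: hy_limit t x + hy_limit t y.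
    rewrite (_ : (fun n => _) = (fun n => a *: euler n t x + euler n t y)).
      by apply: cvgD; [apply: cvgZl_tmp|]; exact: limE.
    by apply/funext => n; rewrite /euler (iterJ_lin _ (hn_gt0 n)).
  exact: (cvg_unique _ (limE t0 Dxy) c).
- move=> x D2x; rewrite mul1r.
  have c : nrm (euler n t x) @[n --> \oo] --> nrm (hy_limit t x) by apply: cvg_nrm; exact: limE.
  apply: (cvgr_to_le c).
  by apply: nearW => n; exact: euler_le.
- exact: dom2_dense.
Qed.

Lemma hy_lin (t : R) : 0 <= t -> linear (T t).
Proof. by move=> t0; case: (hy_ext t0) => -[]. Qed.

Lemma hy_cvg_dom2 (t : R) x : 0 <= t -> dom2 x -> euler n t x @[n --> \oo] --> T t x.
Proof. by move=> t0 D2; rewrite (proj2 (hy_ext t0)) //; exact: limE. Qed.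

Lemma hy_le (t : R) x : 0 <= t -> nrm (T t x) <= nrm x.
Proof.
move=> t0; apply/ler_addgt0Pr => e e0.
have [lT [M M0 hM]] := proj1 (bounded_linearP _) (proj1 (hy_ext t0)).
have M1 : 0 < M + 1 by rewrite ltr_wpDl.
have [d Dd hd] := dom2_dense x (divr_gt0 e0 M1).
have h1 : nrm (T t d) <= nrm d.
  have c : nrm (euler n t d) @[n --> \oo] --> nrm (T t d) by apply: cvg_nrm; exact: hy_cvg_dom2.
  apply: (cvgr_to_le c).
  by apply: nearW => n; exact: euler_le.
have h2 : nrm (T t x) <= nrm (T t d) + M * nrm (x - d).
  rewrite -{1}(subrK d x) (linD lT) addrC.
  by apply: le_trans (nrmD _ _) _; rewrite lerD2l hM.
have h3 : nrm d <= nrm x + nrm (x - d) by rewrite -{1}(subKr x d) nrmB.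
have : nrm (x - d) * (M + 1) <= e by move: hd; rewrite (ltr_pdivlMr _ _ M1) => /ltW.
by have := nrm_ge0 (x - d); nra.
Qed.

Lemma hy_cvg (t : R) x : 0 <= t -> euler n t x @[n --> \oo] --> T t x.
Proof.
move=> t0; apply/cvg_nrmP => e e0.
have [d Dd hd] := dom2_dense x (divr_gt0 e0 (ltr0n _ 3)).
have /cvg_nrmP/(_ _ (divr_gt0 e0 (ltr0n _ 3))) := hy_cvg_dom2 t0 Dd.
apply: filterS => n hn'.
have e1 : nrm (euler n t x - euler n t d) <= nrm (x - d).
  by rewrite /euler -(linB (iterJ_lin _ (hn_gt0 n))); exact: iterJ_le.
have e2 : nrm (T t d - T t x) <= nrm (x - d).
  by rewrite nrm_sym -(linB (hy_lin t0)); exact: hy_le.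
apply: le_lt_trans (nrm_triangle (euler n t d) _ _) _.
apply: le_lt_trans (lerD (lexx _) (nrm_triangle (T t d) _ _)) _.
by lra.
Qed.

Lemma hy_add (s t : R) x : 0 <= s -> 0 <= t -> T (s + t) x = T s (T t x).
Proof.
move=> s0 t0; have st0 : 0 <= s + t by rewrite addr_ge0.
apply: (@eq_on_dense _ _ _ (dom A) (T (s + t)) (T s \o T t)) => //.
- exact: dom_dense.
- exact: (proj1 (hy_ext st0)).
- by apply: bounded_linear_comp; [exact: (proj1 (hy_ext s0))|exact: (proj1 (hy_ext t0))].
move=> {}x Dx /=.
have c1 : euler n (s + t) x @[n --> \oo] --> T (s + t) x by exact: hy_cvg.
have c2 : euler n (s + t) x @[n --> \oo] --> T s (T t x).
  apply/cvg_nrmP => e e0; have e3 : 0 < e / 3 by rewrite divr_gt0.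
  have /cvg_nrmP/(_ _ e3) h1 : euler n t x @[n --> \oo] --> T t x by exact: hy_cvg.
  have /cvg_nrmP/(_ _ e3) h2 : euler n s (T t x) @[n --> \oo] --> T s (T t x) by exact: hy_cvg.
  have n1 : 0 < nrm (A x) + 1 by rewrite ltr_wpDl ?nrm_ge0.
  have h0 : (2^-1 : R) ^+ n @[n --> \oo] --> 0.
    by apply: cvg_expr; rewrite ger0_norm ?invr_ge0 // invf_lt1 // ltr1n.
  have h3 := @cvgr0_norm_lt _ _ _ _ _ (fun n => (2^-1 : R) ^+ n) h0 _ (divr_gt0 e3 n1).
  have {}h3 := h3 _; near=> n.
  have hp := hn_gt0 n.
  have k1 : nrm (euler n t x - T t x) < e / 3 by near: n.
  have k2 : nrm (euler n s (T t x) - T s (T t x)) < e / 3 by near: n.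
  have k3 : hn n * (nrm (A x) + 1) < e / 3.
    by rewrite -ltr_pdivlMr // -[hn n]ger0_norm ?(ltW hp) //; near: n; exact: h3.
  have k4 : nrm (euler n s (euler n t x) - euler n s (T t x)) <= nrm (euler n t x - T t x).
    by rewrite /euler -(linB (iterJ_lin _ hp)); exact: iterJ_le.
  have k5 : nrm (euler n (s + t) x - euler n s (euler n t x)) <= hn n * nrm (A x).
    rewrite /euler -iterD.
    have /andP[a1 a2] := stepsP n s0; have /andP[a3 a4] := stepsP n t0.
    have /andP[a5 a6] := stepsP n st0.
    set p := steps s n in a1 a2 *; set q := steps t n in a3 a4 *; set r := steps (s + t) n in a5 a6 *.
    (* Rounding [s] and [t] separately loses at most one step against rounding [s + t]. *)
    have pq : (p + q <= r)%N.
      by rewrite -ltnS -(@ltr_nat R) -(ltr_pM2r hp) natrD mulrDl; lra.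
    have qp : (r <= (p + q).+1)%N.
      rewrite -ltnS -(@ltr_nat R) -(ltr_pM2r hp); apply: le_lt_trans a5 _.
      by rewrite -addSn -addnS natrD mulrDl; lra.
    have [->|->] : r = (p + q)%N \/ r = (p + q).+1.
      by move: pq qp; rewrite leq_eqVlt => /orP[/eqP ->|h]; [left|rewrite leq_eqVlt ltnS leqNgt h orbF => /eqP; right].
      by rewrite subrr nrm0; nneg.
    rewrite iterSr -(linB (iterJ_lin _ hp)).
    by apply: le_trans (iterJ_le _ _ hp) _; exact: J_near.
  apply: le_lt_trans (nrm_triangle (euler n s (euler n t x)) _ _) _.
  apply: le_lt_trans (lerD (lexx _) (nrm_triangle (euler n s (T t x)) _ _)) _.
  by rewrite mulrDr mulr1 in k3; lra.
exact: (cvg_unique _ c1 c2).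
Unshelve. all: by end_near. Qed.

Lemma hy_near (t : R) x : 0 <= t -> dom A x -> nrm (T t x - x) <= t * nrm (A x).
Proof.
move=> t0 Dx.
have c : nrm (euler n t x - x) @[n --> \oo] --> nrm (T t x - x).
  by apply: cvg_nrm; apply: cvgB; [exact: hy_cvg|exact: cvg_cst].
apply: (cvgr_to_le c); apply: nearW => n; apply: le_trans (iterJ_near _ _ _) _ => //.
by rewrite ler_wpM2r ?nrm_ge0 //; case/andP: (stepsP n t0).
Qed.

Lemma hy_taylor (t : R) x : 0 <= t -> dom2 x ->
  nrm (T t x - x - t%:C *: A x) <= t ^+ 2 * nrm (A (A x)).
Proof.
move=> t0 D2.
have c : nrm (euler n t x - x - t%:C *: A x) @[n --> \oo] --> nrm (T t x - x - t%:C *: A x).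
  by apply: cvg_nrm; apply: cvgB; [apply: cvgB; [exact: hy_cvg|exact: cvg_cst]|exact: cvg_cst].
have h0 : t ^+ 2 * nrm (A (A x)) + (2^-1 : R) ^+ n * nrm (A x) @[n --> \oo] -->
     t ^+ 2 * nrm (A (A x)) + 0 * nrm (A x).
  apply: cvgD; first exact: cvg_cst; apply: cvgM; last exact: cvg_cst.
  by apply: cvg_expr; rewrite ger0_norm ?invr_ge0 // invf_lt1 // ltr1n.
rewrite mul0r addr0 in h0; apply: ler_cvg_to c h0 _; apply: nearW => n.
have /andP[h1 h2] := stepsP n t0; have hp := hn_gt0 n.
have -> : euler n t x - x - t%:C *: A x = (euler n t x - x - ((steps t n)%:R * hn n)%:C *: A x) -
    (t - (steps t n)%:R * hn n)%:C *: A x.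
  by apply: ri_ext => w; rewrite !riE; ring.
apply: le_trans (nrmB _ _) _; rewrite nrmZR ger0_norm ?subr_ge0 //; apply: lerD.
  apply: le_trans (iterJ_taylor _ hp D2) _; rewrite ler_wpM2r ?nrm_ge0 //.
  by rewrite ler_pXn2r ?nnegrE // mulr_ge0 // ltW.
rewrite ler_wpM2r ?nrm_ge0 // -/(hn n).
by rewrite -natr1 mulrDl mul1r in h2; lra.
Qed.

(** The second-order estimate needs [dom2]. Writing [x = J 1 w] and approximating [w] by some [d] in
    [dom A] gives [J 1 d] in [dom2], close to [x] in the graph norm of [A]. *)
Lemma hy_quotient x : dom A x -> forall e : R, 0 < e -> exists2 r : R, 0 < r &
  forall h, 0 < h < r -> nrm (T h x - x - h%:C *: A x) <= e * h.
Proof.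
move=> Dx e e0; pose w := x - A x.
have xJ : x = J 1 w by rewrite -{1}(J2 ltr01 Dx) scale1r.
have [d Dd hd] := dom_dense w (divr_gt0 e0 (ltr0n _ 8)).
have D2 := J_dom2 ltr01 Dd; set x' := J 1 d in D2.
have [Dx' DAx'] := D2; have [Dxx' Exx'] := domB Dx Dx'.
have hA : nrm (A (x - x')) <= 2 * nrm (w - d).
  have [_ E1] := J1 w ltr01; have [_ E2] := J1 d ltr01.
  rewrite -xJ scale1r in E1; rewrite -/x' scale1r in E2.
  have -> : A (x - x') = J 1 (w - d) - (w - d).
    rewrite (linB (J_lin ltr01)) -xJ -/x' Exx' -E1 -E2.
    by apply: ri_ext => v; rewrite !riE; ring.
  by apply: le_trans (nrmB _ _) _; have := J_le (w - d) ltr01; lra.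
have c0 : 0 < nrm (A (A x')) + 1 by rewrite ltr_wpDl ?nrm_ge0.
exists (e / 2 / (nrm (A (A x')) + 1)); first by rewrite !divr_gt0.
move=> h /andP[h0 hr]; rewrite ltr_pdivlMr // mulrDr mulr1 in hr.
have -> : T h x - x - h%:C *: A x = (T h (x - x') - (x - x')) +
    ((T h x' - x' - h%:C *: A x') - h%:C *: A (x - x')).
  rewrite (linB (hy_lin (ltW h0))) Exx'.
  by apply: ri_ext => v; rewrite !riE; ring.
apply: le_trans (nrmD _ _) _; apply: le_trans (lerD (lexx _) (nrmB _ _)) _.
have k1 := hy_near (ltW h0) Dxx'; have k2 := hy_taylor (ltW h0) D2.
rewrite nrmZR gtr0_norm //.
have k3 : h * nrm (A (x - x')) <= h * (2 * nrm (w - d)) by rewrite ler_wpM2l ?(ltW h0).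
have k4 : h * nrm (w - d) <= h * (e / 8) by rewrite ler_wpM2l ?(ltW h0) // ltW.
have k5 : h ^+ 2 * nrm (A (A x')) <= h * (e / 2).
  by rewrite expr2 -mulrA ler_wpM2l ?(ltW h0) //; lra.
by lra.
Qed.

Theorem hille_yosida : exists S : R -> X -> X, generates A S.
Proof.
exists T; split; first split.
- by move=> t t0; case: (hy_ext t0).
- apply/funext => x; apply: (@eq_on_dense _ _ _ (dom A) (T 0) id) => //.
  + exact: dom_dense.
  + exact: (proj1 (hy_ext (lexx 0))).
  + exact: bounded_linear_id.
  + move=> {}x Dx; apply/eqP; rewrite -subr_eq0; apply/eqP/nrm0_eq0/le_anti.
    by rewrite nrm_ge0 andbT; have := hy_near (lexx 0) Dx; rewrite mul0r.
- by move=> s t s0 t0; apply/funext => x /=; exact: hy_add.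
- move=> x; apply/at_right0_cvgP => e e0.
  have [d Dd hd] := dom_dense x (divr_gt0 e0 (ltr0n _ 3)).
  have c0 : 0 < nrm (A d) + 1 by rewrite ltr_wpDl ?nrm_ge0.
  exists (e / 3 / (nrm (A d) + 1)); first by rewrite !divr_gt0.
  move=> h /andP[h0 hr]; rewrite ltr_pdivlMr // mulrDr mulr1 in hr.
  have -> : T h x - x = T h (x - d) + ((T h d - d) - (x - d)).
    rewrite (linB (hy_lin (ltW h0))).
    by apply: ri_ext => v; rewrite !riE; ring.
  apply: le_lt_trans (nrmD _ _) _; apply: le_lt_trans (lerD (lexx _) (nrmB _ _)) _.
  by have := hy_le (x - d) (ltW h0); have := hy_near (ltW h0) Dd; lra.
move=> x y; split=> [[Dx <-]|/quotientP hq]; first exact/quotientP/hy_quotient.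
(* The generator of [T] cannot be larger than [A]. Solving [z - A z = x - y] in [dom A], the vector
   [v = x - z] would have derivative [v] under [T] at 0, so [|T_h v| > |v|] for small [h] unless
   [v = 0]. *)
have [Dz Ez] := J1 (x - y) ltr01; set z := J 1 (x - y) in Dz Ez; rewrite scale1r in Ez.
suff v0 : x - z = 0.
  have xz : x = z by apply/eqP; rewrite -subr_eq0 v0.
  rewrite -xz in Dz Ez; split=> //.
  by apply/oppr_inj/(@addrI _ x).
apply/nrm0_eq0/eqP; case: eqVneq => // v0; exfalso.
have vp : 0 < nrm (x - z) by rewrite lt_neqAle eq_sym v0 nrm_ge0.
have e4 : (0 : R) < 4^-1 * nrm (x - z) by rewrite mulr_gt0 // invr_gt0.
have [r1 r10 h1] := hq _ e4; have [r2 r20 h2] := hy_quotient Dz e4.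
pose h := Num.min r1 r2 / 2.
have m0 : 0 < Num.min r1 r2 by rewrite lt_min r10.
have h0 : 0 < h by rewrite divr_gt0.
have hm : h < Num.min r1 r2 by rewrite ltr_pdivrMr // ltr_pMr // ltr1n.
have := h1 h; have := h2 h; move: hm; rewrite lt_min h0 => /andP[-> ->] /(_ isT) k2 /(_ isT) k1.
have k3 : nrm (T h (x - z) - (x - z) - h%:C *: (x - z)) <= 2^-1 * nrm (x - z) * h.
  have -> : T h (x - z) - (x - z) - h%:C *: (x - z) = (T h x - x - h%:C *: y) - (T h z - z - h%:C *: A z).
    have -> : y = x - (z - A z) by rewrite Ez subKr.
    rewrite (linB (hy_lin (ltW h0))).
    by apply: ri_ext => v; rewrite !riE; ring.
  by apply: le_trans (nrmB _ _) _; lra.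
have k4 := ri_abs_le (T h (x - z) - (x - z) - h%:C *: (x - z)) (x - z).
have k5 := ri_le (T h (x - z)) (x - z).
have k6 := ler_wpM2r (ltW vp) (hy_le (x - z) (ltW h0)).
have k7 := ler_wpM2r (ltW vp) k3.
move: k4; rewrite 2!riBl riZl ri_self ler_norml => /andP[k4 _].
have : 0 < h * nrm (x - z) ^+ 2 by rewrite mulr_gt0 // exprn_gt0.
by move: k4; rewrite expr2; lra.
Qed.

End HilleYosida.

(** * System nodes *)

Section ResolventIdentity.
Context {R : realType} {X : hilbertType R} {A : unbounded X}.

Lemma resolvent_bl s : rho A s -> bounded_linear (resolvent A s).
Proof. by move=> /resolventP[]. Qed.

Lemma resolvent_lin s : rho A s -> linear (resolvent A s).
Proof. by move=> /resolvent_bl[]. Qed.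

Lemma resolvent_dom s x : rho A s -> dom A (resolvent A s x).
Proof. by move=> /resolventP[_ /(_ x)[]]. Qed.

Lemma resolventK s x : rho A s -> s *: resolvent A s x - A (resolvent A s x) = x.
Proof. by move=> /resolventP[_ /(_ x)[]]. Qed.

Lemma Kresolvent s x : rho A s -> dom A x -> resolvent A s (s *: x - A x) = x.
Proof. by move=> /resolventP[_ _ h] /h. Qed.

Lemma resolvent_id s b x : rho A s -> rho A b ->
  resolvent A s x = resolvent A b x + (b - s) *: resolvent A s (resolvent A b x).
Proof.
move=> rs rb; have ls := resolvent_lin rs.
have := Kresolvent rs (resolvent_dom x rb); have := resolventK x rb.
set y := resolvent A b x; move=> Ey Es.
rewrite -{1}Es -(linZ ls) -(linD ls); congr (resolvent A s _).
rewrite -Ey; apply: inner_ext => w.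
by rewrite !(linearDl, linearBl, linearNl, linearZl_LR) /=; ring.
Qed.

End ResolventIdentity.

(** * Extrapolated operators and the graph of a system node *)

Section Node.
Context {R : realType} {U X Y : hilbertType R} (S : sysnode U X Y).

Local Notation A := (opA S).
Local Notation W := (Xm1 S).
Local Notation al := (alpha S).

Lemma emb_lin : linear (emb W). Proof. exact: emb_linear. Qed.

Lemma emb_nrm x : nrm (emb W x) = nrm (resolvent A al x).
Proof. by rewrite /nrm emb_norm. Qed.

Lemma resolvent_inj s x : rho A s -> resolvent A s x = 0 -> x = 0.
Proof.
move=> rs h; have := resolventK x rs; rewrite h.
have D0 : A 0 = 0.
  have [D1 D2] := dom_closed (opA_generates S).
  have := gen_linear (opA_generates S) (-1) D1 D1.
  by rewrite scaler0 addr0 scaleN1r addNr.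
by rewrite D0 scaler0 subrr.
Qed.

Lemma emb_inj x x' : emb W x = emb W x' -> x = x'.
Proof.
move=> h; apply/eqP; rewrite -subr_eq0; apply/eqP/(resolvent_inj (alpha_rho S)).
by apply: nrm0_eq0; rewrite -emb_nrm (linB emb_lin) h subrr nrm0.
Qed.

Lemma emb_range_dense (w : W) (e : R) : 0 < e -> exists2 w', range (emb W) w' & nrm (w - w') < e.
Proof. by apply: dense_eps; exact: emb_dense. Qed.

(** The resolvent identity bounds [(s - A)^-1 x] by a multiple of [(alpha - A)^-1 x], whose norm is
    that of [emb x]. *)
Lemma ext_resolventP s : rho A s ->
  bounded_linear (ext_resolvent W s) /\ forall x, ext_resolvent W s (emb W x) = resolvent A s x.
Proof.
move=> rs; have [ls [M M0 hM]] := proj1 (bounded_linearP _) (resolvent_bl rs).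
pose K := 1 + modc (al - s) * M.
have [||||||h1 h2] := @extensionP _ _ _ _ setT (emb W) (resolvent A s) K.
- by [].
- by move=> a x y _ _; exact: emb_lin.
- by move=> a x y _ _; exact: ls.
- by rewrite addr_ge0 // mulr_ge0 // modc_ge0.
- move=> x _; rewrite emb_nrm (resolvent_id x rs (alpha_rho S)).
  apply: le_trans (nrmD _ _) _; rewrite mulrDl mul1r lerD2l nrmZ -mulrA.
  by rewrite ler_wpM2l ?modc_ge0.
- by move=> w d d0; have [_ [x _ <-] h] := emb_range_dense w d0; exists x.
by split=> // x; exact: h2.
Qed.

Lemma ext_resolvent_bl s : rho A s -> bounded_linear (ext_resolvent W s).
Proof. by move=> /ext_resolventP[]. Qed.

Lemma ext_resolvent_emb s x : rho A s -> ext_resolvent W s (emb W x) = resolvent A s x.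
Proof. by move=> /ext_resolventP[]. Qed.

Lemma dom_dense_node (w : X) (e : R) : 0 < e -> exists2 x, dom A x & nrm (w - x) < e.
Proof. by apply: (sg_dom_dense (opA_generates S)); exists al; exact: alpha_rho. Qed.

Lemma emb_bl : bounded_linear (emb W).
Proof.
apply/bounded_linearP; split; first exact: emb_lin.
have [_ [M M0 hM]] := proj1 (bounded_linearP _) (resolvent_bl (alpha_rho S)).
by exists M => // x; rewrite emb_nrm.
Qed.

Lemma ext_opP : bounded_linear (ext_op W) /\ forall x, dom A x -> ext_op W x = emb W (A x).
Proof.
have ra := alpha_rho S; have la := resolvent_lin ra.
have [_ [M M0 hM]] := proj1 (bounded_linearP _) (resolvent_bl ra).
have [D0 DS] := dom_closed (opA_generates S).
apply: (@extensionP _ _ _ _ (dom A) id (emb W \o A) (modc al * M + 1)) => //.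
- by move=> a x y Dx Dy /=; rewrite (gen_linear (opA_generates S)) // emb_lin.
- by rewrite addr_ge0 // mulr_ge0 // modc_ge0.
- move=> x Dx /=; rewrite emb_nrm.
  (* This form involves no [A], so the norm of [A x] in the completion is controlled by that of [x]
     in [X]. *)
  have -> : resolvent A al (A x) = al *: resolvent A al x - x.
    by rewrite -{3}(Kresolvent ra Dx) (linB la) (linZ la) subKr.
  apply: le_trans (nrmB _ _) _; rewrite mulrDl mul1r lerD2r nrmZ -mulrA.
  by rewrite ler_wpM2l ?modc_ge0.
- exact: dom_dense_node.
Qed.

Lemma ext_op_resolvent s w : rho A s ->
  s *: emb W (ext_resolvent W s w) - ext_op W (ext_resolvent W s w) = w.
Proof.
move=> rs; have bE := ext_resolvent_bl rs.
apply: (@eq_on_dense _ _ _ (range (emb W)) (fun w => s *: emb W (ext_resolvent W s w) - ext_op W (ext_resolvent W s w)) id).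
- exact: emb_range_dense.
- apply: bounded_linearB; last exact: (bounded_linear_comp (proj1 ext_opP) bE).
  exact: (bounded_linearZ s (bounded_linear_comp emb_bl bE)).
- exact: bounded_linear_id.
move=> _ [x _ <-]; rewrite ext_resolvent_emb // (proj2 ext_opP); last exact: resolvent_dom.
by rewrite -(linZ emb_lin) -(linB emb_lin) resolventK.
Qed.

Lemma ext_resolvent_op s x : rho A s ->
  ext_resolvent W s (s *: emb W x - ext_op W x) = x.
Proof.
move=> rs; have bE := ext_resolvent_bl rs.
apply: (@eq_on_dense _ _ _ (dom A) (fun x => ext_resolvent W s (s *: emb W x - ext_op W x)) id).
- exact: dom_dense_node.
- apply: (bounded_linear_comp bE).
  by apply: bounded_linearB; [exact/bounded_linearZ/emb_bl|case: ext_opP].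
- exact: bounded_linear_id.
move=> {}x Dx; rewrite (proj2 ext_opP) // -(linZ emb_lin) -(linB emb_lin).
by rewrite ext_resolvent_emb // Kresolvent.
Qed.

Lemma ext_resolvent_id s b w : rho A s -> rho A b ->
  ext_resolvent W s w = ext_resolvent W b w + (b - s) *: resolvent A s (ext_resolvent W b w).
Proof.
move=> rs rb.
apply: (@eq_on_dense _ _ _ (range (emb W)) (ext_resolvent W s)
  (fun w => ext_resolvent W b w + (b - s) *: resolvent A s (ext_resolvent W b w))).
- exact: emb_range_dense.
- exact: ext_resolvent_bl.
- apply: bounded_linearD; first exact: ext_resolvent_bl.
  apply: bounded_linearZ; apply: (bounded_linear_comp (resolvent_bl rs)).
  exact: ext_resolvent_bl.
by move=> _ [x _ <-]; rewrite !ext_resolvent_emb // -resolvent_id.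
Qed.

Definition input_map (s : R[i]) (u : U) : X := ext_resolvent W s (opB S u).
Local Notation H := input_map.

Lemma input_map_bl s : rho A s -> bounded_linear (H s).
Proof. by move=> rs; exact: (bounded_linear_comp (ext_resolvent_bl rs) (opB_bounded S)). Qed.

(** By the resolvent identity the difference is in the range of the resolvent on [X]; this is what
    makes [C] applicable to it. *)
Lemma input_map_diff s b u : rho A s -> rho A b -> dom A (H s u - H b u).
Proof.
move=> rs rb; rewrite /H (ext_resolvent_id _ rs rb) addrAC subrr add0r.
have [D0 DS] := dom_closed (opA_generates S).
by rewrite -[_ *: _]addr0; apply: (DS) => //; exact: resolvent_dom.
Qed.

Lemma opC_add x y : dom A x -> dom A y -> opC S (x + y) = opC S x + opC S y.
Proof. by move=> Dx Dy; have := @opC_linear _ _ _ _ S 1 x y Dx Dy; rewrite !scale1r. Qed.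

Lemma opC_resolvent_bl s : rho A s -> bounded_linear (fun f => opC S (resolvent A s f)).
Proof.
move=> rs; apply/bounded_linearP; split.
  move=> a x y; rewrite (resolvent_lin rs) opC_linear //; exact: resolvent_dom.
have [M hM] := opC_bounded S.
have [_ [N N0 hN]] := proj1 (bounded_linearP _) (resolvent_bl rs).
exists (`|M| * (1 + modc (al - s) * N)); first by rewrite mulr_ge0 ?addr_ge0 // mulr_ge0 ?modc_ge0.
move=> f; apply: le_trans (hM _ (resolvent_dom f rs)) _.
have -> : al *: resolvent A s f - A (resolvent A s f) = f + (al - s) *: resolvent A s f.
  rewrite -[in RHS](resolventK f rs); set y := resolvent A s (_ - _).
  rewrite [in RHS]/y (Kresolvent rs (resolvent_dom f rs)).
  by apply: inner_ext => w; rewrite !(linearDl, linearBl, linearNl, linearZl_LR) /=; ring.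
apply: le_trans (ler_wpM2r (nrm_ge0 _) (ler_norm M)) _.
rewrite -mulrA ler_wpM2l //; apply: le_trans (nrmD _ _) _.
by rewrite mulrDl mul1r lerD2l nrmZ -mulrA ler_wpM2l ?modc_ge0.
Qed.

(** The output is required to agree for every [b], exactly as in [output_function]; [nodeP] shows
    that one point of the resolvent set is enough. *)
Definition node (x : X) (u : U) (z : X) (y : Y) : Prop :=
  emb W z = ext_op W x + opB S u /\
  forall b, rho A b -> y = opC S (x - H b u) + transfer S b u.

(** A description inside [X]: with [f = s x - z], the state equation is [(s - A) x = f + B u]. From
    here on the completion is hardly mentioned. *)
Lemma nodeP s x u z y : rho A s -> node x u z y <->
  x = resolvent A s (s *: x - z) + H s u /\
  y = opC S (resolvent A s (s *: x - z)) + transfer S s u.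
Proof.
move=> rs; have lE := proj1 (ext_resolvent_bl rs).
set f := s *: x - z.
have key : emb W z = ext_op W x + opB S u <-> x = resolvent A s f + H s u.
  have -> : resolvent A s f + H s u = ext_resolvent W s (emb W f + opB S u).
    by rewrite (linD lE) ext_resolvent_emb.
  have ef : emb W f = s *: emb W x - emb W z by rewrite /f (linB emb_lin) (linZ emb_lin).
  split=> h.
    rewrite -{1}(ext_resolvent_op x rs); congr (ext_resolvent W s _).
    by rewrite ef h opprD addrA subrK.
  have := ext_op_resolvent (emb W f + opB S u) rs; rewrite -h ef.
  rewrite -addrA => /addrI h2; have {}h2 : ext_op W x = emb W z - opB S u.
    by rewrite -[LHS]opprK h2 opprD opprK.
  by rewrite h2 subrK.
split=> [[/key hx hy]|[hx hy]].
  by split=> //; rewrite (hy s rs) {1}hx addrK.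
split=> [|b rb]; first exact/key.
rewrite hy; have -> : x - H b u = resolvent A s f + (H s u - H b u) by rewrite {1}hx addrA.
rewrite opC_add; [|exact: resolvent_dom|exact: input_map_diff].
by rewrite -addrA; congr (_ + _); rewrite -(transfer_diff rs rb) subrK.
Qed.

Lemma node_mk s f u : rho A s ->
  node (resolvent A s f + H s u) u (s *: (resolvent A s f + H s u) - f)
       (opC S (resolvent A s f) + transfer S s u).
Proof. by move=> rs; apply/(nodeP _ _ _ _ rs); rewrite subKr. Qed.

Lemma node_lin a x u z y x' u' z' y' : node x u z y -> node x' u' z' y' ->
  node (a *: x + x') (a *: u + u') (a *: z + z') (a *: y + y').
Proof.
have rs := alpha_rho S; have lR := resolvent_lin rs.
move=> /(nodeP _ _ _ _ rs)[hx hy] /(nodeP _ _ _ _ rs)[hx' hy'].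
have e : al *: (a *: x + x') - (a *: z + z') = a *: (al *: x - z) + (al *: x' - z').
  by apply: inner_ext => w; rewrite !(linearDl, linearBl, linearNl, linearZl_LR) /=; ring.
apply/(nodeP _ _ _ _ rs); rewrite e lR; split.
  by rewrite (proj1 (input_map_bl rs)) {1}hx {1}hx' scalerDr addrACA.
rewrite opC_linear ?(proj1 (transfer_bounded rs)); [|exact: resolvent_dom|exact: resolvent_dom].
by rewrite {1}hy {1}hy' scalerDr addrACA.
Qed.

Lemma nodeB x u z y x' u' z' y' : node x u z y -> node x' u' z' y' ->
  node (x - x') (u - u') (z - z') (y - y').
Proof.
move=> h h'; have := node_lin (-1) h' h.
by rewrite !scaleN1r ![- _ + _]addrC.
Qed.

Lemma node_uniq x u z y z' y' : node x u z y -> node x u z' y' -> z = z' /\ y = y'.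
Proof.
move=> [h1 h2] [h1' h2']; split; first by apply: emb_inj; rewrite h1.
by rewrite (h2 _ (alpha_rho S)) (h2' _ (alpha_rho S)).
Qed.

Lemma node_dom x : dom A x -> node x 0 (A x) (opC S x).
Proof.
have rs := alpha_rho S; move=> Dx; apply/(nodeP _ _ _ _ rs).
rewrite (Kresolvent rs Dx) (lin0 (proj1 (input_map_bl rs))).
by rewrite (lin0 (proj1 (transfer_bounded rs))) !addr0.
Qed.

Lemma node_input s u : rho A s -> node (H s u) u (s *: H s u) (transfer S s u).
Proof.
move=> rs; apply/(nodeP _ _ _ _ rs).
have := lin0 (proj1 (opC_resolvent_bl rs)); rewrite subrr => ->.
by rewrite (lin0 (resolvent_lin rs)) !add0r.
Qed.

Lemma classical_node z0 u z y : classical_trajectory S z0 u z y ->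
  [/\ z 0 = z0, is_C2 u & exists2 z', is_C1 z z' &
    forall t : R, 0 <= t -> node (z t) (u t) (z' t) (y t)].
Proof.
move=> [[C2 _] [z00 [z' C1 hz]] hy]; split=> //; exists z' => // t t0.
by split=> [|b rb]; [exact: hz|exact: hy].
Qed.

Lemma node_classical u z z' y : is_C2 u -> is_C1 z z' ->
  (forall t : R, 0 <= t -> node (z t) (u t) (z' t) (y t)) ->
  classical_trajectory S (z 0) u z y.
Proof.
move=> C2 C1 h; split.
- by split=> //; exists (z' 0); case: (h 0 (lexx 0)).
- by split=> //; exists z' => // t t0; case: (h t t0).
- by move=> b t rb t0; case: (h t t0) => _; apply.
Qed.

End Node.

(** * Continuous and differentiable functions on the half-line *)

Section WithinContinuity.
Context {R : realType}.
Implicit Types (V W : completeNormedModType R[i]) (H : hilbertType R).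

Lemma wcP (V : topologicalType) (f : R -> V) : {within half_line, continuous f} <->
  forall t : R, 0 <= t -> f s @[s --> within half_line (nbhs t)] --> f t.
Proof.
split=> [/subspace_continuousP h t t0|h]; first by apply: h; rewrite half_lineE.
by apply/subspace_continuousP => t; rewrite half_lineE; exact: h.
Qed.

Lemma wc_ri H (f g : R -> H) : {within half_line, continuous f} ->
  {within half_line, continuous g} ->
  {within half_line, continuous (fun t => re_inner (f t) (g t))}.
Proof. by move=> /wcP hf /wcP hg; apply/wcP => t t0; apply: cvg_ri; [exact: hf|exact: hg]. Qed.

Lemma wcD V (f g : R -> V) : {within half_line, continuous f} ->
  {within half_line, continuous g} -> {within half_line, continuous (fun t => f t + g t)}.
Proof. by move=> /wcP hf /wcP hg; apply/wcP => t t0; apply: cvgD; [exact: hf|exact: hg]. Qed.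

Lemma wc_lin V W (L : V -> W) (f : R -> V) : bounded_linear L ->
  {within half_line, continuous f} -> {within half_line, continuous (L \o f)}.
Proof.
move=> [_ cL] /wcP hf; apply/wcP => t t0.
exact: (cvg_comp _ _ (hf t t0) (cL (f t))).
Qed.

Lemma wcZ V (a : R[i]) (f : R -> V) : {within half_line, continuous f} ->
  {within half_line, continuous (fun t => a *: f t)}.
Proof. by move=> h; apply: (wc_lin (bounded_linearZ a (bounded_linear_id V)) h). Qed.

Lemma wcB V (f g : R -> V) : {within half_line, continuous f} ->
  {within half_line, continuous g} -> {within half_line, continuous (fun t => f t - g t)}.
Proof.
move=> hf hg; have -> : (fun t => f t - g t) = (fun t => f t + -1 *: g t).
  by apply/funext => t; rewrite scaleN1r.
exact/wcD/wcZ.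
Qed.

Lemma wc_cst (V : topologicalType) (c : V) : {within half_line, continuous (fun _ : R => c : V)}.
Proof. by apply/wcP => t t0; exact: cvg_cst. Qed.

Lemma wc_nrm V (f : R -> V) : {within half_line, continuous f} ->
  {within half_line, continuous (fun t => nrm (f t))}.
Proof. by move=> /wcP hf; apply/wcP => t t0; apply: cvg_nrm; exact: hf. Qed.

Lemma has_deriv_wc V (f f' : R -> V) : (forall t : R, 0 <= t -> has_deriv f t (f' t)) ->
  {within half_line, continuous f}.
Proof. by move=> h; apply/within_contP => t t0; exact: has_deriv_near (h t t0). Qed.

Lemma C1_wc V (f f' : R -> V) : is_C1 f f' -> {within half_line, continuous f}.
Proof. by case=> h _; exact: has_deriv_wc h. Qed.

Lemma C1D V (f f' g g' : R -> V) : is_C1 f f' -> is_C1 g g' ->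
  is_C1 (fun t => f t + g t) (fun t => f' t + g' t).
Proof.
move=> [h c] [h' c']; split; last exact: wcD.
by move=> t t0; apply: has_derivD; [exact: h|exact: h'].
Qed.

Lemma C2D V (f g : R -> V) : is_C2 f -> is_C2 g -> is_C2 (fun t => f t + g t).
Proof.
move=> [f' [f'' [h1 h2]]] [g' [g'' [h1' h2']]].
by exists (fun t => f' t + g' t), (fun t => f'' t + g'' t); split; apply: C1D.
Qed.

Definition vexp V (r : R) (c : V) (t : R) : V := (expR (r * t))%:C *: c.

Lemma C1_vexp V r (c : V) : is_C1 (vexp r c) (vexp r (r%:C *: c)).
Proof.
have h b t : has_deriv (vexp r b) t (vexp r (r%:C *: b) t).
  rewrite /vexp scalerA -rmorphM mulrC; exact: has_deriv_exp.
by split=> [t _|]; [exact: h|apply: has_deriv_wc => t _; exact: h].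
Qed.

Lemma C2_vexp V r (c : V) : is_C2 (vexp r c).
Proof. by exists (vexp r (r%:C *: c)), (vexp r (r%:C *: (r%:C *: c))); split; exact: C1_vexp. Qed.

Lemma C1_cst V (c : V) : is_C1 (fun=> c) (fun=> 0).
Proof. by split=> [t _|]; [exact: has_deriv_cst|exact: wc_cst]. Qed.

Lemma C2_cst V (c : V) : is_C2 (fun=> c).
Proof. by exists (fun=> 0), (fun=> 0); split; exact: C1_cst. Qed.

Lemma wc_integrable (f : R -> R) (b : R) : {within half_line, continuous f} ->
  (@lebesgue_measure R).-integrable `[0, b] (EFin \o f).
Proof.
move=> h; apply: continuous_compact_integrable; first exact: segment_compact.
by apply: continuous_subspaceW h => t /=; rewrite in_itv half_lineE /= => /andP[].
Qed.

Lemma Rintegral_itv_cst (b c : R) : 0 <= b ->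
  \int[lebesgue_measure]_(t in `[0, b]) c = b * c.
Proof.
move=> b0; rewrite Rintegral_cst //= lebesgue_measure_itv /= lte_fin.
have [h|h] := ltP 0 b; first by rewrite oppr0 adde0 mulrC.
have -> : b = 0 by apply/le_anti; rewrite b0 h.
by rewrite /= mulr0 mul0r.
Qed.

Lemma Rintegral_le_cst (f : R -> R) (b c : R) : 0 <= b ->
  {within half_line, continuous f} -> (forall t, 0 <= t <= b -> f t <= c) ->
  \int[lebesgue_measure]_(t in `[0, b]) f t <= b * c.
Proof.
move=> b0 hf h; rewrite -Rintegral_itv_cst //; apply: le_Rintegral.
- exact: measurable_itv.
- exact: wc_integrable.
- by apply: wc_integrable; apply/wcP => t t0; exact: cvg_cst.
- by move=> t /=; rewrite in_itv /=; exact: h.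
Qed.

End WithinContinuity.

Section NodeTrajectories.
Context {R : realType} {U X Y : hilbertType R} (S : sysnode U X Y).
Local Notation A := (opA S).
Local Notation T := (semigroup S).

Let gen := opA_generates S.

Lemma C1_semigroup x : dom A x -> is_C1 (T^~ x) (fun t => T t (A x)).
Proof.
move=> Dx; split=> [t t0|]; first exact: (sg_deriv gen).
by apply/within_contP => t t0; exact: (sg_cont gen).
Qed.

(** By [nodeP], [y] is a bounded linear function of [x], [z] and [u], although [C] alone is not
    bounded on [X]. *)
Lemma node_wc z u z' y : {within half_line, continuous z} ->
  {within half_line, continuous u} -> {within half_line, continuous z'} ->
  (forall t : R, 0 <= t -> node S (z t) (u t) (z' t) (y t)) ->
  {within half_line, continuous y}.
Proof.
move=> hz hu hz' h; have rs := alpha_rho S.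
have c : {within half_line, continuous (fun t => opC S (resolvent A (alpha S) (alpha S *: z t - z' t))
    + transfer S (alpha S) (u t))}.
  apply: wcD; last exact: (wc_lin (transfer_bounded rs)).
  have hf := wcB (wcZ (a := alpha S) hz) hz'.
  by have := wc_lin (opC_resolvent_bl rs) hf.
apply/within_contP => t t0 e e0.
have /within_contP/(_ t t0 e e0) := c; apply: filterS => s hs s0.
have /(nodeP _ _ _ _ rs)[_ ->] := h s s0; have /(nodeP _ _ _ _ rs)[_ ->] := h t t0.
exact: hs.
Qed.

(** Superposition of the forced motion [e^(r t) H_r u] and a free motion; [H_r u] is the initial
    state from which an exponential input produces a purely exponential state. *)
Lemma exp_trajectory (r : R) u x : rho A r%:C -> dom A x ->
  classical_trajectory S (input_map S r%:C u + x) (vexp r u)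
    (fun t => vexp r (input_map S r%:C u) t + T t x)
    (fun t => vexp r (transfer S r%:C u) t + opC S (T t x)) /\
  is_C1 (fun t => vexp r (input_map S r%:C u) t + T t x)
    (fun t => vexp r (r%:C *: input_map S r%:C u) t + T t (A x)) /\
  forall t : R, 0 <= t -> node S (vexp r (input_map S r%:C u) t + T t x) (vexp r u t)
    (vexp r (r%:C *: input_map S r%:C u) t + T t (A x))
    (vexp r (transfer S r%:C u) t + opC S (T t x)).
Proof.
move=> rr Dx.
have hn t : 0 <= t -> node S (vexp r (input_map S r%:C u) t + T t x) (vexp r u t)
    (vexp r (r%:C *: input_map S r%:C u) t + T t (A x))
    (vexp r (transfer S r%:C u) t + opC S (T t x)).
  move=> t0; have [D <-] := sg_dom gen t0 Dx.
  have := node_lin (expR (r * t))%:C (node_input u rr) (node_dom D).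
  by rewrite addr0.
have hC : is_C1 (fun t => vexp r (input_map S r%:C u) t + T t x)
    (fun t => vexp r (r%:C *: input_map S r%:C u) t + T t (A x)).
  by apply: C1D; [exact: C1_vexp|exact: C1_semigroup].
split=> //; have := node_classical (C2_vexp r u) hC hn.
by rewrite /vexp mulr0 expR0 scale1r (sg0 gen).
Qed.

End NodeTrajectories.

(** * The dissipation inequality at a single instant *)

Section Passivity.
Context {R : realType} {U X : hilbertType R} (S : sysnode U X U) (E : U -> U).
Hypothesis bE : bounded_linear E.
Hypothesis hS : forall z0 u z y (tau : R), classical_trajectory S z0 u z y -> 0 <= tau ->
  nrm (z tau) ^+ 2 - nrm z0 ^+ 2 <=
    2 * (\int[lebesgue_measure]_(t in `[0, tau]) re_inner (u t) (y t))
    + 2 * (\int[lebesgue_measure]_(t in `[0, tau]) re_inner (E (u t)) (u t)).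

Lemma wc_near0 (p : R -> R) (e : R) : {within half_line, continuous p} -> 0 < e ->
  exists2 d : R, 0 < d & forall t, 0 <= t < d -> p t <= p 0 + e.
Proof.
move=> /wcP/(_ 0 (lexx _)) hp e0.
move/cvgrPdist_lt : hp => /(_ e e0); rewrite near_withinE => /nearP[d d0 hd].
exists d => // t /andP[t0 td]; have := hd t; rewrite subr0 ger0_norm // half_lineE => /(_ td t0).
by rewrite ltr_norml => /andP[h _]; lra.
Qed.

(* The dissipation inequality at time 0 along exp (r t) H_r u + T_t (x - H_r u) *)
Lemma node_passive x u z y : node S x u z y ->
  re_inner x z <= re_inner u y + re_inner (E u) u.
Proof.
have gen := opA_generates S.
have [r0 hr0] := rho_eventually gen (ex_intro _ _ (alpha_rho S)).
have rr := hr0 r0 (lexx _); set r := r0 in rr => hn.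
have [hx _] := proj1 (nodeP _ _ _ _ rr) hn.
have Dx : dom (opA S) (x - input_map S r%:C u).
  by rewrite {1}hx addrK; exact: resolvent_dom.
have [] := exp_trajectory u rr Dx; rewrite addrC subrK.
set z_ := fun t : R => _ + _; set y_ := fun t : R => _ + _; set z'_ := fun t : R => _ + _.
move=> ct [C1z hnode].
have z_0 : z_ 0 = x by rewrite /z_ /vexp mulr0 expR0 scale1r (sg0 gen) addrC subrK.
have u_0 : vexp r u 0 = u by rewrite /vexp mulr0 expR0 scale1r.
have [z'_0 y_0] : z = z'_ 0 /\ y = y_ 0.
  by have := hnode 0 (lexx 0); rewrite -/(z_ 0) z_0 u_0 => /(node_uniq hn).
have cu : {within half_line, continuous (vexp r u)} by exact: (C1_wc (C1_vexp r u)).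
have cz := C1_wc C1z; have [dz cz'] := C1z.
have cy : {within half_line, continuous y_} := node_wc cz cu cz' hnode.
have c1 := wc_ri cu cy; have c2 := wc_ri (wc_lin bE cu) cu.
(* The errors are [t e] from the derivative and [2 t e / 4] from each integral, in total [2 t e]. *)
apply/ler_addgt0Pr => e e0; have e4 : 0 < e / 4 by rewrite divr_gt0.
have [d1 d10 h1] := wc_near0 c1 e4; have [d2 d20 h2] := wc_near0 c2 e4.
have /nearP[d3 d30 h3] := has_deriv_sq (dz 0 (lexx 0)) e0.
pose t := Num.min d1 (Num.min d2 d3) / 2.
have m0 : 0 < Num.min d1 (Num.min d2 d3) by rewrite !lt_min d10 d20.
have t0 : 0 < t by rewrite divr_gt0.
have tm : t < Num.min d1 (Num.min d2 d3) by rewrite ltr_pdivrMr // ltr_pMr // ltr1n.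
move: tm; rewrite !lt_min => /andP[t1 /andP[t2 t3]].
have := h3 t; rewrite subr0 gtr0_norm // => /(_ t3 (ltW t0)).
rewrite -/(z_ t) z_0 -z'_0 ler_norml => /andP[k1 _].
have k2 := hS ct (ltW t0).
have k3 := @Rintegral_le_cst R _ t (re_inner u y + e / 4) (ltW t0) c1 _.
have k4 := @Rintegral_le_cst R _ t (re_inner (E u) u + e / 4) (ltW t0) c2 _.
have {}k3 : \int[lebesgue_measure]_(t in `[0, t]) re_inner (vexp r u t) (y_ t) <= t * (re_inner u y + e / 4).
  apply: k3 => s /andP[s0 st]; have := h1 s; rewrite s0 (le_lt_trans st t1) u_0 -y_0.
  by apply.
have {}k4 : \int[lebesgue_measure]_(t in `[0, t]) re_inner (E (vexp r u t)) (vexp r u t) <= t * (re_inner (E u) u + e / 4).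
  apply: k4 => s /andP[s0 st]; have := h2 s; rewrite s0 (le_lt_trans st t2) /= u_0.
  by apply.
have k5 : t * (2 * re_inner x z) <= t * (2 * (re_inner u y + re_inner (E u) u + e)).
  move: k1 k2; rewrite -/(z_ t); move: (nrm (z_ t)) => zt k1 k2; lra.
by rewrite ler_pM2l // ler_pM2l in k5.
Qed.

End Passivity.

(** * The closed loop *)

Section ClosedLoop.
Context {R : realType} {U X : hilbertType R} (S : sysnode U X U) (m k : R).
Hypothesis pas : forall x u z y, node S x u z y ->
  re_inner x z <= re_inner u y + m * nrm u ^+ 2.
Hypothesis k0 : 0 < k.
Hypothesis km : k * m < 1.

Let K (y : U) : U := - (k%:C *: y).
Local Notation A := (opA S).
Local Notation G := (transfer S).
Local Notation H := (input_map S).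
Let C f s := opC S (resolvent A s f).

Lemma fbK_bl : bounded_linear K.
Proof.
have -> : K = (fun y => (- k%:C) *: y) by apply/funext => y; rewrite scaleNr.
exact/bounded_linearZ/bounded_linear_id.
Qed.

Let lK : linear K := proj1 fbK_bl.

Definition fb_node x v z y := node S x (v + K y) z y.

Lemma fb_node_lin a x v z y x' v' z' y' : fb_node x v z y -> fb_node x' v' z' y' ->
  fb_node (a *: x + x') (a *: v + v') (a *: z + z') (a *: y + y').
Proof.
move=> h h'; rewrite /fb_node lK addrACA -scalerDr.
exact: node_lin.
Qed.

Lemma fb_nodeB x v z y x' v' z' y' : fb_node x v z y -> fb_node x' v' z' y' ->
  fb_node (x - x') (v - v') (z - z') (y - y').
Proof.
move=> h h'; have := fb_node_lin (-1) h' h.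
by rewrite !scaleN1r ![- _ + _]addrC.
Qed.

(** With [u = v + K y] one has [k y = v - u], so [k <u, y> = <u, v> - |u|^2]: the feedback produces
    a term [- |u|^2] that absorbs [k m |u|^2]. *)
Lemma fb_energy x v z y : fb_node x v z y ->
  k * re_inner x z <= re_inner (v + K y) v - (1 - k * m) * nrm (v + K y) ^+ 2.
Proof.
move=> h; have := ler_wpM2l (ltW k0) (pas h); set u := v + K y.
have -> : k * (re_inner u y + m * nrm u ^+ 2) = re_inner u (k%:C *: y) + k * m * nrm u ^+ 2.
  by rewrite riZr; ring.
have -> : k%:C *: y = v - u by rewrite /u /K opprD addNKr opprK.
by rewrite riBr ri_self; lra.
Qed.

Lemma fb_dissipative x z y : fb_node x 0 z y -> re_inner x z <= 0.
Proof.
move=> /fb_energy; rewrite ri0r sub0r => h.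
rewrite -(pmulr_rle0 _ k0); apply: le_trans h _.
by rewrite oppr_le0 mulr_ge0 ?sqr_ge0 // subr_ge0 ltW.
Qed.

(** Zero state and zero input force [u = 0] by the energy inequality, hence [y = 0] and then
    [z = 0]. So the closed-loop graph is the graph of a function. *)
Lemma fb_zero z y : fb_node 0 0 z y -> z = 0 /\ y = 0.
Proof.
move=> h; have := fb_energy h; rewrite ri0l ri0r mulr0 sub0r oppr_ge0 pmulr_rle0 ?subr_gt0 // => h1.
have u0 : 0 + K y = 0.
  by apply/nrm0_eq0/eqP; rewrite -sqrf_eq0 eq_le h1 sqr_ge0.
have y0 : y = 0.
  rewrite add0r /K in u0; have := congr1 (fun v => (- k^-1)%:C *: v) u0.
  rewrite scaler0 scalerN scalerA -rmorphM /= mulNr mulVf ?gt_eqF //.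
  by rewrite rmorphN scaleNr scale1r opprK.
split=> //; rewrite /fb_node u0 y0 in h.
have h0 := nodeB h h; rewrite !subrr in h0.
by have [] := node_uniq h h0.
Qed.

Lemma fb_uniq x v z y z' y' : fb_node x v z y -> fb_node x v z' y' -> z = z' /\ y = y'.
Proof.
move=> h h'; have := fb_nodeB h h'; rewrite !subrr => /fb_zero[hz hy].
by split; apply/eqP; rewrite -subr_eq0 ?hz ?hy.
Qed.

Lemma opA_dissipative x : dom A x -> re_inner x (A x) <= 0.
Proof.
move=> Dx; have := pas (node_dom Dx).
by rewrite ri0l nrm0 expr0n mulr0 addr0.
Qed.

Lemma rho_right s : 0 < complex.Re s -> rho A s.
Proof.
apply: (dissipative_rho (opA_generates S)); first by exists (alpha S); exact: alpha_rho.
exact: opA_dissipative.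
Qed.

(** For [x = H_s u] and [z = s x] the passivity inequality reads
    [Re s |x|^2 <= <u, G(s) u> + m |u|^2]. Hence [<G(s) u, u> >= - m |u|^2], and [I + k G(s)] is
    coercive with constant [1 - k m]. *)
Lemma fb_inverse s : 0 < complex.Re s -> exists P, is_inverse (fun u => u - K (G s u)) P.
Proof.
move=> s0; have rs := rho_right s0; apply: (@coercive_inverse _ _ _ (1 - k * m)).
- apply: bounded_linearB; first exact: bounded_linear_id.
  exact: (bounded_linear_comp fbK_bl (transfer_bounded rs)).
- by rewrite subr_gt0.
move=> u; have := pas (node_input u rs); rewrite riC riZ_self (riC u) => h.
have h1 : 0 <= re_inner (G s u) u + m * nrm u ^+ 2.
  by apply: le_trans h; rewrite mulr_ge0 ?sqr_ge0 // ltW.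
rewrite riBl ri_self /K riNl riZl.
by have := mulr_ge0 (ltW k0) h1; lra.
Qed.

Lemma fb_solve s P f v : rho A s -> is_inverse (fun u => u - K (G s u)) P ->
  let u := P (v + K (C f s)) in
  fb_node (resolvent A s f + H s u) v (s *: (resolvent A s f + H s u) - f) (C f s + G s u).
Proof.
move=> rs [bP [_ PK]] u; rewrite /fb_node.
have -> : v + K (C f s + G s u) = u.
  by rewrite (linD lK) addrA -(PK (v + K (C f s))) -/u subrK.
exact: node_mk.
Qed.

(** The operator is defined by its graph; [fb_uniq] makes the choice of [z] unambiguous. *)
Definition fb_op : unbounded X :=
  Unbounded [set x | exists z y, fb_node x 0 z y] (fun x => xget 0 [set z | exists y, fb_node x 0 z y]).

Lemma fb_opP x z y : fb_node x 0 z y -> dom fb_op x /\ fb_op x = z.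
Proof.
move=> h; split; first by exists z, y.
have e : exists z, [set z | exists y, fb_node x 0 z y] z by exists z, y.
by have [y' h'] := xgetPex 0 e; have [] := fb_uniq h' h.
Qed.

Lemma fb_op_dom x : dom fb_op x -> exists y, fb_node x 0 (fb_op x) y.
Proof.
move=> [z [y h]].
have e : exists z, [set z | exists y, fb_node x 0 z y] z by exists z, y.
exact: (xgetPex 0 e).
Qed.

Lemma fb_op_rho s P : 0 < complex.Re s -> is_inverse (fun u => u - K (G s u)) P ->
  is_resolvent fb_op s (fun f => resolvent A s f + H s (P (K (C f s)))).
Proof.
move=> s0 hP; have rs := rho_right s0; have [bP _] := hP.
have hQ f : fb_node (resolvent A s f + H s (P (K (C f s)))) 0
    (s *: (resolvent A s f + H s (P (K (C f s)))) - f) (C f s + G s (P (K (C f s)))).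
  by have /= := fb_solve f 0 rs hP; rewrite add0r.
split.
- apply: bounded_linearD; first exact: resolvent_bl.
  apply: (bounded_linear_comp (input_map_bl rs)).
  exact: (bounded_linear_comp bP (bounded_linear_comp fbK_bl (opC_resolvent_bl rs))).
- by move=> f; have [D ->] := fb_opP (hQ f); rewrite subKr.
move=> x /fb_op_dom[y hx]; set f := s *: x - _.
(* The difference [q] of the two solutions satisfies [A^K q = s q]; dissipativity gives
   [Re s |q|^2 <= 0]. *)
have := fb_nodeB (hQ f) hx; rewrite subrr.
have e (q : X) : s *: q - f - fb_op x = s *: (q - x).
  by apply: inner_ext => w; rewrite !(linearDl, linearBl, linearNl, linearZl_LR) /=; ring.
rewrite e.
move=> /fb_dissipative; rewrite riC riZ_self pmulr_rle0 // => h.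
by apply/eqP; rewrite -subr_eq0; apply/eqP/nrm0_eq0/eqP; rewrite -sqrf_eq0 eq_le h sqr_ge0.
Qed.

Lemma fb_op_right s : 0 < complex.Re s -> rho fb_op s.
Proof. by move=> s0; have [P hP] := fb_inverse s0; eexists; exact: fb_op_rho hP. Qed.

Lemma fb_op_dissipative x : dom fb_op x -> re_inner x (fb_op x) <= 0.
Proof. by move=> /fb_op_dom[y]; exact: fb_dissipative. Qed.

Lemma fb_op_generates : exists T, generates fb_op T.
Proof. by apply: hille_yosida => [r r0|x]; [exact: fb_op_right|exact: fb_op_dissipative]. Qed.

Definition fb_opC (x : X) : U := xget 0 [set y | exists z, fb_node x 0 z y].

Lemma fb_opCP x z y : fb_node x 0 z y -> fb_opC x = y.
Proof.
move=> h; have e : exists y, [set y | exists z, fb_node x 0 z y] y by exists y, z.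
by have [z' h'] := xgetPex 0 e; have [] := fb_uniq h' h.
Qed.

Lemma fb_op_node x : dom fb_op x -> fb_node x 0 (fb_op x) (fb_opC x).
Proof. by move=> /fb_op_dom[y h]; rewrite (fb_opCP h). Qed.

Lemma fb_opC_linear a x y : dom fb_op x -> dom fb_op y ->
  fb_opC (a *: x + y) = a *: fb_opC x + fb_opC y.
Proof.
move=> /fb_op_node hx /fb_op_node hy; have := fb_node_lin a hx hy.
by rewrite scaler0 addr0 => /fb_opCP.
Qed.

Let Re1 : 0 < complex.Re (1 : R[i]).
Proof. exact: ltr01. Qed.

Let r1 : rho A 1 := rho_right Re1.
Let rK1 : rho fb_op 1 := fb_op_right Re1.

(** The explicit formula is available at 1; the resolvent identity moves boundedness to any [s] in
    the resolvent set, including points outside the right half-plane. *)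
Lemma fb_opC_resolvent_bl s : rho fb_op s -> bounded_linear (fun f => fb_opC (resolvent fb_op s f)).
Proof.
move=> rs; have [P hP] := fb_inverse Re1; have [bP _] := hP.
have b1 : bounded_linear (fun f => fb_opC (resolvent fb_op 1 f)).
  have -> : (fun f => fb_opC (resolvent fb_op 1 f)) = (fun f => C f 1 + G 1 (P (K (C f 1)))).
    apply/funext => f; rewrite (resolventE (fb_op_rho Re1 hP)).
    by have /= := fb_solve f 0 r1 hP; rewrite add0r => /fb_opCP.
  apply: bounded_linearD; first exact: opC_resolvent_bl.
  apply: (bounded_linear_comp (transfer_bounded r1)).
  exact: (bounded_linear_comp bP (bounded_linear_comp fbK_bl (opC_resolvent_bl r1))).
have -> : (fun f => fb_opC (resolvent fb_op s f)) =
    (fun f => fb_opC (resolvent fb_op 1 f)) \o (fun f => f + (1 - s) *: resolvent fb_op s f).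
  apply/funext => f /=; congr fb_opC.
  rewrite (linD (resolvent_lin rK1)) (linZ (resolvent_lin rK1)) (resolvent_id f rK1 rs).
  by rewrite -addrA -scalerDl (_ : s - 1 + (1 - s) = 0) ?scale0r ?addr0 //; ring.
apply: (bounded_linear_comp b1); apply: bounded_linearD; first exact: bounded_linear_id.
exact/bounded_linearZ/resolvent_bl.
Qed.

(* The completion of X for |(1 - A^K)^-1 x| is X itself, embedded by (1 - A^K)^-1 *)
Lemma fb_emb_dense : dense (range (resolvent fb_op 1)).
Proof.
have [T gen] := fb_op_generates; apply: eps_dense => w e e0.
have [x Dx hx] := sg_dom_dense gen (ex_intro _ _ rK1) w e0.
by exists x => //; exists (1 *: x - fb_op x) => //; rewrite (Kresolvent rK1).
Qed.

Definition fb_ext : extrapolation fb_op 1 :=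
  @Extrapolation R X fb_op 1 X (resolvent fb_op 1) (resolvent_lin rK1) (fun=> erefl) fb_emb_dense.

(** As [emb] is [(1 - A^K)^-1], the extended resolvent is [(s - A^K)^-1 (1 - A^K)], which is this
    bounded operator on [X]. *)
Lemma fb_extE s w : rho fb_op s -> ext_resolvent fb_ext s w = w + (1 - s) *: resolvent fb_op s w.
Proof.
move=> rs; pose g := fun w : X => w + (1 - s) *: resolvent fb_op s w.
have bg : bounded_linear g.
  apply: bounded_linearD; first exact: bounded_linear_id.
  exact/bounded_linearZ/resolvent_bl.
have hg x : g (resolvent fb_op 1 x) = resolvent fb_op s x.
  by rewrite /g [RHS](resolvent_id x rs rK1).
have ex : exists g, [set g : fb_ext -> X | bounded_linear g /\
    forall x, [set: X] x -> g (emb fb_ext x) = resolvent fb_op s x] g.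
  by exists g; split=> [|x _]; [exact: bg|exact: hg].
have [bE hE] := xgetPex (fun=> 0) ex.
apply: (@eq_on_dense _ X X (range (resolvent fb_op 1)) (ext_resolvent fb_ext s) g) => //.
  exact/dense_eps/fb_emb_dense.
by move=> _ [x _ <-]; rewrite hg; exact: hE.
Qed.

Theorem closed_loop_exists : exists SK : sysnode U X U, closed_loop S K SK.
Proof.
have [T gen] := fb_op_generates.
have [P1 hP1] := fb_inverse Re1; have [bP1 _] := hP1.
(* [Hk] is [(1 - A^K)^-1 B^K]. In this realization of the completion it is [B^K] itself. *)
pose Hk v : X := H 1 (P1 v); pose yk v : U := G 1 (P1 v).
have nk v : fb_node (Hk v) v (Hk v) (yk v).
  have /= := fb_solve 0 v r1 hP1; have lC := lin0 (proj1 (opC_resolvent_bl r1)).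
  have -> : C 0 1 = 0 by exact: lC.
  by rewrite (lin0 (resolvent_lin r1)) (lin0 lK) !add0r addr0 subr0 scale1r.
(* The value at 1 is [G(1) P1]; the values elsewhere are then forced by [transfer_diff]. *)
pose Gk s v := yk v + (1 - s) *: fb_opC (resolvent fb_op s (Hk v)).
have bHk : bounded_linear Hk := bounded_linear_comp (input_map_bl r1) bP1.
have opCb : exists M : R, forall x, dom fb_op x -> nrm (fb_opC x) <= M * nrm (1 *: x - fb_op x).
  have [_ [M M0 hM]] := proj1 (bounded_linearP _) (fb_opC_resolvent_bl rK1).
  by exists M => x Dx; have := hM (1 *: x - fb_op x); rewrite (Kresolvent rK1).
have Gkb s : rho fb_op s -> bounded_linear (Gk s).
  move=> rs; apply: bounded_linearD.
    exact: (bounded_linear_comp (transfer_bounded r1) bP1).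
  exact: (bounded_linearZ _ (bounded_linear_comp (fb_opC_resolvent_bl rs) bHk)).
have opCB x y : dom fb_op x -> dom fb_op y -> fb_opC (x - y) = fb_opC x - fb_opC y.
  by move=> Dx Dy; have := fb_opC_linear (-1) Dy Dx; rewrite !scaleN1r ![- _ + _]addrC.
have [D0 DS] := dom_closed gen.
have opCZ a x : dom fb_op x -> fb_opC (a *: x) = a *: fb_opC x /\ dom fb_op (a *: x).
  move=> Dx; rewrite -[a *: x]addr0 fb_opC_linear //; split; last exact: DS.
  by have := opCB 0 0 D0 D0; rewrite !subrr => ->; rewrite addr0.
have Gkd s b : rho fb_op s -> rho fb_op b -> forall v,
    Gk s v - Gk b v = fb_opC (ext_resolvent fb_ext s (Hk v) - ext_resolvent fb_ext b (Hk v)).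
  move=> rs rb v; rewrite (fb_extE _ rs) (fb_extE _ rb) /Gk.
  have ca (V : zmodType) (x y z : V) : (x + y) - (x + z) = y - z.
    by rewrite opprD addrACA subrr add0r.
  rewrite !ca.
  have [e1 d1] := opCZ (1 - s) _ (resolvent_dom (Hk v) rs).
  have [e2 d2] := opCZ (1 - b) _ (resolvent_dom (Hk v) rb).
  by rewrite opCB // e1 e2.
pose SK := @SysNode R U X U fb_op T 1 fb_ext Hk fb_opC Gk gen rK1 bHk fb_opC_linear opCb Gkb Gkd.
(* The constructed node has exactly the closed-loop graph, so all the required formulas can be read
   from [nodeP] for [S]. *)
have nodeK x v z y : node SK x v z y <-> fb_node x v z y.
  have iE : input_map SK 1 v = Hk v.
    by rewrite /input_map /= fb_extE // subrr scale0r addr0.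
  have gE : Gk 1 v = yk v by rewrite /Gk subrr scale0r addr0.
  split.
    move=> /(@nodeP _ _ _ _ SK 1 _ _ _ _ rK1)[]; rewrite /= iE gE scale1r => hx hy.
    set q := resolvent fb_op 1 (x - z) in hx hy.
    have hq := fb_op_node (resolvent_dom (x - z) rK1 : dom fb_op q).
    have eq : fb_op q = q - (x - z).
      by have := resolventK (x - z) rK1; rewrite scale1r -/q => <-; rewrite subKr.
    have := fb_node_lin 1 hq (nk v); rewrite !scale1r add0r eq -hx -hy.
    by rewrite addrAC -hx subKr.
  move=> h; have := fb_nodeB h (nk v); rewrite subrr => h0.
  have [Dq Eq] := fb_opP h0; have Cq := fb_opCP h0.
  apply/(@nodeP _ _ _ _ SK 1 _ _ _ _ rK1); rewrite /= iE gE scale1r.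
  have -> : resolvent fb_op 1 (x - z) = x - Hk v.
    rewrite -[RHS](Kresolvent rK1 Dq) Eq scale1r; congr (resolvent _ _ _).
    by rewrite opprB addrA subrK.
  by rewrite Cq !subrK.
exists SK; split.
  by exists 0 => s s0; split; [exact: rho_right|exact: fb_inverse].
move=> s rs rKs; have rKs' : rho (opA SK) s := rKs.
pose P v := v + K (transfer SK s v).
have bP : bounded_linear P.
  apply: bounded_linearD; first exact: bounded_linear_id.
  exact: (bounded_linear_comp fbK_bl (transfer_bounded rKs')).
have hin v : input_map SK s v = H s (P v) /\ transfer SK s v = G s (P v).
  have /nodeK := node_input v rKs'; move=> /(nodeP _ _ _ _ rs)[].
  have lC := lin0 (proj1 (opC_resolvent_bl rs)).
  by rewrite subrr lC (lin0 (resolvent_lin rs)) !add0r.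
have KP v : P v - K (G s (P v)) = v.
  by rewrite -(proj2 (hin v)) /P addrK.
have lL : linear (fun u => u - K (G s u)).
  move=> a x y; rewrite (proj1 (transfer_bounded rs)) lK opprD scalerBr.
  by rewrite addrACA.
(* A kernel vector is a plant input sustained by feedback alone, with [z = s x]; since [s] is in the
   closed-loop resolvent set, [x = 0], and then [fb_zero] gives [G(s) u = 0]. *)
have inj u : u - K (G s u) = 0 -> u = 0.
  move=> hu; have uE : u = 0 + K (G s u) by rewrite add0r; apply/eqP; rewrite -subr_eq0 hu.
  have : fb_node (H s u) 0 (s *: H s u) (G s u) by rewrite /fb_node -uE; exact: node_input.
  move=> /nodeK /[dup] hn /(@nodeP _ _ _ _ SK s _ _ _ _ rKs')[].
  rewrite subrr (lin0 (resolvent_lin rKs')) (lin0 (proj1 (input_map_bl rKs'))) addr0 => hH _.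
  move/nodeK : hn; rewrite hH scaler0 => /fb_zero[_ hG].
  by rewrite uE hG (lin0 lK) addr0.
have PK u : P (u - K (G s u)) = u.
  apply/eqP; rewrite -subr_eq0; apply/eqP/inj.
  by have := linB lL (P (u - K (G s u))) u; rewrite /= KP subrr.
have invP : is_inverse (fun u => u - K (G s u)) P by split; [exact: bP|split=> u; [exact: PK|exact: KP]].
(* [K] is a scalar and commutes with [G(s)], so [P] serves for both inverses. *)
have KG y : K (G s y) = G s (K y).
  by rewrite /K (linN (proj1 (transfer_bounded rs))) (linZ (proj1 (transfer_bounded rs))).
have invQ : is_inverse (fun y => y - G s (K y)) P.
  by rewrite (_ : (fun y => y - G s (K y)) = (fun u => u - K (G s u))) //; apply/funext => y; rewrite KG.
have hout f : resolvent fb_op s f = resolvent A s f + H s (K (P (C f s))) /\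
    fb_opC (resolvent fb_op s f) = P (C f s).
  have hq := fb_op_node (resolvent_dom f rKs).
  have eq : fb_op (resolvent fb_op s f) = s *: resolvent fb_op s f - f.
    by have e := resolventK f rKs; rewrite -[X in _ = _ - X]e subKr.
  rewrite eq in hq; move/(nodeP _ _ _ _ rs) : hq; rewrite subKr add0r => -[hx hy].
  have -> : P (C f s) = fb_opC (resolvent fb_op s f).
    rewrite -[RHS]PK KG; congr P; apply: (canRL (addrK _)).
    exact: esym hy.
  by [].
exists P, P; split => //.
- by move=> u; case: (hin u).
- by split=> [x|x|u]; [case: (hout x)|case: (hout x)|case: (hin u)].
Qed.

End ClosedLoop.

(** * Integrals of squared norms *)

Section Energy.
Context {R : realType}.
Implicit Types H : hilbertType R.
Local Notation mu := (@lebesgue_measure R).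

Lemma wc_nrm_sq (V : completeNormedModType R[i]) (f : R -> V) :
  {within half_line, continuous f} ->
  {within half_line, continuous (fun t => nrm (f t) ^+ 2)}.
Proof.
by move=> /wc_nrm/wcP h; apply/wcP => s s0; have hs := h s s0; exact: (cvgM hs hs).
Qed.

Lemma sq_norm_L2_wc (V : completeNormedModType R[i]) (f : R -> V) t :
  {within half_line, continuous f} ->
  sq_norm_L2 `[0, t] f = (\int[mu]_(s in `[0, t]) (nrm (f s) ^+ 2))%:E.
Proof.
move=> hf; rewrite /sq_norm_L2 /Rintegral fineK //.
apply: integrable_fin_num; first exact: measurable_itv.
by apply: wc_integrable; exact: wc_nrm_sq.
Qed.

Lemma sq_norm_FTC H (z z' : R -> H) (t : R) : is_C1 z z' -> 0 < t ->
  \int[mu]_(s in `[0, t]) (2 * re_inner (z s) (z' s)) = nrm (z t) ^+ 2 - nrm (z 0) ^+ 2.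
Proof.
move=> C1z t0; have [dz cz'] := C1z; have cz := C1_wc C1z.
have cf : {within half_line, continuous (fun s => 2 * re_inner (z s) (z' s))}.
  by apply/wcP => s s0; apply: cvgMl_tmp; have /wcP := wc_ri cz cz'; exact.
have dF (s : R) : 0 < s -> is_derive s (1 : R) (fun s => nrm (z s) ^+ 2) (2 * re_inner (z s) (z' s)).
  by move=> s0; apply: (rderiv_is_derive s0); apply: has_deriv_sq; exact: (dz _ (ltW s0)).
have cF : {within half_line, continuous (fun s => nrm (z s) ^+ 2)}.
  exact: wc_nrm_sq.
rewrite /Rintegral (@continuous_FTC2 R _ (fun s => nrm (z s) ^+ 2) 0 t t0) //.
- by apply: continuous_subspaceW cf => s /=; rewrite in_itv half_lineE /= => /andP[].
- split.
  + by move=> s; rewrite in_itv /= => /andP[s0 _]; have := dF s s0; case.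
  + have /wcP/(_ 0 (lexx _))/cvgrPdist_lt h := cF; apply/cvgrPdist_lt => e e0.
    have := h e e0; rewrite /at_right !near_withinE.
    by apply: filterS => s hs s0; apply: hs; rewrite half_lineE ltW.
  + have /wcP/(_ t (ltW t0))/cvgrPdist_lt h := cF; apply/cvgrPdist_lt => e e0.
    have := h e e0; rewrite /at_left !near_withinE; have := near_dist t t0.
    apply: filterS2 => s st hs _; apply: hs; rewrite half_lineE.
    by move: st; rewrite ltr_norml => /andP[+ _]; lra.
- move=> s; rewrite in_itv /= => /andP[s0 _].
  by rewrite derive1E; apply: derive_val; exact: dF.
Qed.

End Energy.

(** * From an arbitrary closed-loop node back to the plant *)

Section ClosedLoopNode.
Context {R : realType} {U X Y : hilbertType R} (S : sysnode U X Y) (K : Y -> U)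
  (SK : sysnode U X Y).
Hypothesis lK : linear K.

(** By [nodeP] a single point in both resolvent sets suffices; there the identities of [closed_loop]
    express the closed-loop graph through plant data. *)
Lemma closed_loop_node x v z y : closed_loop S K SK ->
  node SK x v z y -> node S x (v + K y) z y.
Proof.
case=> -[w hw] hcl hn.
have [r0 hr0] := rho_eventually (opA_generates SK) (ex_intro _ _ (alpha_rho SK)).
pose s := (Num.max r0 (w + 1))%:C : R[i].
have rK : rho (opA SK) s by apply: hr0; rewrite le_max lexx.
have [rs _] : rho (opA S) s /\ exists P, is_inverse (fun u => u - K (transfer S s u)) P.
  by apply: hw; rewrite /= lt_max ltrDl ltr01 orbT.
have [P [Q [[_ [_ PK]] [_ [_ QK]] hG [hR hC hH]]]] := hcl s rs rK.
have /(nodeP _ _ _ _ rK)[] := hn; set f := _ - z; rewrite hC hR hG /input_map hH => hx hy.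
set a := opC S (resolvent (opA S) s f) in hx hy.
(* From [y = Q a + G (P v)] and [P v - K G (P v) = v]. Together with [Q a - G K Q a = a], this turns
   the closed-loop formulas into those of [S]. *)
have e : v + K y = K (Q a) + P v.
  by rewrite hy (linD lK) -{1}(PK v) /=; apply: inner_ext => u;
     rewrite !(linearDl, linearBl, linearNl, linearZl_LR) /=; ring.
apply/(nodeP _ _ _ _ rs); rewrite -/f -/a e /input_map.
have lB := proj1 (opB_bounded S); have lE := proj1 (ext_resolvent_bl rs).
have lG := proj1 (transfer_bounded rs).
split; first by rewrite (linD lB) (linD lE) addrA.
by rewrite [LHS]hy (linD lG) addrA; congr (_ + _); rewrite -[X in _ = X + _](QK a) /= subrK.
Qed.

End ClosedLoopNode.

(** * Energy balance and well-posedness *)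

Section StrictlyDissipative.
Context {R : realType} {U X Y : hilbertType R} (S : sysnode U X Y) (a b : R).
Hypothesis a0 : 0 <= a.
Hypothesis b0 : 0 < b.
Hypothesis diss : forall x v z y, node S x v z y ->
  2 * re_inner x z <= a * nrm v ^+ 2 - b * nrm y ^+ 2.

Lemma node_energy v z z' y (t : R) : {within half_line, continuous v} -> is_C1 z z' ->
  (forall s : R, 0 <= s -> node S (z s) (v s) (z' s) (y s)) -> 0 <= t ->
  ((nrm (z t) ^+ 2)%:E + b%:E * sq_norm_L2 `[0%R, t] y <=
   (nrm (z 0) ^+ 2)%:E + a%:E * sq_norm_L2 `[0%R, t] v)%E.
Proof.
move=> cv C1z hn t0; have [dz cz'] := C1z; have cz := C1_wc C1z.
have cy : {within half_line, continuous y} := node_wc cz cv cz' hn.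
rewrite !sq_norm_L2_wc // -!EFinM -!EFinD lee_fin.
have cl (c : R) (f : R -> R) : {within half_line, continuous f} ->
    {within half_line, continuous (fun t => c * f t)}.
  by move=> /wcP cf; apply/wcP => s s0; apply: cvgMl_tmp; exact: cf.
have [->|tn] := eqVneq t 0.
  by rewrite set_itv1 !Rintegral_set1 !mulr0.
have tp : 0 < t by rewrite lt_neqAle eq_sym tn.
have mI : measurable `[0, t]%classic by exact: measurable_itv.
have h1 := @le_Rintegral _ _ _ lebesgue_measure `[0, t]%classic
  (fun s => 2 * re_inner (z s) (z' s)) (fun s => a * nrm (v s) ^+ 2 - b * nrm (y s) ^+ 2) mI.
have i1 := @wc_integrable R _ t (cl 2 _ (wc_ri cz cz')).
have i2 := @wc_integrable R _ t (cl a _ (wc_nrm_sq cv)).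
have i3 := @wc_integrable R _ t (cl b _ (wc_nrm_sq cy)).
have := h1 i1; rewrite sq_norm_FTC // RintegralB // !RintegralZl //.
- move=> h; rewrite -lerBrDr -addrA -lerBlDl; apply: h.
    apply: wc_integrable; apply/wcP => s s0.
    have /wcP c1 := cl a _ (wc_nrm_sq cv); have /wcP c2 := cl b _ (wc_nrm_sq cy).
    exact: cvgB (c1 s s0) (c2 s s0).
  by move=> s /=; rewrite in_itv /= => /andP[s0 _]; apply: diss; exact: hn.
- by apply: wc_integrable; exact: wc_nrm_sq.
- by apply: wc_integrable; exact: wc_nrm_sq.
Qed.

Lemma classical_energy z0 v z y (t : R) : classical_trajectory S z0 v z y -> 0 <= t ->
  ((nrm (z t) ^+ 2)%:E + b%:E * sq_norm_L2 `[0%R, t] y <=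
   (nrm z0 ^+ 2)%:E + a%:E * sq_norm_L2 `[0%R, t] v)%E.
Proof.
move=> /classical_node[<- [v' [v'' [C1v _]]] [z' C1z hn]] t0.
exact: node_energy (C1_wc C1v) C1z hn t0.
Qed.

Lemma sq_norm_L2_ge0 (V : completeNormedModType R[i]) D (f : R -> V) : (0 <= sq_norm_L2 D f)%E.
Proof. by apply: integral_ge0 => t _; rewrite lee_fin sqr_ge0. Qed.

Lemma dissipative_well_posed : well_posed S.
Proof.
(* [1 + 1 / b] restores the full weight of [|y|^2] on the left, and [1 + a] dominates both
   coefficients on the right. *)
exists 1 => //; exists ((1 + b^-1) * (1 + a)).
  by rewrite mulr_ge0 // addr_ge0 // invr_ge0 ltW.
move=> z0 v z y h; have := classical_energy h ler01.
have /classical_node[z00 [v' [v'' [C1v _]]] [z' C1z hn]] := h.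
have cz := C1_wc C1z; have cv := C1_wc C1v.
have cy := node_wc cz cv (proj2 C1z) hn.
have := sq_norm_L2_ge0 `[0, 1] v; have := sq_norm_L2_ge0 `[0, 1] y.
rewrite (sq_norm_L2_wc 1 cv) (sq_norm_L2_wc 1 cy) -!EFinM -!EFinD !lee_fin.
set q := \int[_]_(_ in _) nrm (v _) ^+ 2; set p := \int[_]_(_ in _) nrm (y _) ^+ 2 => p0 q0 h1.
have bi : b^-1 * b = 1 by rewrite mulVf // gt_eqF.
have bi0 : 0 <= b^-1 by rewrite invr_ge0 ltW.
have z2 := sqr_ge0 (nrm (z 1)); have z3 := sqr_ge0 (nrm z0).
have h2 : nrm (z 1) ^+ 2 + p <= (1 + b^-1) * (nrm (z 1) ^+ 2 + b * p).
  rewrite mulrDl mul1r mulrDr [b^-1 * (b * p)]mulrA bi mul1r.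
  have := mulr_ge0 bi0 z2; have := mulr_ge0 (ltW b0) p0; lra.
apply: le_trans h2 _; rewrite -mulrA ler_wpM2l ?addr_ge0 //.
apply: le_trans h1 _; rewrite mulrDl mul1r mulrDr.
by have := mulr_ge0 a0 z3; have := mulr_ge0 a0 q0; lra.
Qed.

Lemma opA_diss x : dom (opA S) x -> re_inner x (opA S x) <= 0.
Proof.
move=> Dx; have := diss (node_dom Dx); rewrite nrm0 expr0n mulr0 sub0r => h.
rewrite -(pmulr_rle0 _ (ltr0n _ 2)); apply: le_trans h _.
by rewrite oppr_le0 mulr_ge0 ?sqr_ge0 // ltW.
Qed.

Lemma dissipative_semigroup : contraction_semigroup (semigroup S).
Proof.
apply: (dissipative_contraction (opA_generates S)) opA_diss.
by exists (alpha S); exact: alpha_rho.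
Qed.

Lemma real_rho (r : R) : 0 < r -> rho (opA S) r%:C.
Proof.
move=> r0; apply: (dissipative_rho (opA_generates S)) opA_diss _ => //.
by exists (alpha S); exact: alpha_rho.
Qed.

End StrictlyDissipative.

Section ClosedLoopDissipation.
Context {R : realType} {U X : hilbertType R} (S : sysnode U X U) (m k : R).
Hypothesis pas : forall x u z y, node S x u z y ->
  re_inner x z <= re_inner u y + m * nrm u ^+ 2.
Hypothesis k0 : 0 < k.
Hypothesis km : k * m < 1.

(** Put [c = 1 - k m]. Doubling [fb_energy] and using [2 <u, v> <= c |u|^2 + |v|^2 / c] leaves
    [2 k <x, z> <= |v|^2 / c - c |u|^2]. Since [k y = v - u], [k^2 |y|^2 <= 2 |v|^2 + 2 |u|^2]
    trades the remaining [- c |u|^2] for [- c k^2 |y|^2 / 2] plus [c |v|^2]; dividing by [k] gives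
    the constants. *)
Lemma closed_loop_dissipative SK : closed_loop S (fun y => - (k%:C *: y)) SK ->
  exists2 a : R, 0 <= a & exists2 b : R, 0 < b & forall x v z y, node SK x v z y ->
    2 * re_inner x z <= a * nrm v ^+ 2 - b * nrm y ^+ 2.
Proof.
move=> hcl; pose c : R := 1 - k * m; have c0 : 0 < c by rewrite subr_gt0.
have ci0 : 0 < c^-1 by rewrite invr_gt0.
exists ((c + c^-1) / k); first by rewrite divr_ge0 ?(ltW k0) // addr_ge0 // ltW.
exists (c * k / 2) => [|x v z y hn]; first by rewrite divr_gt0 ?mulr_gt0.
have := fb_energy pas k0 (closed_loop_node (proj1 (fbK_bl k)) hcl hn).
set u := v + _; rewrite -/c => h.
have hu : k ^+ 2 * nrm y ^+ 2 = nrm v ^+ 2 - 2 * re_inner u v + nrm u ^+ 2.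
  have -> : k ^+ 2 * nrm y ^+ 2 = nrm (k%:C *: y) ^+ 2 by rewrite nrmZR gtr0_norm // exprMn.
  have -> : k%:C *: y = v - u by rewrite /u opprD addNKr opprK.
  by rewrite nrm_sqB (riC v u).
have h1 : 0 <= (nrm (c%:C *: u - v)) ^+ 2 by rewrite sqr_ge0.
have h2 : 0 <= nrm (u + v) ^+ 2 by rewrite sqr_ge0.
rewrite nrm_sqB nrmZR gtr0_norm // exprMn riZl in h1; rewrite nrm_sqD in h2.
have ci : c^-1 * c = 1 by rewrite mulVf // gt_eqF.
have h3 : 2 * re_inner u v <= c * nrm u ^+ 2 + c^-1 * nrm v ^+ 2.
  have := mulr_ge0 (ltW ci0) h1; rewrite mulrDr mulrBr.
  have -> : c^-1 * (c ^+ 2 * nrm u ^+ 2) = (c^-1 * c) * c * nrm u ^+ 2 by ring.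
  have -> : c^-1 * (2 * (c * re_inner u v)) = (c^-1 * c) * (2 * re_inner u v) by ring.
  by rewrite ci !mul1r; lra.
have h4 : c * (k ^+ 2 * nrm y ^+ 2) <= c * (2 * nrm v ^+ 2 + 2 * nrm u ^+ 2).
  by rewrite ler_wpM2l ?(ltW c0) // hu; lra.
rewrite -(ler_pM2l k0).
have -> : k * ((c + c^-1) / k * nrm v ^+ 2 - c * k / 2 * nrm y ^+ 2) =
    (c + c^-1) * nrm v ^+ 2 - c * (k ^+ 2 * nrm y ^+ 2) / 2.
  by move: (c) (c^-1) => c1 c2; field; rewrite gt_eqF.
by rewrite mulrDl; lra.
Qed.

End ClosedLoopDissipation.

(** * Square integrable functions *)

Section StrongMeasurability.
Context {R : realType}.
Implicit Types (V W Z : completeNormedModType R[i]).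
Local Notation mu := (@lebesgue_measure R).

Lemma simple_map_preimage V (s : R -> V) (B : set V) : simple_map s -> measurable (s @^-1` B).
Proof.
move=> [fs ms]; have -> : s @^-1` B = \bigcup_(c in range s `&` B) s @^-1` [set c].
  apply/seteqP; split=> [t Bt|t [c [_ Bc] /= e]]; last by rewrite /preimage /= e.
  by exists (s t) => //; split=> //; exists t.
by apply: fin_bigcup_measurable => [|c _]; [exact: finite_setIl|exact: ms].
Qed.

Lemma simple_map2 V W Z (h : V -> W -> Z) s s' : simple_map s -> simple_map s' ->
  simple_map (fun t : R => h (s t) (s' t)).
Proof.
move=> hs hs'; split.
  apply: (@sub_finite_set _ _ [set h x y | x in range s & y in range s']).
    by move=> _ [t _ <-]; exists (s t); [exists t|exists (s' t); [exists t|]].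
  by apply: finite_image2; [exact: (proj1 hs)|exact: (proj1 hs')].
move=> c; have -> : (fun t => h (s t) (s' t)) @^-1` [set c] =
    \bigcup_(p in range s) (s @^-1` [set p] `&` s' @^-1` [set q | h p q = c]).
  apply/seteqP; split=> [t /= e|t [p _ [/= -> //]]].
  by exists (s t); [exists t|split].
apply: fin_bigcup_measurable => [|p _]; first exact: (proj1 hs).
by apply: measurableI; exact: simple_map_preimage.
Qed.

Lemma simple_cst V (c : V) : simple_map (fun _ : R => c).
Proof.
split=> [|d]; first by apply: (sub_finite_set _ (finite_set1 c)) => _ [t _ <-].
have [->|n] := pselect (c = d); first by rewrite preimage_cst mem_set //; exact: measurableT.
by rewrite preimage_cst memNset //; exact: measurable0.
Qed.

Definition restr V (A : set R) (f : R -> V) (t : R) : V := if t \in A then f t else 0.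

Lemma simple_restr V A (s : R -> V) : measurable A -> simple_map s -> simple_map (restr A s).
Proof.
move=> mA hs; split.
  apply: (@sub_finite_set _ _ (range s `|` [set 0])).
    by move=> _ [t _ <-]; rewrite /restr; case: ifP => _; [left; exists t|right].
  by rewrite finite_setU; split; [exact: (proj1 hs)|exact: finite_set1].
move=> c; have -> : restr A s @^-1` [set c] =
    (A `&` s @^-1` [set c]) `|` (~` A `&` (fun=> 0 : V) @^-1` [set c]).
  apply/seteqP; split=> [t|t [|] []] /=; rewrite /restr.
  - by case: ifPn => [/set_mem At <-|]; [left|rewrite notin_setE; right].
  - by move=> At <-; rewrite mem_set.
  - by move=> At <-; rewrite memNset.
apply: measurableU; apply: measurableI => //; first exact: (proj2 hs).
  exact: measurableC.
exact: (proj2 (simple_cst _)).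
Qed.

Lemma sm_simple V (s : R -> V) : simple_map s -> strongly_measurable s.
Proof. by move=> h; exists (fun=> s) => // t _; exact: cvg_cst. Qed.

Lemma smD V (f g : R -> V) : strongly_measurable f -> strongly_measurable g ->
  strongly_measurable (fun t => f t + g t).
Proof.
move=> [s hs cs] [s' hs' cs']; exists (fun n t => s n t + s' n t).
  by move=> n; exact: simple_map2.
by move=> t t0; apply: cvgD; [exact: cs|exact: cs'].
Qed.

Lemma smB V (f g : R -> V) : strongly_measurable f -> strongly_measurable g ->
  strongly_measurable (fun t => f t - g t).
Proof.
move=> [s hs cs] [s' hs' cs']; exists (fun n t => s n t - s' n t).
  by move=> n; exact: (simple_map2 (fun x y => x - y)).
by move=> t t0; apply: cvgB; [exact: cs|exact: cs'].
Qed.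

Lemma sm_restr V A (f : R -> V) : measurable A -> strongly_measurable f ->
  strongly_measurable (restr A f).
Proof.
move=> mA [s hs cs]; exists (fun n => restr A (s n)); first by move=> n; exact: simple_restr.
by move=> t t0; rewrite /restr; case: ifP => _; [exact: cs|exact: cvg_cst].
Qed.

Lemma sm_wc V (f : R -> V) : {within half_line, continuous f} -> strongly_measurable f.
Proof.
move=> /within_contP cf; pose h n : R := n.+1%:R^-1.
(* The [(n + 1)^2] cells of width [1 / (n + 1)] cover [[0, n + 1)], so every [t >= 0] is eventually
   covered by an arbitrarily short cell. *)
pose J n (k : nat) := `[k%:R * h n, k.+1%:R * h n[%classic : set R.
pose s n t := \sum_(k < (n.+1 * n.+1)%N) restr (J n k) (fun=> f (k%:R * h n)) t.
exists s => [n|t t0].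
  have -> : s n = fun t => \sum_(k < (n.+1 * n.+1)%N) restr (J n k) (fun=> f (k%:R * h n)) t by [].
  elim: (n.+1 * n.+1)%N => [|m IH].
    by under eq_fun do rewrite big_ord0; exact: simple_cst.
  under eq_fun do rewrite big_ord_recr /=; apply: (simple_map2 +%R IH).
  by apply: simple_restr; [exact: measurable_itv|exact: simple_cst].
apply/cvg_nrmP => e e0; have /nearP[d d0 hd] := cf t t0 e e0.
near=> n; have h0 : 0 < h n by rewrite invr_gt0.
have hn : h n < d by near: n; exact: near_infty_natSinv_lt (PosNum d0).
have tn : t < n%:R by near: n; exact: nbhs_infty_gtr.
have q0 : 0 <= t / h n by rewrite divr_ge0 // ltW.
have /andP[k1 k2] := truncn_itv q0; set k := Num.trunc _ in k1 k2.
rewrite ler_pdivlMr // in k1; rewrite ltr_pdivrMr // in k2.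
have kN : (k < n.+1 * n.+1)%N.
  rewrite -(ltr_nat R) natrM; apply: (@le_lt_trans _ _ (t * n.+1%:R)).
    by rewrite -ler_pdivrMr.
  by rewrite ltr_pM2r // (lt_trans tn) // ltr_nat.
have -> : s n t = f (k%:R * h n).
  rewrite /s (bigD1 (Ordinal kN)) //= big1 ?addr0.
    by rewrite /restr mem_set // /J /= in_itv /= k1 k2.
  move=> i ik; rewrite /restr memNset // /J /= in_itv /= => /andP[i1 i2].
  move/eqP: ik; apply; apply: val_inj => /=; apply/eqP; rewrite eqn_leq.
  have a1 := le_lt_trans i1 k2; have a2 := le_lt_trans k1 i2.
  by move: a1 a2; rewrite !ltr_pM2r // !ltr_nat !ltnS => -> ->.
apply: hd; last by rewrite mulr_ge0 // ltW.
rewrite ler0_norm ?subr_le0 // opprB; apply: lt_trans hn.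
by move: k2; rewrite -natr1 mulrDl mul1r; lra.
Unshelve. all: by end_near.
Qed.

Lemma half_line_measurable : measurable (half_line : set R).
Proof. exact: measurable_itv. Qed.

Lemma sm_nrm V (f : R -> V) : strongly_measurable f ->
  measurable_fun half_line (fun t => nrm (f t)).
Proof.
move=> [s hs cs]; apply: (@measurable_fun_cvg _ _ _ _ (fun n t => nrm (s n t))).
  move=> n _ B mB; apply: measurableI; first exact: half_line_measurable.
  by have := simple_map_preimage (@nrm R V @^-1` B) (hs n); exact.
by move=> t; rewrite half_lineE => t0; apply: cvg_nrm; exact: cs.
Qed.

Lemma sm_sq V (f : R -> V) (D : set R) : measurable D -> D `<=` half_line -> strongly_measurable f ->
  measurable_fun D (fun t => (nrm (f t) ^+ 2)%:E).
Proof.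
move=> mD DH hf; apply/measurable_EFinP; apply: measurable_funX.
exact: measurable_funS half_line_measurable DH (sm_nrm hf).
Qed.

Lemma itv_half (b : R) : `[0, b]%classic `<=` half_line.
Proof. by move=> t /=; rewrite in_itv half_lineE /= => /andP[]. Qed.

Section Domain.
Variable D : set R.
Hypothesis mD : measurable D.
Hypothesis DH : D `<=` half_line.

(** Working with squared norms avoids square roots of extended reals; the price is the factor 2 of
    [(p + q)^2 <= 2 p^2 + 2 q^2] in every triangle inequality. *)
Lemma sq_norm_D V (f g : R -> V) : strongly_measurable f -> strongly_measurable g ->
  (sq_norm_L2 D (fun t => (f t + g t)%R) <= 2%:E * (sq_norm_L2 D f + sq_norm_L2 D g))%E.
Proof.
move=> hf hg; have mf := sm_sq mD DH hf; have mg := sm_sq mD DH hg.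
have p (h : R -> V) t : (0 <= (nrm (h t) ^+ 2)%:E :> \bar R)%E by rewrite lee_fin sqr_ge0.
rewrite /sq_norm_L2 -ge0_integralD // -ge0_integralZl_EFin //.
- apply: ge0_le_integral => //.
  + by move=> t _; exact: (p (fun t => f t + g t)).
  + exact: (sm_sq mD DH (smD hf hg)).
  + by apply: measurable_funeM; exact: emeasurable_funD.
  move=> t _; rewrite -EFinD -EFinM lee_fin.
  have h1 : nrm (f t + g t) ^+ 2 <= (nrm (f t) + nrm (g t)) ^+ 2.
    by rewrite lerXn2r ?nnegrE ?addr_ge0 ?nrm_ge0 ?nrmD.
  by have := sqr_ge0 (nrm (f t) - nrm (g t)); move: h1; rewrite sqrrD sqrrB; lra.
- by move=> t _; rewrite adde_ge0.
- exact: emeasurable_funD.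
Qed.

Lemma sq_norm_B V (f g : R -> V) : strongly_measurable f -> strongly_measurable g ->
  (sq_norm_L2 D (fun t => (f t - g t)%R) <= 2%:E * (sq_norm_L2 D f + sq_norm_L2 D g))%E.
Proof.
move=> hf hg; have h0 : strongly_measurable (fun _ : R => 0 : V) by exact/sm_simple/simple_cst.
have := sq_norm_D hf (smB h0 hg).
rewrite (_ : sq_norm_L2 D (fun t => 0 - g t) = sq_norm_L2 D g) /=.
  by under [X in (sq_norm_L2 D X <= _)%E -> _]eq_fun do rewrite sub0r.
by apply: eq_integral => t _; rewrite sub0r nrmN.
Qed.

Lemma sq_norm_sym V (f g : R -> V) :
  sq_norm_L2 D (fun t => f t - g t) = sq_norm_L2 D (fun t => g t - f t).
Proof. by apply: eq_integral => t _; rewrite nrm_sym. Qed.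

Lemma sq_norm_triangle V (h f g : R -> V) : strongly_measurable f -> strongly_measurable g ->
  strongly_measurable h ->
  (sq_norm_L2 D (fun t => (f t - g t)%R) <=
   2%:E * (sq_norm_L2 D (fun t => (f t - h t)%R) + sq_norm_L2 D (fun t => (h t - g t)%R)))%E.
Proof.
move=> hf hg hh; have := sq_norm_D (smB hf hh) (smB hh hg).
by under [X in (sq_norm_L2 D X <= _)%E -> _]eq_fun do rewrite addrA subrK.
Qed.

End Domain.

Lemma sq_norm_mono V (D D' : set R) (f : R -> V) : measurable D -> measurable D' ->
  D `<=` D' -> D' `<=` half_line -> strongly_measurable f ->
  (sq_norm_L2 D f <= sq_norm_L2 D' f)%E.
Proof.
move=> mD mD' DD' DH hf; apply: ge0_subset_integral => //; first exact: sm_sq.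
by move=> t _; rewrite lee_fin sqr_ge0.
Qed.

Lemma sq_norm_itv_mono V (t b : R) (f : R -> V) : t <= b -> strongly_measurable f ->
  (sq_norm_L2 `[0%R, t] f <= sq_norm_L2 `[0%R, b] f)%E.
Proof.
move=> tb hf; apply: sq_norm_mono (@itv_half b) hf; [exact: measurable_itv|exact: measurable_itv|].
by move=> r /=; rewrite !in_itv /= => /andP[-> rt] /=; exact: le_trans rt tb.
Qed.

Lemma sq_norm_itv_half V (t : R) (f : R -> V) : strongly_measurable f ->
  (sq_norm_L2 `[0%R, t] f <= sq_norm_L2 half_line f)%E.
Proof.
move=> hf; apply: sq_norm_mono (@itv_half t) (@subset_refl _ _) hf; first exact: measurable_itv.
exact: half_line_measurable.
Qed.

Lemma sq_norm_restr V (D A : set R) (f : R -> V) : A `<=` D ->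
  sq_norm_L2 D (restr A f) = sq_norm_L2 A f.
Proof.
move=> AD; rewrite /sq_norm_L2 integral_mkcond [RHS]integral_mkcond.
apply: eq_integral => t _; rewrite /patch /restr.
case: ifPn => tD; case: ifPn => tA //; first by rewrite nrm0 expr0n.
by move: tD; rewrite notin_setE => -[]; apply: AD; exact: set_mem.
Qed.

Lemma sq_norm_ext V (D : set R) (f g : R -> V) : (forall t, D t -> f t = g t) ->
  sq_norm_L2 D f = sq_norm_L2 D g.
Proof. by move=> h; apply: eq_integral => t /set_mem Dt; rewrite h. Qed.

End StrongMeasurability.

(** * Approximation by simple functions *)

Section DominatedApproximation.
Context {R : realType} {V : completeNormedModType R[i]}.
Implicit Types f g w : R -> V.
Local Notation mu := (@lebesgue_measure R).

Lemma sq_norm_dominated (b : R) (f_ : nat -> R -> V) f (g : R -> R) :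
  (forall n, strongly_measurable (f_ n)) -> strongly_measurable f ->
  {ae mu, forall t, `[0, b]%classic t -> f_ n t @[n --> \oo] --> f t} ->
  mu.-integrable `[0, b] (EFin \o g) ->
  (forall n t, `[0, b]%classic t -> nrm (f_ n t - f t) ^+ 2 <= g t) ->
  forall e : R, 0 < e -> exists n, (sq_norm_L2 `[0%R, b] (fun t => (f_ n t - f t)%R) <= e%:E)%E.
Proof.
move=> hf_ hf cf ig fg e e0.
have mI : measurable `[0, b]%classic by exact: measurable_itv.
have [] := @dominated_convergence _ _ _ mu `[0, b]%classic mI
  (fun n t => (nrm (f_ n t - f t) ^+ 2)%:E) (cst 0%E) (EFin \o g) _ _ _ ig _.
- by move=> n; exact: (sm_sq mI (@itv_half R b) (smB (hf_ n) hf)).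
- exact: measurable_cst.
- apply: (@filterS _ _ (ae_filter_ringOfSetsType mu) _ _ _ cf) => t h It; have /cvg_nrmP {}h := h It.
  apply/fine_cvgP; split; first by apply: nearW.
  apply/cvgrPdist_lt => d d0; have s0 : 0 < Num.sqrt d by rewrite sqrtr_gt0.
  apply: filterS (h _ s0) => n hn /=; rewrite sub0r normrN ger0_norm ?sqr_ge0 //.
  by rewrite -(sqr_sqrtr (ltW d0)) ltrXn2r ?nnegrE ?nrm_ge0 ?sqrtr_ge0.
- by apply: aeW => t n It; rewrite /= ger0_norm ?sqr_ge0 // lee_fin; exact: fg.
move=> _ _; rewrite integral_cst // mul0e => h.
have /h : ereal_nbhs 0%E (fun u => u < e%:E)%E by apply: open_ereal_lt'; rewrite lte_fin.
by case=> N _ /(_ N (leqnn N)) /= /ltW hN; exists N.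
Qed.

Lemma simple_approx (b : R) f : strongly_measurable f -> (sq_norm_L2 `[0%R, b] f < +oo)%E ->
  forall e : R, 0 < e -> exists2 s, simple_map s & (sq_norm_L2 `[0%R, b] (fun t => (s t - f t)%R) <= e%:E)%E.
Proof.
move=> hf fi e e0; have [s hs cs] := hf.
have mI : measurable `[0, b]%classic by exact: measurable_itv.
(* Each [s n] is cut off where it exceeds [|f| + 1]. Pointwise convergence survives, and the squared
   error is at most [(2 |f| + 1)^2 <= 8 |f|^2 + 2], which is integrable. *)
pose A n : set R := half_line `&` [set t | nrm (s n t) <= nrm (f t) + 1].
have mA n : measurable (A n).
  apply: measurable_fun_le; first exact: half_line_measurable.
    exact: (sm_nrm (sm_simple (hs n))).
  by apply: measurable_funD; [exact: (sm_nrm hf)|exact: measurable_cst].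
have hr n : simple_map (restr (A n) (s n)) by exact: simple_restr.
have [|||n hn] := @sq_norm_dominated b (fun n => restr (A n) (s n)) f
    (fun t => 8 * nrm (f t) ^+ 2 + 2) (fun n => sm_simple (hr n)) hf _ _ _ e e0.
- apply: aeW => t /itv_half /[dup] Ht; rewrite half_lineE => t0.
  apply/cvg_nrmP => d d0; have /cvg_nrmP h := cs t t0.
  apply: filterS2 (h d d0) (h 1 ltr01) => n hd h1; rewrite /restr mem_set //.
  split=> //=; have := nrm_dist (s n t) (f t); rewrite ler_norml => /andP[_ h2].
  by rewrite -lerBlDl (le_trans h2) // ltW.
- have i1 : mu.-integrable `[0, b] (fun t => (nrm (f t) ^+ 2)%:E).
    apply/integrableP; split; first exact: (sm_sq mI (@itv_half R b) hf).
    under eq_integral do rewrite gee0_abs ?lee_fin ?sqr_ge0 //.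
    exact: fi.
  have i2 : mu.-integrable `[0, b] (EFin \o (fun _ : R => 2 : R)).
    by apply: wc_integrable; apply/wcP => t t0; exact: cvg_cst.
  have i3 := @integrableZl _ _ _ mu _ mI 8 _ i1.
  exact: (@integrableD _ _ _ mu _ mI _ _ i3 i2).
- move=> n t _; have k0 := nrm_ge0 (f t).
  have h : nrm (restr (A n) (s n) t) <= nrm (f t) + 1.
    by rewrite /restr; case: ifPn => [/set_mem[]//|_]; rewrite nrm0 addr_ge0.
  have h2 : nrm (restr (A n) (s n) t - f t) <= 2 * nrm (f t) + 1.
    by apply: le_trans (nrmB _ _) _; lra.
  apply: (@le_trans _ _ ((2 * nrm (f t) + 1) ^+ 2)).
    by rewrite lerXn2r ?nnegrE ?nrm_ge0 // addr_ge0 // mulr_ge0.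
  by have := sqr_ge0 (2 * nrm (f t) - 1); rewrite !expr2; nra.
by exists (restr (A n) (s n)).
Qed.

End DominatedApproximation.

(** * An algebra of exponential sums *)

Section Exponentials.
Context {R : realType}.

(** Exponents are positive because only positive [r] are known to lie in the resolvent set of a
    dissipative node. The span is closed under products but has no constants built in. *)
Inductive expsum : (R -> R) -> Prop :=
| expsum0 : expsum (fun=> 0)
| expsumS r c f : 0 < r -> expsum f -> expsum (fun t => c * expR (r * t) + f t).

Lemma expsum_exp r c : 0 < r -> expsum (fun t => c * expR (r * t)).
Proof.
move=> r0; have := expsumS c r0 expsum0.
by under [X in expsum X -> _]eq_fun do rewrite addr0.
Qed.

Lemma expsumD f g : expsum f -> expsum g -> expsum (fun t => f t + g t).
Proof.
elim=> [|r c {}f r0 _ IH] hg.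
  by under [X in expsum X]eq_fun do rewrite add0r.
under [X in expsum X]eq_fun do rewrite -addrA.
exact: (expsumS c r0 (IH hg)).
Qed.

Lemma expsum_mul1 s a f : 0 < s -> expsum f -> expsum (fun t => a * expR (s * t) * f t).
Proof.
move=> s0; elim=> [|r c {}f r0 _ IH].
  by under [X in expsum X]eq_fun do rewrite mulr0; exact: expsum0.
have -> : (fun t => a * expR (s * t) * (c * expR (r * t) + f t)) =
    (fun t => a * c * expR ((s + r) * t) + a * expR (s * t) * f t).
  by apply/funext => t; rewrite mulrDr [(s + r) * t]mulrDl expRD; ring.
by apply: expsumS => //; rewrite addr_gt0.
Qed.

Lemma expsumM f g : expsum f -> expsum g -> expsum (fun t => f t * g t).
Proof.
elim=> [|r c {}f r0 _ IH] hg.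
  by under [X in expsum X]eq_fun do rewrite mul0r; exact: expsum0.
under [X in expsum X]eq_fun do rewrite mulrDl.
by apply: expsumD; [exact: expsum_mul1|exact: IH].
Qed.

Lemma expsumN f : expsum f -> expsum (fun t => - f t).
Proof.
elim=> [|r c {}f r0 _ IH].
  by under [X in expsum X]eq_fun do rewrite oppr0; exact: expsum0.
under [X in expsum X]eq_fun do rewrite opprD -mulNr.
exact: (expsumS _ r0 IH).
Qed.

(* As N grows this tends to 0 for x < 1/2 and to 1 for 1/2 < x <= 1. *)
Definition threshold (N : nat) (x : R) : R := 1 - (1 - x ^+ N) ^+ (2 ^ N)%N.

(** With a positive exponent [N.+1] the threshold is a polynomial without constant term, so it stays
    in an algebra without unit. *)
Lemma expsum_threshold N f : expsum f -> expsum (fun t => threshold N.+1 (f t)).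
Proof.
move=> hf; rewrite /threshold; have hp : expsum (fun t => f t ^+ N.+1).
  elim: N => [|N IH]; first by under [X in expsum X]eq_fun do rewrite expr1.
  by under [X in expsum X]eq_fun do rewrite exprS; exact: expsumM.
elim: (2 ^ N.+1)%N => [|M IH].
  by under [X in expsum X]eq_fun do rewrite expr0 subrr; exact: expsum0.
have -> : (fun t => 1 - (1 - f t ^+ N.+1) ^+ M.+1) = (fun t =>
    (1 - (1 - f t ^+ N.+1) ^+ M) + (f t ^+ N.+1 + - (f t ^+ N.+1 * (1 - (1 - f t ^+ N.+1) ^+ M)))).
  by apply/funext => t; rewrite [_ ^+ M.+1]exprS; ring.
by apply: expsumD => //; apply: expsumD => //; apply/expsumN/expsumM.
Qed.

Lemma bernoulli_lower (y : R) M : 0 <= y <= 1 -> 1 - M%:R * y <= (1 - y) ^+ M.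
Proof.
move=> /andP[y0 y1]; elim: M => [|M IH]; first by rewrite mul0r subr0 expr0.
rewrite exprS; apply: (@le_trans _ _ ((1 - y) * (1 - M%:R * y))).
  by rewrite -natr1; have := mulr_ge0 (ler0n R M) (sqr_ge0 y); rewrite expr2; lra.
by rewrite ler_wpM2l // subr_ge0.
Qed.

Lemma bernoulli_upper (y : R) M : 0 <= y <= 1 -> (1 - y) ^+ M * (1 + M%:R * y) <= 1.
Proof.
move=> /andP[y0 y1]; elim: M => [|M IH]; first by rewrite mul0r addr0 expr0 mul1r.
apply: le_trans IH; rewrite exprSr -mulrA ler_wpM2l ?exprn_ge0 ?subr_ge0 //.
by rewrite -natr1; have := mulr_ge0 (ler0n R M) (sqr_ge0 y); have := sqr_ge0 y; rewrite expr2; lra.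
Qed.

Lemma threshold_bound N x : 0 <= x <= 1 -> 0 <= threshold N x <= 1.
Proof.
move=> /andP[x0 x1]; have y0 : 0 <= 1 - x ^+ N by rewrite subr_ge0 exprn_ile1.
rewrite /threshold subr_ge0 gerBl exprn_ge0 // andbT exprn_ile1 //.
by rewrite gerBl exprn_ge0.
Qed.

(** Bernoulli's inequality gives geometric rates: the error is at most [2^N x^N] below 1/2, and at
    most [1 / (1 + 2^N x^N)] above it. *)
Lemma threshold_cvg (x : R) : 0 <= x <= 1 -> x != 2^-1 ->
  threshold n x @[n --> \oo] --> ((2^-1 < x)%R%:R : R).
Proof.
move=> x01 xn; have /andP[x0 x1] := x01.
have y01 N : 0 <= x ^+ N <= 1 by rewrite exprn_ge0 //= exprn_ile1.
have [p [p0 p1 hp]] : exists p : R, [/\ 0 <= p, p < 1 &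
    forall N, `|(2^-1 < x)%R%:R - threshold N x| <= p ^+ N].
  have [h|h] := ltP 2^-1 x.
    exists (2 * x)^-1; split=> [||N].
    - by rewrite invr_ge0 mulr_ge0.
    - by rewrite invf_lt1; [lra|apply: mulr_gt0 => //; lra].
    have /andP[_ t1] := threshold_bound N x01.
    rewrite ger0_norm ?subr_ge0 // /threshold subKr exprVn.
    have q0 : 0 < (2 * x) ^+ N by rewrite exprn_gt0 // mulr_gt0 //; lra.
    rewrite -[leRHS]mul1r ler_pdivlMr //; apply: le_trans (bernoulli_upper (2 ^ N)%N (y01 N)).
    rewrite ler_wpM2l ?exprn_ge0 ?subr_ge0 //; first by case/andP: (y01 N).
    by rewrite natrX -exprMn lerDr.
  exists (2 * x); split=> [||N]; first by rewrite mulr_ge0.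
    by move: xn; rewrite neq_lt => /orP[|]; lra.
  have /andP[t0 _] := threshold_bound N x01.
  rewrite sub0r normrN ger0_norm // /threshold lerBlDr -lerBlDl.
  apply: le_trans (bernoulli_lower (2 ^ N)%N (y01 N)).
  by rewrite natrX -exprMn.
apply/cvgrPdist_lt => e e0.
have := @cvg_geometric R 1 p; rewrite ger0_norm // => /(_ p1)/cvgrPdist_lt/(_ e e0).
apply: filterS => N; rewrite /= mul1r sub0r normrN ger0_norm ?exprn_ge0 // => h.
exact: le_lt_trans (hp N) h.
Qed.

End Exponentials.

(** * Density of exponential sums in L2 of a bounded interval *)

Section ExponentialDensity.
Context {R : realType} {V : completeNormedModType R[i]}.
Implicit Types f g w : R -> V.
Local Notation mu := (@lebesgue_measure R).

Inductive vexpsum : (R -> V) -> Prop :=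
| vexpsum0 : vexpsum (fun=> 0)
| vexpsumS r c f : 0 < r -> vexpsum f -> vexpsum (fun t => vexp r c t + f t).

Lemma vexpsumD f g : vexpsum f -> vexpsum g -> vexpsum (fun t => f t + g t).
Proof.
elim=> [|r c {}f r0 _ IH] hg.
  by under [X in vexpsum X]eq_fun do rewrite add0r.
under [X in vexpsum X]eq_fun do rewrite -addrA.
exact: (vexpsumS c r0 (IH hg)).
Qed.

Lemma vexpsum_expsum (f : R -> R) (c : V) : expsum f -> vexpsum (fun t => (f t)%:C *: c).
Proof.
elim=> [|r a {}f r0 _ IH].
  by under [X in vexpsum X]eq_fun do rewrite scale0r; exact: vexpsum0.
have -> : (fun t => (a * expR (r * t) + f t)%:C *: c) = (fun t => vexp r (a%:C *: c) t + (f t)%:C *: c).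
  by apply/funext => t; rewrite /vexp scalerA -rmorphM mulrC rmorphD scalerDl.
exact: vexpsumS.
Qed.

Lemma vexpsum_C2 w : vexpsum w -> is_C2 w.
Proof.
elim=> [|r c f r0 _ IH]; first exact: C2_cst.
by apply: C2D => //; exact: C2_vexp.
Qed.

Lemma vexpsum_sm w : vexpsum w -> strongly_measurable w.
Proof. by move=> /vexpsum_C2[w' [w'' [h _]]]; exact/sm_wc/(C1_wc h). Qed.

Section Horizon.
Variable b : R.

Let mI : measurable `[0, b]%classic. Proof. exact: measurable_itv. Qed.
Let IH : `[0, b]%classic `<=` half_line := @itv_half R b.

Definition approximable f := strongly_measurable f /\ forall e : R, 0 < e ->
  exists2 w, vexpsum w & (sq_norm_L2 `[0%R, b] (fun t => (w t - f t)%R) <= e%:E)%E.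

Lemma approximable_vexpsum w : vexpsum w -> approximable w.
Proof.
move=> hw; split=> [|e e0]; first exact: vexpsum_sm.
exists w => //; rewrite (@sq_norm_ext _ _ _ _ (fun=> 0)) => [|t _]; last exact: subrr.
rewrite /sq_norm_L2 nrm0 expr0n integral_cst // mul0e lee_fin; exact: ltW.
Qed.

Lemma approximable_lim f : strongly_measurable f ->
  (forall e : R, 0 < e -> exists2 g, approximable g &
     (sq_norm_L2 `[0%R, b] (fun t => (g t - f t)%R) <= e%:E)%E) -> approximable f.
Proof.
move=> hf h; split=> // e e0; have e4 : 0 < e / 4 by rewrite divr_gt0.
have [g [hg ag] gf] := h _ e4; have [w hw wg] := ag _ e4; exists w => //.
apply: le_trans (sq_norm_triangle mI IH (vexpsum_sm hw) hf hg) _.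
apply: (@le_trans _ _ (2%:E * ((e / 4)%:E + (e / 4)%:E))%E).
  by apply: lee_wpmul2l; [rewrite lee_fin|exact: leeD].
by rewrite -EFinD -EFinM lee_fin; lra.
Qed.

Lemma approximable_ext f g : strongly_measurable g -> (forall t, 0 <= t <= b -> f t = g t) ->
  approximable f -> approximable g.
Proof.
move=> hg fg [hf h]; split=> // e e0; have [w hw hwf] := h e e0; exists w => //.
rewrite (@sq_norm_ext _ _ _ _ (fun t => w t - f t)) // => t /=.
by rewrite in_itv /= => /fg ->.
Qed.

Lemma approximableD f g : approximable f -> approximable g -> approximable (fun t => f t + g t).
Proof.
move=> [hf af] [hg ag]; split=> [|e e0]; first exact: smD.
have e4 : 0 < e / 4 by rewrite divr_gt0.
have [v hv vf] := af _ e4; have [w hw wg] := ag _ e4.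
exists (fun t => v t + w t); first exact: vexpsumD.
have := sq_norm_D mI IH (smB (vexpsum_sm hv) hf) (smB (vexpsum_sm hw) hg).
rewrite (@sq_norm_ext _ _ _ _ (fun t => v t + w t - (f t + g t))) => [h|t _]; last first.
  by rewrite opprD addrACA.
apply: le_trans h _; apply: (@le_trans _ _ (2%:E * ((e / 4)%:E + (e / 4)%:E))%E).
  by apply: lee_wpmul2l; [rewrite lee_fin|exact: leeD].
by rewrite -EFinD -EFinM lee_fin; lra.
Qed.

Let sm_set (A : set R) (c : V) : measurable A -> strongly_measurable (restr A (fun=> c)).
Proof. by move=> mA; apply/sm_restr/sm_simple/simple_cst. Qed.

Let bounded_lim (f_ : nat -> R -> V) f (C : R) : (forall n, approximable (f_ n)) ->
  strongly_measurable f ->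
  {ae mu, forall t, `[0, b]%classic t -> f_ n t @[n --> \oo] --> f t} ->
  (forall n t, 0 <= t <= b -> nrm (f_ n t - f t) <= C) -> approximable f.
Proof.
move=> af hf cf fC; apply: approximable_lim => // e e0.
have [|n t It|n hn] := @sq_norm_dominated _ _ b f_ f (fun=> C ^+ 2) (fun n => proj1 (af n)) hf cf _ _ e e0.
- by apply: wc_integrable; apply/wcP => t t0; exact: cvg_cst.
- move: It; rewrite /= in_itv /= => /fC h.
  by have hn := h n; rewrite lerXn2r ?nnegrE ?nrm_ge0 // (le_trans (nrm_ge0 _) hn).
by exists (f_ n).
Qed.

Lemma approximable_ray a (c : V) : approximable (restr `]a, +oo[%classic (fun=> c)).
Proof.
have mA : measurable (`]a, +oo[%classic : set R) by exact: measurable_itv.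
have [ab|ba] := ltP a b; last first.
  apply: (approximable_ext (sm_set c mA) _ (approximable_vexpsum vexpsum0)) => t /andP[_ tb].
  by rewrite /restr memNset //= in_itv /= andbT => /(le_lt_trans ba); rewrite ltNge tb.
(* A single exponential that equals 1/2 at [a] and 1 at [b]; its thresholds tend to the indicator of
   the ray except at the one point [a]. *)
pose r := ln 2 / (b - a); pose x t := 2^-1 * expR (r * (t - a)).
have r0 : 0 < r by rewrite divr_gt0 ?subr_gt0 // ln_gt0 // ltr1n.
have x0 t : 0 <= x t by rewrite mulr_ge0 ?expR_ge0.
have xE t : (2^-1 < x t) = (a < t).
  by rewrite /x ltr_pMr // -expR0 ltr_expR pmulr_rgt0 // subr_gt0.
have x1 t : t <= b -> x t <= 1.
  move=> tb; rewrite /x ler_pdivrMl // mulr1 -[leRHS]lnK ?posrE // ler_expR.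
  by rewrite /r mulrAC ler_pdivrMr ?subr_gt0 // ler_wpM2l ?lerD2r // ltW // ln_gt0 // ltr1n.
have ex : expsum x.
  have -> : x = (fun t => 2^-1 * expR (- (r * a)) * expR (r * t)).
    by apply/funext => t; rewrite /x mulrBr expRD; ring.
  exact: expsum_exp.
have af n : approximable (fun t => (threshold n.+1 (x t))%:C *: c).
  exact/approximable_vexpsum/vexpsum_expsum/expsum_threshold.
apply: (bounded_lim (C := nrm c) af (sm_set c mA)).
- exists [set a]; split; [exact: measurable_set1|exact: lebesgue_measure_set1|].
  move=> t /= /not_implyP[+ h]; rewrite in_itv /= => /andP[t0 tb].
  apply: contrapT => /eqP ta; apply: h.
  have xn : x t != 2^-1.
    have h2 : (2^-1 : R) != 0 by rewrite invr_neq0.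
    apply/eqP; rewrite /x -[RHS]mulr1 => /(mulfI h2); rewrite -expR0 => /expR_inj/eqP.
    by rewrite mulf_eq0 (gt_eqF r0) /= subr_eq0; exact/negP.
  have := @threshold_cvg R (x t); rewrite x0 x1 // xE => /(_ isT xn) h.
  have -> : restr `]a, +oo[%classic (fun=> c) t = ((a < t)%R%:R : R)%:C *: c.
    by rewrite /restr; case: ifPn; [rewrite inE|rewrite notin_setE];
       rewrite /= in_itv /= andbT; [move=> ->; rewrite scale1r|move=> /negP/negbTE ->; rewrite scale0r].
  have {}h : threshold n.+1 (x t) @[n --> \oo] --> ((a < t)%R%:R : R).
    by have := h; rewrite -(cvg_shiftS (fun n => threshold n (x t))).
  apply/cvg_nrmP => e e0; have c0 : 0 < nrm c + 1 by rewrite ltr_pwDr ?nrm_ge0.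
  move/cvgrPdist_lt : h => /(_ (e / (nrm c + 1)) (divr_gt0 e0 c0)).
  apply: filterS => n hn; rewrite -scalerBl -rmorphB nrmZR distrC.
  move: hn; rewrite ltr_pdivlMr //; apply: le_lt_trans.
  by rewrite ler_wpM2l // lerDl.
move=> n t /andP[t0 tb].
have := @threshold_bound R n.+1 (x t); rewrite x0 x1 // => /(_ isT)/andP[q0 q1].
rewrite /restr; case: ifP => _; last by rewrite subr0 nrmZR ger0_norm // ler_piMl ?nrm_ge0.
rewrite -[X in _ - X]scale1r -scalerBl -[X in _ - X](rmorph1 (real_complex R)) -rmorphB nrmZR.
by rewrite ler_piMl ?nrm_ge0 // distrC ger0_norm ?subr_ge0 // gerBl.
Qed.

(** Dynkin's argument: the rays are stable under intersection and generate the Borel sets, and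
    approximable sets are stable under complements and disjoint countable unions. *)
Lemma approximable_set (A : set R) : measurable A -> forall c, approximable (restr A (fun=> c)).
Proof.
have hU (A1 A2 : set R) : A1 `&` A2 `<=` set0 ->
    (forall c, approximable (restr A1 (fun=> c))) ->
    (forall c, approximable (restr A2 (fun=> c))) ->
    forall c, approximable (restr (A1 `|` A2) (fun=> c)).
  move=> dA hA1 hA2 c.
  have -> : restr (A1 `|` A2) (fun=> c) = fun t => restr A1 (fun=> c) t + restr A2 (fun=> c) t.
    apply/funext => t; rewrite /restr in_setU.
    case: (boolP (t \in A1)) => t1; case: (boolP (t \in A2)) => t2 /=; rewrite ?addr0 ?add0r //.
    by case: (dA t); split; exact: set_mem.
  exact: approximableD.
(* Constants are not exponential sums, but on [[0, b]] they coincide with a ray that starts before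
   0. *)
have hT c : approximable (restr setT (fun=> c)).
  apply: approximable_ext (approximable_ray (-1) c); first exact: sm_set.
  move=> t /andP[t0 _]; rewrite /restr !mem_set //= in_itv /= andbT.
  by apply: lt_le_trans t0; rewrite ltrN10.
(* Quantifying over [c] lets the complement be treated by adding the set with value [- c]. *)
move=> mA; pose P (B : set R) := forall c, approximable (restr B (fun=> c)).
apply: (@dynkin_induction _ (measurableTypeR R) (@RGenOInfty.G R) P _ _ _ _ _ _ A) => //.
- exact: RGenOInfty.measurableE.
- move=> _ _ [x ->] [y ->]; exists (Num.max x y).
  by apply/seteqP; split=> t /=; rewrite !in_itv /= !andbT gt_max => /andP.
- by move=> _ [x ->] c; exact: approximable_ray.
- move=> S mS hS c.
  have -> : restr (~` S) (fun=> c) = fun t => restr setT (fun=> c) t + restr S (fun=> - c) t.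
    apply/funext => t; rewrite /restr in_setC in_setT.
    by case: (t \in S) => /=; rewrite ?addr0 ?subrr.
  by apply: approximableD.
- move=> F mF tF hF c.
  pose B n := \big[setU/set0]_(k < n) F k.
  have mB n : measurable (B n) by apply: bigsetU_measurable => i _; exact: mF.
  have hB n : approximable (restr (B n) (fun=> c)).
    elim: n c => [|n IHn] c.
      rewrite /B big_ord0 (_ : restr set0 _ = fun=> 0); first exact/approximable_vexpsum/vexpsum0.
      by apply/funext => t; rewrite /restr in_set0.
    rewrite /B big_ord_recr /=; apply: hU => [t []||]; [|exact: IHn|exact: hF].
    rewrite -bigcup_mkord => -[k /= kn Fk] Fn.
    have := tF k n I I; move=> h; move: kn; rewrite h ?ltnn //.
    by exists t.
  apply: (bounded_lim (C := nrm c) hB).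
  - by apply: sm_set; apply: bigcup_measurable => k _; exact: mF.
    apply: aeW => t _; apply/cvg_nrmP => e e0.
    have [Ft|nF] := pselect ((\bigcup_k F k) t).
      have [k _ Fk] := Ft; exists k.+1 => // n /= kn.
      by rewrite /restr !mem_set ?subrr ?nrm0 // /B -bigcup_mkord; exists k.
    apply: nearW => n; rewrite /restr !memNset ?subrr ?nrm0 //.
    by rewrite /B -bigcup_mkord => -[k _ Fk]; apply: nF; exists k.
  move=> n t _; rewrite /restr; case: ifPn => [/set_mem|_].
    rewrite /B -bigcup_mkord => -[k _ Fk]; rewrite mem_set ?subrr ?nrm0 ?nrm_ge0 //.
    by exists k.
  by case: ifP => _; rewrite sub0r nrmN ?nrm0 ?nrm_ge0.
- by have := congr1 (fun T => T A) (RGenOInfty.measurableE R); rewrite /measurable /= => <-.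
Qed.

Lemma approximable_simple s : simple_map s -> approximable s.
Proof.
move=> hs; have /finite_seqP[r rE] := proj1 hs.
have key (l : seq V) : approximable (fun t => if s t \in l then s t else 0).
  elim: l => [|c l IHl].
    exact: (approximable_vexpsum vexpsum0).
  (* A value listed twice must not be added a second time. *)
  have [cl|cl] := boolP (c \in l).
    under [X in approximable X]eq_fun do rewrite in_cons.
    have -> : (fun t => if (s t == c) || (s t \in l) then s t else 0) =
        (fun t => if s t \in l then s t else 0); last exact: IHl.
    by apply/funext => t; case: eqP => [->|//]; rewrite cl.
  have -> : (fun t => if s t \in c :: l then s t else 0) =
      (fun t => restr (s @^-1` [set c]) (fun=> c) t + (if s t \in l then s t else 0)).
    apply/funext => t; rewrite /restr in_cons; case: eqP => [e|ne] /=.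
      by rewrite mem_set // e (negbTE cl) addr0.
    by rewrite memNset // add0r.
  by apply: approximableD => //; apply: approximable_set; exact: (proj2 hs).
apply: (approximable_ext (sm_simple hs) _ (key r)) => t _.
have : range s (s t) by exists t.
by rewrite rE /= => ->.
Qed.

Lemma approximable_L2 f : strongly_measurable f -> (sq_norm_L2 `[0%R, b] f < +oo)%E ->
  approximable f.
Proof.
move=> hf fi; apply: approximable_lim => // e e0.
have [s hs sf] := simple_approx hf fi e0.
by exists s => //; exact: approximable_simple.
Qed.

End Horizon.

End ExponentialDensity.

(** * Completeness of L2 on growing intervals *)

Section L2Completeness.
Context {R : realType} {V : completeNormedModType R[i]}.
Local Notation mu := (@lebesgue_measure R).

(** The rank [N] is kept explicit because at time [t] the increments are controlled only from the
    horizons [m >= t] on. *)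
Lemma halving_cvg (u : nat -> V) (a : R) (N : nat) :
  (forall m, (N <= m)%N -> nrm (u m.+1 - u m) <= a * 2^-1 ^+ m) ->
  exists l : V, u m @[m --> \oo] --> l /\
    forall m, (N <= m)%N -> nrm (u m - l) <= 2 * a * 2^-1 ^+ m.
Proof.
move=> h; have hq m : 0 < (2^-1 : R) ^+ m by rewrite exprn_gt0 // invr_gt0.
have a0 : 0 <= a.
  by have := le_trans (nrm_ge0 _) (h N (leqnn N)); rewrite pmulr_lge0.
have hk m k : (N <= m)%N -> nrm (u (m + k)%N - u m) <= 2 * a * 2^-1 ^+ m.
  move=> Nm; suff : nrm (u (m + k)%N - u m) <= 2 * a * 2^-1 ^+ m * (1 - 2^-1 ^+ k).
    move=> /le_trans; apply; rewrite ler_piMr ?gerBl ?(ltW (hq k)) //.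
    by rewrite mulr_ge0 ?(ltW (hq m)) // mulr_ge0.
  elim: k => [|k IH]; first by rewrite addn0 subrr nrm0 expr0 subrr mulr0.
  apply: le_trans (nrm_triangle (u (m + k)%N) _ _) _; rewrite addnS.
  apply: le_trans (lerD (h _ (leq_trans Nm (leq_addr k m))) IH) _.
  by rewrite exprD exprS; move: (_ ^+ m) (_ ^+ k) => p q; lra.
have cE : 2 * a * 2^-1 ^+ m @[m --> \oo] --> (0 : R).
  rewrite -[X in _ --> X](mulr0 (2 * a)); apply: cvgMl_tmp.
  by apply: cvg_expr; rewrite ger0_norm ?invr_ge0 // invf_lt1 // ltr1n.
have [l hl] : exists l : V, u (n + N)%N @[n --> \oo] --> l.
  apply: (@cauchy_seq_cvg _ _ _ (fun n => 2 * a * 2^-1 ^+ (n + N))).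
    by have := cE; rewrite -(cvg_shiftn N).
  by move=> n k; rewrite addnAC; apply: hk; rewrite leq_addl.
have {}hl : u m @[m --> \oo] --> l by rewrite -(cvg_shiftn N).
exists l; split=> // m Nm; rewrite nrm_sym.
have c : nrm (u n - u m) @[n --> \oo] --> nrm (l - u m).
  by apply: cvg_nrm; apply: cvgB => //; exact: cvg_cst.
apply: (cvgr_to_le c); exists m => // n /= mn.
by rewrite -(subnKC mn); exact: hk.
Qed.

Lemma cvge0_le (u : nat -> \bar R) (v : nat -> R) : v n @[n --> \oo] --> (0 : R) ->
  (\forall n \near \oo, (0 <= u n <= (v n)%:E)%E) -> u n @[n --> \oo] --> 0%E.
Proof.
move=> v0 h; apply: (@squeeze_cvge _ _ _ _ (cst 0%E) u (EFin \o v) h).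
  exact: cvg_cst.
by apply: cvg_EFin => //; exact: nearW.
Qed.

Lemma sq_norm_half (f : R -> V) (M : R) : strongly_measurable f ->
  (forall n : nat, sq_norm_L2 `[0%R, n%:R] f <= M%:E)%E -> (sq_norm_L2 half_line f <= M%:E)%E.
Proof.
move=> hf h; pose I (n : nat) : set R := `[0, n%:R]%classic.
have mI n : measurable (I n) by exact: measurable_itv.
have IH n : I n `<=` half_line by exact: itv_half.
have mH := @half_line_measurable R.
pose g n t : \bar R := (nrm (restr (I n) f t) ^+ 2)%:E.
have mg n : measurable_fun half_line (g n).
  exact: (sm_sq mH (@subset_refl _ _) (sm_restr (mI n) hf)).
have H := @cvg_monotone_convergence _ _ _ mu half_line mH g mg _ _.
have {}H : (\int[mu]_(t in half_line) g n t)%E @[n --> \oo] --> sq_norm_L2 half_line f.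
  have -> : sq_norm_L2 half_line f = (\int[mu]_(t in half_line) limn (g^~ t))%E.
    apply: eq_integral => t /set_mem; rewrite half_lineE => t0; apply/esym/cvg_lim => //.
    apply: cvg_near_cst; near=> n; rewrite /g /restr mem_set // /I /= in_itv /= t0.
    by near: n; exact: nbhs_infty_ger.
  apply: H => [n t _|t _ m n mn]; first by rewrite lee_fin sqr_ge0.
  rewrite lee_fin lerXn2r ?nnegrE ?nrm_ge0 // /restr.
  case: ifPn => [/set_mem|_]; last by rewrite nrm0 nrm_ge0.
  rewrite /I /= in_itv /= => /andP[t0 tm]; rewrite mem_set // /I /= in_itv /= t0.
  by apply: le_trans tm _; rewrite ler_nat.
apply: (cvge_to_le H); apply: nearW => n.
by have := sq_norm_restr f (IH n); rewrite {1}/sq_norm_L2 => ->; exact: h.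
Unshelve. all: by end_near.
Qed.

Section RieszFischer.
Variables (y_ : nat -> R -> V) (C : R).
Hypothesis C0 : 0 <= C.
Hypothesis sm_y : forall n, strongly_measurable (y_ n).
Hypothesis fin_y : forall n (b : R), (sq_norm_L2 `[0%R, b] (y_ n) < +oo)%E.
Hypothesis cauchy_y : forall n : nat,
  (sq_norm_L2 `[0%R, n%:R] (fun t => (y_ n.+1 t - y_ n t)%R) <= (C * 16^-1 ^+ n)%:E)%E.

Let mI (b : R) : measurable `[0, b]%classic. Proof. exact: measurable_itv. Qed.
Let IH (b : R) : `[0, b]%classic `<=` half_line := @itv_half R b.
Let mH := @half_line_measurable R.

(** The weights explain the rate [16^-n]: the series of [4^n |d_n|^2] still has a finite integral,
    and where it converges the increments decay like [2^-n]. *)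
Lemma riesz_fischer : exists2 y : R -> V, strongly_measurable y &
  forall t : R, 0 <= t -> sq_norm_L2 `[0%R, t] (fun s => (y_ n s - y s)%R) @[n --> \oo] --> 0%E.
Proof.
have h16 n : 0 < (16^-1 : R) ^+ n by rewrite exprn_gt0 // invr_gt0.
have h4 n : 0 < (4^-1 : R) ^+ n by rewrite exprn_gt0 // invr_gt0.
(* The simple functions s n replace y_ n, since a pointwise limit of simple
   functions is measurable by definition. *)
have /choice[s hs] : forall n : nat, exists s, simple_map s /\
    (sq_norm_L2 `[0%R, n%:R] (fun t => (s t - y_ n t)%R) <= (16^-1 ^+ n)%:E)%E.
  by move=> n; have [s ss h] := simple_approx (sm_y n) (fin_y n n%:R) (h16 n); exists s.
have sms n := sm_simple (proj1 (hs n)).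
have smd n : strongly_measurable (fun t => s n.+1 t - s n t) by exact: smB.
pose J (n : nat) : set R := `[0, n%:R]%classic.
pose d n := restr (J n) (fun t => s n.+1 t - s n t).
have sd n : strongly_measurable (d n) by exact: (sm_restr (mI _) (smd n)).
pose D := 4 * C + 6; have D0 : 0 <= D by rewrite addr_ge0 // mulr_ge0.
have hd n : (sq_norm_L2 half_line (d n) <= (D * 16^-1 ^+ n)%:E)%E.
  rewrite sq_norm_restr; last exact: IH.
  apply: le_trans (sq_norm_triangle (mI _) (@IH _) (sms n.+1) (sms n) (sm_y n.+1)) _.
  have h1 : (sq_norm_L2 `[0%R, n%:R] (fun t => (s n.+1 t - y_ n.+1 t)%R) <= (16^-1 ^+ n)%:E)%E.
    have nn : n%:R <= n.+1%:R :> R by rewrite ler_nat.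
    apply: le_trans (sq_norm_itv_mono nn (smB (sms n.+1) (sm_y n.+1))) _.
    apply: le_trans (proj2 (hs n.+1)) _; rewrite lee_fin exprS.
    by rewrite ler_piMl ?(ltW (h16 n)) // invf_le1 // ler1n.
  have h2 : (sq_norm_L2 `[0%R, n%:R] (fun t => (y_ n.+1 t - s n t)%R) <=
      2%:E * ((C * 16^-1 ^+ n)%:E + (16^-1 ^+ n)%:E))%E.
    apply: le_trans (sq_norm_triangle (mI _) (@IH _) (sm_y n.+1) (sms n) (sm_y n)) _.
    apply: lee_wpmul2l; first by rewrite lee_fin.
    by apply: leeD => //; rewrite sq_norm_sym; exact: (proj2 (hs n)).
  apply: (@le_trans _ _ (2%:E * ((16^-1 ^+ n)%:E + 2%:E * ((C * 16^-1 ^+ n)%:E + (16^-1 ^+ n)%:E)))%E).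
    by apply: lee_wpmul2l; [rewrite lee_fin|exact: leeD].
  move: (_ ^+ n) => p; rewrite /D -[X in (X <= _)%E]/(2 * (p + 2 * (C * p + p)))%:E lee_fin; lra.
pose g n t : \bar R := ((4 ^+ n)%:E * (nrm (d n t) ^+ 2)%:E)%E.
have g0 n t : (0 <= g n t)%E by rewrite mule_ge0 // lee_fin exprn_ge0 // nrm_ge0.
have mg n : measurable_fun half_line (g n).
  by apply: measurable_funeM; exact: (sm_sq mH (@subset_refl _ _) (sd n)).
pose G t := (\sum_(0 <= n <oo) g n t)%E.
have mG : measurable_fun half_line G.
  by apply: ge0_emeasurable_sum => [n t _ _|n _]; [exact: g0|exact: mg].
have G0 t : (0 <= G t)%E by apply: nneseries_ge0 => n _ _; exact: g0.
have intG : (\int[mu]_(t in half_line) G t <= (2 * D)%:E)%E.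
  rewrite integral_nneseries //.
  apply: le_trans (epsilon_trick0 xpredT _); last by rewrite mulr_ge0.
  apply: lee_nneseries => [n _ _|n _]; first by apply: integral_ge0.
  rewrite ge0_integralZl_EFin ?exprn_ge0 //; last first.
  - exact: (sm_sq mH (@subset_refl _ _) (sd n)).
  - by move=> t _; rewrite lee_fin sqr_ge0.
  apply: le_trans (lee_wpmul2l _ (hd n)) _; first by rewrite lee_fin exprn_ge0.
  have -> : 2 * D / (2 ^ n.+1)%:R = D * 2^-1 ^+ n.
    by rewrite natrX exprS exprVn; field; rewrite expf_neq0.
  rewrite -EFinM lee_fin mulrCA ler_wpM2l // -exprMn.
  by rewrite lerXn2r ?nnegrE ?mulr_ge0 ?invr_ge0 //; lra.
pose Conv : set R := half_line `&` [set t | (G t < +oo)%E].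
have mConv : measurable Conv.
  by apply: emeasurable_fun_infty_o.
have step t : Conv t -> forall m, t <= m%:R ->
    nrm (s m.+1 t - s m t) <= Num.sqrt (fine (G t)) * 2^-1 ^+ m.
  move=> [t0 Gt] m tm; have Gf : G t \is a fin_num by rewrite ge0_fin_numE.
  have : (g m t <= G t)%E.
    apply: le_trans (nneseries_lim_ge m.+1 _); last by move=> n _ _; exact: g0.
    by rewrite big_nat_recr //= leeDr // sume_ge0.
  rewrite -(fineK Gf) /g -EFinM lee_fin /d /restr mem_set; last first.
    by move: t0; rewrite half_lineE /J /= in_itv /= tm => ->.
  move=> h; have p2 : (4 : R) ^+ m = (2 ^+ m) ^+ 2 by rewrite -exprM mulnC exprM expr2; congr (_ ^+ m); ring.
  rewrite exprVn ler_pdivlMr ?exprn_gt0 // -(ger0_norm (nrm_ge0 _)).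
  rewrite -(@ger0_norm _ (2 ^+ m)) ?exprn_ge0 // -normrM -sqrtr_sqr ler_wsqrtr //.
  by rewrite exprMn -p2 mulrC.
(* The default 0 off [Conv] matches [restr Conv (s n)], so that [y] is a limit of simple functions
   at every point. *)
have /choice[y hy] : forall t, exists l : V,
    (Conv t -> s n t @[n --> \oo] --> l /\ forall m, t <= m%:R ->
      nrm (s m t - l) <= 2 * Num.sqrt (fine (G t)) * 2^-1 ^+ m) /\ (~ Conv t -> l = 0).
  move=> t; have [ct|nc] := pselect (Conv t); last by exists 0.
  have t0 : 0 <= t by rewrite -half_lineE; case: ct.
  have key N : t <= N%:R -> exists l : V, s m t @[m --> \oo] --> l /\
      forall m, (N <= m)%N -> nrm (s m t - l) <= 2 * Num.sqrt (fine (G t)) * 2^-1 ^+ m.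
    move=> tN; apply: halving_cvg => m Nm; apply: step => //.
    by apply: le_trans tN _; rewrite ler_nat.
  have [l [hl _]] := key _ (ltW (archi_boundP t0)).
  exists l; split=> // _; split=> // m /key[l' [hl' /(_ m (leqnn m))]].
  by rewrite (cvg_unique (@norm_hausdorff _ V) hl hl').
have smy : strongly_measurable y.
  exists (fun n => restr Conv (s n)) => [n|t t0]; first exact: (simple_restr mConv (proj1 (hs n))).
  rewrite /restr; have [ct|nc] := pselect (Conv t).
    by rewrite mem_set //; have [/(_ ct)[]] := hy t.
  by rewrite memNset //; have [_ ->] := hy t; [exact: cvg_cst|].
exists y => // t t0; pose c := 2 + 32 * D.
apply: (@cvge0_le _ (fun n => c * 4^-1 ^+ n)).
  rewrite -[X in _ --> X](mulr0 c); apply: cvgMl_tmp.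
  by apply: cvg_expr; rewrite ger0_norm ?invr_ge0 // invf_lt1 // ltr1n.
near=> n; have tn : t <= n%:R by near: n; exact: nbhs_infty_ger.
rewrite sq_norm_L2_ge0 /=.
have smd' : strongly_measurable (fun t => y_ n t - y t) by exact: smB.
apply: le_trans (sq_norm_itv_mono tn smd') _.
apply: le_trans (sq_norm_triangle (mI _) (@IH _) (sm_y n) smy (sms n)) _.
have h1 : (sq_norm_L2 `[0%R, n%:R] (fun r => (y_ n r - s n r)%R) <= (4^-1 ^+ n)%:E)%E.
  rewrite sq_norm_sym; apply: le_trans (proj2 (hs n)) _.
  by rewrite lee_fin lerXn2r ?nnegrE ?invr_ge0 // lef_pV2 ?posrE // ler_nat.
have h2 : (sq_norm_L2 `[0%R, n%:R] (fun r => (s n r - y r)%R) <= (16 * D * 4^-1 ^+ n)%:E)%E.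
  have q0 : 0 < 4 * (4^-1 : R) ^+ n by rewrite mulr_gt0.
  have mGn : measurable_fun (J n) G by exact: measurable_funS mH (@IH _) mG.
  apply: (@le_trans _ _ (\int[mu]_(r in `[0%R, n%:R]) ((4 * 4^-1 ^+ n)%:E * G r))%E).
    apply: ge0_le_integral => //.
    - by move=> r _; rewrite lee_fin sqr_ge0.
    - exact: (sm_sq (mI _) (@IH _) (smB (sms n) smy)).
    - exact: measurable_funeM.
    move=> r /[dup] /IH Hr; rewrite /= in_itv /= => /andP[_ rn].
    (* Where [G] is infinite the bound is trivial; the exceptional set thus needs no separate
       treatment as a null set. *)
    have [cr|nc] := pselect (Conv r); last first.
      have -> : G r = +oo%E.
        by apply/eqP; rewrite -leye_eq leNgt; apply/negP => Gr; apply: nc.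
      by rewrite gt0_muley ?lte_fin // leey.
    have [/(_ cr)[_ /(_ n rn) h] _] := hy r.
    have Gf : G r \is a fin_num by rewrite ge0_fin_numE //; case: cr.
    rewrite -(fineK Gf) -EFinM lee_fin.
    apply: (@le_trans _ _ ((2 * Num.sqrt (fine (G r)) * 2^-1 ^+ n) ^+ 2)).
      rewrite lerXn2r ?nnegrE ?nrm_ge0 // !mulr_ge0 ?sqrtr_ge0 ?exprn_ge0 ?invr_ge0 //.
    rewrite !exprMn sqr_sqrtr ?fine_ge0 // -exprM mulnC exprM.
    have -> : (2^-1 : R) ^+ 2 = 4^-1 by rewrite exprVn; congr (_^-1); ring.
    by rewrite le_eqVlt; apply/orP; left; apply/eqP; ring.
  rewrite ge0_integralZl_EFin ?(ltW q0) //.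
  apply: (@le_trans _ _ ((4 * 4^-1 ^+ n)%:E * (2 * D)%:E)%E).
    apply: lee_wpmul2l; first by rewrite lee_fin ltW.
    by apply: le_trans intG; apply: ge0_subset_integral.
  rewrite -EFinM lee_fin; have := mulr_ge0 D0 (ltW (h4 n)); move: (_ ^+ n) => p; lra.
apply: (@le_trans _ _ (2%:E * ((4^-1 ^+ n)%:E + (16 * D * 4^-1 ^+ n)%:E))%E).
  by apply: lee_wpmul2l; [rewrite lee_fin|exact: leeD].
by rewrite -EFinD -EFinM lee_fin /c; move: (_ ^+ n) => p; lra.
Unshelve. all: by end_near.
Qed.

End RieszFischer.

End L2Completeness.

(** * Stability *)

Section Stability.
Context {R : realType} {U X Y : hilbertType R} (S : sysnode U X Y) (a b : R).
Hypothesis a0 : 0 <= a.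
Hypothesis b0 : 0 < b.
Hypothesis diss : forall x v z y, node S x v z y ->
  2 * re_inner x z <= a * nrm v ^+ 2 - b * nrm y ^+ 2.
Local Notation A := (opA S).
Local Notation T := (semigroup S).

Let gen := opA_generates S.
Let mI (t : R) : measurable `[0, t]%classic. Proof. exact: measurable_itv. Qed.
Let IH (t : R) : `[0, t]%classic `<=` half_line := @itv_half R t.

Lemma C1Z (V : completeNormedModType R[i]) (c : R[i]) (f f' : R -> V) : is_C1 f f' ->
  is_C1 (fun t => c *: f t) (fun t => c *: f' t).
Proof.
move=> [h k]; split=> [t t0|]; last exact: wcZ.
exact: (has_deriv_lin (bounded_linearZ c (bounded_linear_id V)) (h t t0)).
Qed.

Lemma C1B (V : completeNormedModType R[i]) (f f' g g' : R -> V) : is_C1 f f' -> is_C1 g g' ->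
  is_C1 (fun t => f t - g t) (fun t => f' t - g' t).
Proof.
move=> hf /(C1Z (-1)) hg; have := C1D hf hg.
by under eq_fun do rewrite scaleN1r; under [X in is_C1 _ X -> _]eq_fun do rewrite scaleN1r.
Qed.

Lemma node_energy_le v z z' y (t p q : R) : {within half_line, continuous v} -> is_C1 z z' ->
  (forall s : R, 0 <= s -> node S (z s) (v s) (z' s) (y s)) -> 0 <= t ->
  nrm (z 0) ^+ 2 <= p -> (sq_norm_L2 `[0%R, t] v <= q%:E)%E ->
  nrm (z t) ^+ 2 <= p + a * q /\ (sq_norm_L2 `[0%R, t] y <= ((p + a * q) / b)%:E)%E.
Proof.
move=> cv C1z hn t0 hp; have cy := node_wc (C1_wc C1z) cv (proj2 C1z) hn.
have := node_energy diss cv C1z hn t0; have := sq_norm_L2_ge0 `[0, t]%classic y.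
rewrite (sq_norm_L2_wc t cv) (sq_norm_L2_wc t cy) -!EFinM -!EFinD !lee_fin.
move: (\int[_]_(_ in _) _) (\int[_]_(_ in _) _) => i j i0 h1 /(ler_wpM2l a0) h2.
have i0' := mulr_ge0 (ltW b0) i0; have z0 := sqr_ge0 (nrm (z t)).
by rewrite ler_pdivlMr // [j * b]mulrC; split; lra.
Qed.

(** [g] is the sum of the [H_{r_j} c_j]. The compatible initial states contain [g + dom A], which is
    dense, so the input can be fixed first and the initial state approximated afterwards. *)
Lemma vexpsum_trajectory w : vexpsum w -> exists g : X, forall x, dom A x ->
  exists z z' y, [/\ is_C1 z z', z 0 = g + x &
    forall t : R, 0 <= t -> node S (z t) (w t) (z' t) (y t)].
Proof.
elim=> [|r c f r0 _ [g hg]].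
  exists 0 => x Dx; exists (T^~ x), (fun t => T t (A x)), (fun t => opC S (T t x)).
  split; [exact: C1_semigroup|by rewrite (sg0 gen) add0r|move=> t t0].
  by have [D <-] := sg_dom gen t0 Dx; exact: node_dom.
exists (input_map S r%:C c + g) => x /hg[z [z' [y [C1z z_0 hn]]]].
have [D0 _] := dom_closed gen.
have [_ [C1e he]] := exp_trajectory c (real_rho b0 diss r0) D0.
exists (fun t => vexp r (input_map S r%:C c) t + T t 0 + z t), (fun t =>
  vexp r (r%:C *: input_map S r%:C c) t + T t (A 0) + z' t), (fun t =>
  vexp r (transfer S r%:C c) t + opC S (T t 0) + y t); split.
- exact: C1D.
- by rewrite z_0 (sg0 gen) addr0 /vexp mulr0 expR0 scale1r addrA.
- by move=> t t0; have := node_lin 1 (he t t0) (hn t t0); rewrite !scale1r.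
Qed.

Section Input.
Variables (z0 : X) (v : R -> U).
Hypothesis hv : in_L2 v.

Lemma approximating_trajectories : exists (w : nat -> R -> U) (z z' : nat -> R -> X)
    (y : nat -> R -> Y), forall n : nat,
  [/\ vexpsum (w n),
      (sq_norm_L2 `[0%R, n%:R] (fun t => (w n t - v t)%R) <= (16^-1 ^+ n)%:E)%E,
      nrm (z n 0 - z0) <= 4^-1 ^+ n,
      is_C1 (z n) (z' n) &
      forall t : R, 0 <= t -> node S (z n t) (w n t) (z' n t) (y n t)].
Proof.
have [sv fv] := hv.
have /choice[q hq] : forall n : nat, exists q : (R -> U) * (R -> X) * (R -> X) * (R -> Y),
    [/\ vexpsum q.1.1.1,
      (sq_norm_L2 `[0%R, n%:R] (fun t => (q.1.1.1 t - v t)%R) <= (16^-1 ^+ n)%:E)%E,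
      nrm (q.1.1.2 0 - z0) <= 4^-1 ^+ n,
      is_C1 q.1.1.2 q.1.2 &
      forall t : R, 0 <= t -> node S (q.1.1.2 t) (q.1.1.1 t) (q.1.2 t) (q.2 t)].
  move=> n.
  have fn : (sq_norm_L2 `[0%R, n%:R] v < +oo)%E.
    exact: le_lt_trans (sq_norm_itv_half _ sv) fv.
  have [_ hap] := approximable_L2 sv fn.
  have e0 : 0 < (16^-1 : R) ^+ n by rewrite exprn_gt0 // invr_gt0.
  have d0 : 0 < (4^-1 : R) ^+ n by rewrite exprn_gt0 // invr_gt0.
  have [w hw wv] := hap _ e0; have [g hg] := vexpsum_trajectory hw.
  have [x Dx hx] := sg_dom_dense gen (ex_intro _ _ (alpha_rho S)) (z0 - g) d0.
  have [z [z' [y [C1z z_0 hn]]]] := hg x Dx.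
  exists (w, z, z', y); split=> //=; rewrite z_0 nrm_sym.
  by rewrite opprD addrA ltW.
by exists (fun n => (q n).1.1.1), (fun n => (q n).1.1.2), (fun n => (q n).1.2), (fun n => (q n).2).
Qed.

Lemma trajectory_exists : exists z y, [/\ trajectory S z0 v z y, in_L2 y &
  exists M : R, forall t : R, 0 <= t -> nrm (z t) <= M].
Proof.
have [sv fv] := hv; have [w [z [z' [y H]]]] := approximating_trajectories.
have h16 n : 0 < (16^-1 : R) ^+ n by rewrite exprn_gt0 // invr_gt0.
have h4 n : 0 < (4^-1 : R) ^+ n by rewrite exprn_gt0 // invr_gt0.
have p16 n : (16^-1 : R) ^+ n = (4^-1 ^+ n) ^+ 2.
  by rewrite -exprM mulnC exprM; congr (_ ^+ n); rewrite exprVn; congr (_^-1); ring.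
have s16 n : (16^-1 : R) ^+ n.+1 <= 16^-1 ^+ n.
  by rewrite exprS ler_piMl ?(ltW (h16 n)) // invf_le1 // ler1n.
have s4 n : (4^-1 : R) ^+ n.+1 <= 4^-1 ^+ n.
  by rewrite exprS ler_piMl ?(ltW (h4 n)) // invf_le1 // ler1n.
have C2w n : is_C2 (w n) by have [/vexpsum_C2] := H n.
have cw n : {within half_line, continuous (w n)} by have [w' [w'' [/C1_wc]]] := C2w n.
have cy n : {within half_line, continuous (y n)}.
  by have [_ _ _ C1z hn] := H n; exact: node_wc (C1_wc C1z) (cw n) (proj2 C1z) hn.
have sw n := sm_wc (cw n); have sy n := sm_wc (cy n).
(* Consecutive inputs are compared on [[0, n]] only, the common part of their horizons. *)
have hw n : (sq_norm_L2 `[0%R, n%:R] (fun t => (w n.+1 t - w n t)%R) <= (4 * 16^-1 ^+ n)%:E)%E.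
  apply: le_trans (sq_norm_triangle (mI _) (@IH _) (sw n.+1) (sw n) sv) _.
  have h1 : (sq_norm_L2 `[0%R, n%:R] (fun t => (w n.+1 t - v t)%R) <= (16^-1 ^+ n)%:E)%E.
    have nn : n%:R <= n.+1%:R :> R by rewrite ler_nat.
    apply: le_trans (sq_norm_itv_mono nn (smB (sw n.+1) sv)) _.
    by have [_ h _ _ _] := H n.+1; apply: le_trans h _; rewrite lee_fin.
  have h2 : (sq_norm_L2 `[0%R, n%:R] (fun t => (v t - w n t)%R) <= (16^-1 ^+ n)%:E)%E.
    by rewrite sq_norm_sym; have [] := H n.
  apply: (@le_trans _ _ (2%:E * ((16^-1 ^+ n)%:E + (16^-1 ^+ n)%:E))%E).
    by apply: lee_wpmul2l; [rewrite lee_fin|exact: leeD].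
  by rewrite -EFinD -EFinM lee_fin; move: (_ ^+ n) => p; lra.
(* One 4 bounds the squared difference of initial states and the other that of the inputs, both in
   units of [16^-n]. *)
pose C := 4 + 4 * a; have C0 : 0 <= C by rewrite addr_ge0 // mulr_ge0.
have C1 : 0 <= 1 + C := addr_ge0 ler01 C0.
have CC : C <= (1 + C) ^+ 2.
  by move: (C) C0 => c c0; have := sqr_ge0 c; rewrite sqrrD; lra.
have energy n (t : R) : 0 <= t <= n%:R ->
    nrm (z n.+1 t - z n t) ^+ 2 <= C * 16^-1 ^+ n /\
    (sq_norm_L2 `[0%R, t] (fun s => (y n.+1 s - y n s)%R) <= (C / b * 16^-1 ^+ n)%:E)%E.
  move=> /andP[t0 tn]; have [_ _ z1 D1 n1] := H n.+1; have [_ _ z2 D2 n2] := H n.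
  have cd : {within half_line, continuous (fun t => w n.+1 t - w n t)} by exact: wcB.
  have hd s : 0 <= s -> node S (z n.+1 s - z n s) (w n.+1 s - w n s) (z' n.+1 s - z' n s) (y n.+1 s - y n s).
    by move=> s0; apply: nodeB; [exact: n1|exact: n2].
  have d0 : nrm (z n.+1 0 - z n 0) ^+ 2 <= 4 * 16^-1 ^+ n.
    have h : nrm (z n.+1 0 - z n 0) <= 2 * 4^-1 ^+ n.
      apply: le_trans (nrm_triangle z0 _ _) _; rewrite (nrm_sym z0).
      by have := s4 n; lra.
    apply: (@le_trans _ _ ((2 * 4^-1 ^+ n) ^+ 2)).
      by rewrite lerXn2r ?nnegrE ?nrm_ge0 // mulr_ge0 // ltW.
    by rewrite exprMn p16 expr2 -natrM.
  have hq : (sq_norm_L2 `[0%R, t] (fun t => (w n.+1 t - w n t)%R) <= (4 * 16^-1 ^+ n)%:E)%E.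
    exact: le_trans (sq_norm_itv_mono tn (smB (sw n.+1) (sw n))) (hw n).
  have [h1 h2] := node_energy_le cd (C1B D1 D2) hd t0 d0 hq.
  rewrite mulrAC (_ : C * _ = 4 * 16^-1 ^+ n + a * (4 * 16^-1 ^+ n)) //.
  by rewrite /C; ring.
have [n t|n|yl syl cyl] := @riesz_fischer R Y y (C / b) (divr_ge0 C0 (ltW b0)) sy.
- by rewrite sq_norm_L2_wc // ltry.
- by have [] := energy n n%:R; rewrite ?ler0n ?lexx.
pose L := fine (sq_norm_L2 half_line v).
(* An energy bound independent of [n] and of the time: [|z_n(0)| <= |z0| + 1], and the input has
   squared norm at most [2 (1 + L)]. *)
pose M := (nrm z0 + 1) ^+ 2 + a * (2 * (1 + L)).
have L0 : 0 <= L by rewrite fine_ge0 // sq_norm_L2_ge0.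
have M0 : 0 <= M by rewrite addr_ge0 ?sqr_ge0 // !mulr_ge0 ?addr_ge0.
have bound n (t : R) : 0 <= t <= n%:R -> nrm (z n t) ^+ 2 <= M /\
    (sq_norm_L2 `[0%R, t] (y n) <= (M / b)%:E)%E.
  move=> /andP[t0 tn]; have [_ wv z1 C1z hn] := H n.
  apply: (node_energy_le (cw n) C1z hn t0).
    rewrite lerXn2r ?nnegrE ?nrm_ge0 ?addr_ge0 ?nrm_ge0 //.
    have := nrmD (z n 0 - z0) z0; rewrite subrK => /le_trans; apply.
    rewrite addrC lerD2l; apply: le_trans z1 _.
    by rewrite exprn_ile1 ?invr_ge0 // invf_le1 // ler1n.
  apply: le_trans (sq_norm_itv_mono tn (sw n)) _.
  have := sq_norm_D (mI n%:R) (@IH _) (smB (sw n) sv) sv.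
  under [X in (sq_norm_L2 _ X <= _)%E -> _]eq_fun do rewrite subrK.
  move=> /le_trans; apply; rewrite -[X in (_ <= X)%E]/(2%:E * (1%:E + L%:E))%E.
  apply: lee_wpmul2l; first by rewrite lee_fin.
  apply: leeD.
    by apply: le_trans wv _; rewrite lee_fin exprn_ile1 ?invr_ge0 // invf_le1 // ler1n.
  rewrite /L fineK; last by rewrite ge0_fin_numE // sq_norm_L2_ge0.
  exact: sq_norm_itv_half.
have /choice[zl hzl] : forall t : R, exists l : X, 0 <= t -> z n t @[n --> \oo] --> l.
  move=> t; have [t0|tn] := leP 0 t; last by exists 0.
  have [|l [hl _]] := @halving_cvg _ _ (z^~ t) (1 + C) (Num.bound t).
    move=> m tm; have tm' : t <= m%:R.
      by apply: le_trans (ltW (archi_boundP t0)) _; rewrite ler_nat.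
    have [h _] := energy m t (introT andP (conj t0 tm')).
    apply: (@le_trans _ _ ((1 + C) * 4^-1 ^+ m)).
      rewrite -(@ler_pXn2r _ 2) ?nnegrE ?nrm_ge0 ?mulr_ge0 ?(ltW (h4 m)) //.
      by apply: le_trans h _; rewrite exprMn p16 ler_wpM2r ?sqr_ge0.
    rewrite ler_wpM2l //.
    by rewrite lerXn2r ?nnegrE ?invr_ge0 // lef_pV2 ?posrE // ler_nat.
  by exists l.
have yL n : (sq_norm_L2 `[0%R, n%:R] yl <= (2 * (1 + M / b))%:E)%E.
  have c := cyl n%:R (ler0n R n).
  have h01 : (0%:E < (1 : R)%:E)%E by rewrite lte_fin.
  have /c[N _ hN] := open_ereal_lt' h01.
  (* One index for both purposes: [y m] is close to [yl] on [[0, n]], and its energy bound covers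
     that interval. *)
  pose m := maxn N n; have := hN m (leq_maxl N n); rewrite /= => /ltW h1.
  have nm : (n%:R : R) <= m%:R by rewrite ler_nat leq_maxr.
  have [_ h2] := bound m n%:R (introT andP (conj (ler0n R n) nm)).
  have := sq_norm_B (mI n%:R) (@IH _) (sy m) (smB (sy m) syl).
  under [X in (sq_norm_L2 _ X <= _)%E -> _]eq_fun do rewrite subKr.
  move=> /le_trans; apply; rewrite addeC -[X in (_ <= X)%E]/(2%:E * (1%:E + (M / b)%:E))%E.
  by apply: lee_wpmul2l; [rewrite lee_fin|exact: leeD].
exists zl, yl; split.
- split.
  + split=> // t t0; apply: le_lt_trans fv.
    exact: sq_norm_itv_half.
  + split=> // t t0; apply: le_lt_trans (ltry (2 * (1 + M / b))).
    exact: le_trans (sq_norm_itv_mono (ltW (archi_boundP t0)) syl) (yL _).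
  exists (fun n => z n 0), w, z, y; split=> //.
  + by move=> n; have [_ _ _ C1z hn] := H n; exact: node_classical (C2w n) C1z hn.
  + apply: cvg_pow2 => n; have [_ _ h _ _] := H n; apply: le_trans h _.
    by rewrite lerXn2r ?nnegrE ?invr_ge0 // lef_pV2 ?posrE // ler_nat.
  + move=> t t0; apply: (@cvge0_le _ _ (fun n => 16^-1 ^+ n)).
      by apply: cvg_expr; rewrite ger0_norm ?invr_ge0 // invf_lt1 // ltr1n.
    near=> n; have tn : t <= n%:R by near: n; exact: nbhs_infty_ger.
    rewrite sq_norm_L2_ge0 /=; have [_ h _ _ _] := H n; apply: le_trans h.
    exact: sq_norm_itv_mono tn (smB (sw n) sv).
- split=> //; apply: le_lt_trans (ltry (2 * (1 + M / b))).
  exact: sq_norm_half.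
- exists (M + 1) => t t0.
  have c : nrm (z n t) @[n --> \oo] --> nrm (zl t) by apply: cvg_nrm; exact: hzl.
  apply: (cvgr_to_le c).
  near=> n; have tn : t <= n%:R by near: n; exact: nbhs_infty_ger.
  have [h _] := bound n t (introT andP (conj t0 tn)).
  (* [M <= (M + 1)^2] makes [M + 1] a bound without a square root. *)
  rewrite -(@ler_pXn2r _ 2) ?nnegrE ?nrm_ge0 ?(addr_ge0 M0) //.
  apply: le_trans h _; move: (M) M0 => m m0; have := sqr_ge0 m; rewrite sqrrD; lra.
Unshelve. all: by end_near.
Qed.

End Input.

Lemma in_L2_0 (V : completeNormedModType R[i]) : in_L2 (fun _ : R => 0 : V).
Proof.
split; first exact/sm_simple/simple_cst.
rewrite /sq_norm_L2 nrm0 expr0n integral_cst ?mul0e ?ltry //.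
exact: half_line_measurable.
Qed.

Lemma dissipative_stable : system_stable S.
Proof.
split; first exact: dissipative_well_posed diss.
- by move=> v hv; have [z [y [tr _ hM]]] := trajectory_exists 0 hv; exists z, y.
- by move=> z0; have [z [y [tr hy _]]] := trajectory_exists z0 (in_L2_0 U); exists z, y.
- by move=> v hv; have [z [y [tr hy _]]] := trajectory_exists 0 hv; exists z, y.
Qed.

End Stability.

Theorem theorem1p2 (R : realType) (U X : hilbertType R) (S : sysnode U X U)
    (hS : exists2 E : U -> U, bounded_linear E &
       forall z0 u z y (tau : R), classical_trajectory S z0 u z y -> 0 <= tau ->
         nrm (z tau) ^+ 2 - nrm z0 ^+ 2 <=
           2 * (\int[lebesgue_measure]_(t in `[0, tau]) re_inner (u t) (y t))
           + 2 * (\int[lebesgue_measure]_(t in `[0, tau])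
                    re_inner (E (u t)) (u t))) :
  exists2 kappa0 : \bar R, (0 < kappa0)%E &
    forall kappa : R, 0 < kappa -> (kappa%:E < kappa0)%E ->
      let K := fun y : U => - (kappa%:C *: y) in
      well_posed_feedback S K /\
      forall SK : sysnode U X U, closed_loop S K SK ->
        system_stable SK /\ contraction_semigroup (semigroup SK).
Proof.
have [E bE hE] := hS.
have [_ [M0 M00 hM0]] := proj1 (bounded_linearP _) bE.
(* The added 1 makes [M] positive even for [E = 0], so the threshold [1 / M] is always finite. *)
pose M := M0 + 1; have M1 : 0 < M by rewrite ltr_wpDl.
have pas x u z y : node S x u z y -> re_inner x z <= re_inner u y + M * nrm u ^+ 2.
  move=> /(node_passive bE hE)/le_trans; apply; rewrite lerD2l.
  apply: le_trans (ri_le _ _) _; rewrite expr2 mulrA ler_wpM2r ?nrm_ge0 //.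
  by apply: le_trans (hM0 u) _; rewrite ler_wpM2r ?nrm_ge0 // lerDl.
exists (M^-1)%:E => [|k k0]; first by rewrite lte_fin invr_gt0.
rewrite lte_fin => kM K; have km : k * M < 1 by rewrite -ltr_pdivlMr // div1r.
(* Proved for every node satisfying [closed_loop]; it also supplies well-posedness of the
   constructed one. *)
have stable SK : closed_loop S K SK -> system_stable SK /\ contraction_semigroup (semigroup SK).
  move=> /(closed_loop_dissipative pas k0 km)[a a0 [b b0 diss]].
  by split; [exact: (dissipative_stable a0 b0 diss)|exact: (dissipative_semigroup b0 diss)].
split=> //; split; first exact: fbK_bl.
have [SK hSK] := closed_loop_exists pas k0 km.
by exists SK => //; have [[]] := stable SK hSK.
Qed.
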